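(* Let $g_{\mathrm{BL}}$ be a Brill-Lindquist metric with sources $\mathcal P_*$. (1) Fix $p_i\in\mathcal P_{**}$. There exists a constant $C$ of class $\mathscr C(i)$ and a value of $\varepsilon>0$ which is small relative to $\mathscr C(i)$ with the following property: if $\frac{\alpha_i+\beta_i}{\sigma_i}<\varepsilon$ then there exists a function $\mathcal S_i:S^2\to(0,\infty)$ for which the image $\Sigma_i$ of $\omega\mapsto p_i+\mathcal S_i(\omega)\omega$ is a minimal surface for $g_{\mathrm{BL}}$. Furthermore: (a) $\Sigma_i$ is located in the region $$\Big((\hat\chi^{(i)}\hat\psi^{(i)})^{-1/2}-C\tfrac{\alpha_i+\beta_i}{\sigma_i}\Big)\sqrt{\alpha_i\beta_i}\le|x-p_i|\le\Big((\hat\chi^{(i)}\hat\psi^{(i)})^{-1/2}+C\tfrac{\alpha_i+\beta_i}{\sigma_i}\Big)\sqrt{\alpha_i\beta_i};$$ (b) $\Sigma_i$ is the only minimal surface contained entirely within $|x-p_i|\le\sigma_i/C$. (2) Suppose $p_i\in\mathcal P_*\smallsetminus\mathcal P_{**}$. There exists a constant $C$ of class $\mathscr C(i)$ and a value of $\varepsilon>0$ which is small relative to $\mathscr C(i)$ with the following property: if $\frac{\alpha_i+\beta_i}{\sigma_i}<\varepsilon$ then there are no minimal surfaces which are contained entirely within $|x-p_i|\le\sigma_i/C$.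
   Context: Brill-Lindquist metric: let $\mathcal P_*=\{p_i\}\subset\mathbb R^3$ be a finite set of points and $\alpha_i,\beta_i\ge0$ with at least one of $\alpha_i,\beta_i$ non-zero for each $i$. Put $\chi_{\mathrm{BL}}(x)=1+\sum_i\frac{\alpha_i}{|x-p_i|}$, $\psi_{\mathrm{BL}}(x)=1+\sum_i\frac{\beta_i}{|x-p_i|}$ and $g_{\mathrm{BL}}=(\chi_{\mathrm{BL}}\psi_{\mathrm{BL}})^2g_{\mathbb E}$ on $\mathbb R^3\smallsetminus\mathcal P_*$, where $g_{\mathbb E}$ is the Euclidean metric. Let $\mathcal P_{**}=\{p_i:\alpha_i\beta_i\ne0\}$, $\sigma_i=\min_{j\ne i}|p_i-p_j|$, and $\hat\chi^{(i)}=1+\sum_{j\ne i}\frac{\alpha_j}{|p_i-p_j|}$, $\hat\psi^{(i)}=1+\sum_{j\ne i}\frac{\beta_j}{|p_i-p_j|}$. A constant of class $\mathscr C(i)$ is a polynomial expression in $\hat\chi^{(i)}$, $\hat\psi^{(i)}$, $\frac{\alpha_i+\beta_i}{\sigma_i}$ whose coefficients are fixed universal non-negative real numbers (universal: the polynomial does not depend on the configuration of points, on the parameters, or on $i$). A value $\varepsilon>0$ is small relative to $\mathscr C(i)$ if $1/\varepsilon$ is bounded above by an element of class $\mathscr C(i)$. A minimal surface is a smooth, immersed, closed (compact, without boundary) surface in $\mathbb R^3\smallsetminus\mathcal P_*$ of zero mean curvature with respect to $g_{\mathrm{BL}}$. *)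

(* Defs.v *)
From HB Require Import structures.
From mathcomp Require Import all_boot all_order all_algebra.
From mathcomp Require Import all_classical all_reals all_analysis.

Set Implicit Arguments.
Unset Strict Implicit.
Unset Printing Implicit Defensive.

Import Order.TTheory GRing.Theory Num.Theory.
Import numFieldNormedType.Exports.

Local Open Scope classical_set_scope.
Local Open Scope ring_scope.

(* The library norm on ['rV[R]_n] is the sup norm; it induces the usual
   topology, but lengths have to be Euclidean. *)
Definition enorm (R : realType) (n : nat) (v : 'rV[R]_n) : R :=
  Num.sqrt (\sum_(k < n) v 0 k ^+ 2).

Definition eucl_dist (R : realType) (n : nat) (x y : 'rV[R]_n) : R := enorm (x - y).

Definition unit_sphere (R : realType) : set 'rV[R]_3 := [set w | enorm w = 1].

Section Smoothness.
Context {R : realType} {m : nat} {W : normedModType R}.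

Definition pderiv (a : 'I_m) (f : 'rV[R]_m -> W) : 'rV[R]_m -> W :=
  'D_(delta_mx 0 a) f.

(* Only used with [U] open; [f] may take arbitrary values outside [U]. *)
Fixpoint Ck_on (k : nat) (U : set 'rV[R]_m) (f : 'rV[R]_m -> W) : Prop :=
  if k is k'.+1 then
    forall a : 'I_m, (forall u, U u -> derivable f u (delta_mx 0 a)) /\
                     Ck_on k' U (pderiv a f)
  else forall u, U u -> {for u, continuous f}.

Definition smooth_on (U : set 'rV[R]_m) (f : 'rV[R]_m -> W) : Prop :=
  forall k, Ck_on k U f.

End Smoothness.

Section Metric.
Context {R : realType}.

(* A Riemannian metric on an open subset of R^3, in Cartesian coordinates. *)
Definition metric := 'rV[R]_3 -> 'M[R]_3.

Definition inner (G : 'M[R]_3) (v w : 'rV[R]_3) : R := (v *m G *m w^T) 0 0.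

Definition christoffel (g : metric) (x : 'rV[R]_3) (k i j : 'I_3) : R :=
  2^-1 * \sum_(l < 3) invmx (g x) k l *
    (pderiv i (fun y => g y j l) x + pderiv j (fun y => g y i l) x
     - pderiv l (fun y => g y i j) x).

(* Below, [f] is a local parametrization of a surface in R^3. *)

(* The ambient covariant derivative, along [f], of [pderiv b f] in the
   direction [pderiv a f]. *)
Definition cov_hessian (g : metric) (f : 'rV[R]_2 -> 'rV[R]_3)
    (u : 'rV[R]_2) (a b : 'I_2) : 'rV[R]_3 :=
  pderiv a (pderiv b f) u +
  \row_(k < 3) \sum_(i < 3) \sum_(j < 3)
    christoffel g (f u) k i j * pderiv a f u 0 i * pderiv b f u 0 j.

Definition first_form (g : metric) (f : 'rV[R]_2 -> 'rV[R]_3)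
    (u : 'rV[R]_2) : 'M[R]_2 :=
  \matrix_(a < 2, b < 2) inner (g (f u)) (pderiv a f u) (pderiv b f u).

Definition unit_normal (g : metric) (f : 'rV[R]_2 -> 'rV[R]_3)
    (u : 'rV[R]_2) (nu : 'rV[R]_3) : Prop :=
  (forall a : 'I_2, inner (g (f u)) (pderiv a f u) nu = 0) /\
  inner (g (f u)) nu nu = 1.

Definition second_form (g : metric) (f : 'rV[R]_2 -> 'rV[R]_3)
    (u : 'rV[R]_2) (nu : 'rV[R]_3) : 'M[R]_2 :=
  \matrix_(a < 2, b < 2) inner (g (f u)) (cov_hessian g f u a b) nu.

Definition mean_curvature (g : metric) (f : 'rV[R]_2 -> 'rV[R]_3)
    (u : 'rV[R]_2) (nu : 'rV[R]_3) : R :=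
  \tr (invmx (first_form g f u) *m second_form g f u nu).

End Metric.
Arguments metric R : clear implicits.

Section Surfaces.
Context {R : realType}.

Record chart (M : topologicalType) := Chart {
  chart_dom : set M;
  chart_img : set 'rV[R]_2;
  chart_map : M -> 'rV[R]_2;
  chart_par : 'rV[R]_2 -> M;
  chart_dom_open : open chart_dom;
  chart_img_open : open chart_img;
  chart_map_img : forall x, chart_dom x -> chart_img (chart_map x);
  chart_par_dom : forall u, chart_img u -> chart_dom (chart_par u);
  chart_mapK : forall x, chart_dom x -> chart_par (chart_map x) = x;
  chart_parK : forall u, chart_img u -> chart_map (chart_par u) = u;
  chart_map_continuous : {within chart_dom, continuous chart_map};
  chart_par_continuous : {within chart_img, continuous chart_par} }.

Definition smooth_atlas (M : topologicalType) (A : set (chart M)) : Prop :=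
  (forall x : M, exists2 c, A c & chart_dom c x) /\
  (forall c d, A c -> A d ->
     smooth_on (chart_img c `&` chart_par c @^-1` chart_dom d)
               (chart_map d \o chart_par c)).

(* Second countability follows from compactness.  Connectedness is not
   required, but the empty surface is excluded. *)
Record closed_surface := ClosedSurface {
  surface_sort :> topologicalType;
  atlas : set (chart surface_sort);
  atlas_smooth : smooth_atlas atlas;
  surface_nonempty : [set: surface_sort] !=set0;
  surface_hausdorff : hausdorff_space surface_sort;
  surface_compact : compact [set: surface_sort] }.

Definition smooth_immersion (M : closed_surface) (F : M -> 'rV[R]_3) : Prop :=
  forall c, atlas c ->
    smooth_on (chart_img c) (F \o chart_par c) /\
    forall u, chart_img c u ->
      \rank (\matrix_(a < 2) pderiv a (F \o chart_par c) u) = 2%N.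

Definition zero_mean_curvature (g : metric R) (M : closed_surface)
    (F : M -> 'rV[R]_3) : Prop :=
  forall c, atlas c -> forall u, chart_img c u ->
  forall nu, unit_normal g (F \o chart_par c) u nu ->
    mean_curvature g (F \o chart_par c) u nu = 0.

End Surfaces.
Arguments closed_surface R : clear implicits.

Record brill_lindquist (R : realType) (n : nat) := BrillLindquist {
  pt : 'I_n -> 'rV[R]_3;
  alpha : 'I_n -> R;
  beta : 'I_n -> R;
  pt_inj : injective pt;
  alpha_ge0 : forall i, 0 <= alpha i;
  beta_ge0 : forall i, 0 <= beta i;
  alpha_beta_neq0 : forall i, alpha i != 0 \/ beta i != 0 }.

Section BrillLindquist.
Context {R : realType} {n : nat}.
Variable B : brill_lindquist R n.

Definition chiBL (x : 'rV[R]_3) : R :=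
  1 + \sum_(i < n) alpha B i / eucl_dist x (pt B i).

Definition psiBL (x : 'rV[R]_3) : R :=
  1 + \sum_(i < n) beta B i / eucl_dist x (pt B i).

Definition gBL : metric R := fun x => ((chiBL x * psiBL x) ^+ 2)%:M.

Definition minimal_surface (S : set 'rV[R]_3) : Prop :=
  exists (M : closed_surface R) (F : M -> 'rV[R]_3),
    [/\ smooth_immersion F,
        (forall x i, F x <> pt B i),
        zero_mean_curvature gBL F
      & S = range F].

Definition chi_hat (i : 'I_n) : R :=
  1 + \sum_(j < n | j != i) alpha B j / eucl_dist (pt B i) (pt B j).

Definition psi_hat (i : 'I_n) : R :=
  1 + \sum_(j < n | j != i) beta B j / eucl_dist (pt B i) (pt B j).

(* [+oo] when [pt B i] is the only source, in which case [mass_ratio i] is 0. *)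
Definition sigmaBL (i : 'I_n) : \bar R :=
  \big[Order.min/+oo%E]_(j < n | j != i) (eucl_dist (pt B i) (pt B j))%:E.

Definition mass_ratio (i : 'I_n) : R :=
  fine ((alpha B i + beta B i)%:E / sigmaBL i)%E.

(* The closed region |x - p_i| <= sigma_i / C, for C > 0. *)
Definition near_source (i : 'I_n) (C : R) : set 'rV[R]_3 :=
  [set x | ((eucl_dist x (pt B i))%:E <= sigmaBL i / C%:E)%E].

End BrillLindquist.

(* Real polynomials in three variables, as iterated univariate polynomials. *)
Notation poly3 R := {poly {poly {poly R}}}.

Definition nneg_coefs (R : realType) (P : poly3 R) : Prop :=
  forall i j k : nat, 0 <= P`_i`_j`_k.

Definition eval3 (R : realType) (P : poly3 R) (x y z : R) : R :=
  P.[x%:P%:P].[y%:P].[z].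

(* The element of class C(i) determined by the universal polynomial [P]. *)
Definition class_value (R : realType) (P : poly3 R) (n : nat)
    (B : brill_lindquist R n) (i : 'I_n) : R :=
  eval3 P (chi_hat B i) (psi_hat B i) (mass_ratio B i).

(* Main.v *)
(* Write x = p_i + z.  In the conformal metric Om^2 g_E, Om = chi psi, the mean curvature of a level set
   of h with gradient N is, up to a positive factor,
     |N|^2 tr (Hess h) - (Hess h)(N, N) + 2 |N|^2 <grad Om, N> / Om.
   For h(z) = |z| k(z / |z|) the first two terms depend only on the direction once multiplied by |z|,
   while t <grad Om, N> / Om + k is strictly increasing along the ray t = |z|.  So if the radial graph
   {h = r1} is minimal, every other leaf {h = r} near p_i is strictly mean convex or concave, and
   evaluating at the maximum and the minimum of h on a closed minimal surface forces h = r1 there.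
   If alpha_i beta_i = 0, the round spheres k = 1 are already strictly mean convex.

   The minimal radial graph |z| = r1 / k is found as a fixed point.  With F = (Cas / c - 1)(k - 1),
   Cas the Laplacian of the sphere written with rotation fields X_a, the equation expresses F as a small
   nonlinear function of F, of first and second rotational derivatives of k, and of the ratios
   g_j = |p_j - p_i| / |p_j - x|, which satisfy a quadratic equation.  Everything takes place in the
   Banach algebra of noncommutative power series: the X_a are skew derivations of each homogeneous
   part, so the energy identity bounds k - 1, X_a k and X_a X_b k by F, and k is analytic. *)

Require Import Defs.
From HB Require Import structures.
From mathcomp Require Import all_boot all_order all_algebra.
From mathcomp Require Import all_classical all_reals all_analysis.
From mathcomp Require Import ring lra.

Set Implicit Arguments.
Unset Strict Implicit.
Unset Printing Implicit Defensive.

Import Order.TTheory GRing.Theory Num.Theory.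
Import numFieldNormedType.Exports.

Local Open Scope classical_set_scope.
Local Open Scope ring_scope.

(** * Noncommutative power series *)

(** The constants have to be universal although the ratio of [alpha] to [beta] at the source is
    arbitrary. The linearised equation is [cas - c] with [c = 4 / (2 + kap1 + kap2)], and [c] has no
    positive lower bound, so a crude bound for the inverse would degenerate. Writing the right side
    as [c F] cures this: [v], [rot v / sqrt c] and [rot rot v / c] are all bounded by [F] with
    constant 1, and the quadratic terms of the equation contain exactly the matching powers of [c].
    The ratios [g j] are unknowns of the system, not functions of [k], so that inverse distances
    obey polynomial equations and the fixed point map is a polynomial in the algebra of series. They
    enter the equation for [F] linearly; dividing [g j - 1] by a small [delta] makes this coupling
    count as second order. The number and strength of the other sources disappear by dividing each
    potential by its hatted value at [p_i]: the remaining weights then sum to at most 1. This is why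
    constant polynomials serve for both [C] and the bound on [1 / eps]. *)

Section Words.
Context {R : realType}.

(* Power series in three noncommuting variables, indexed by words.  Unlike commuting coordinates they
   make the l2 norm of each homogeneous part submultiplicative. *)
Definition ser := seq 'I_3 -> R.
Implicit Types f g h : ser.

Definition slice (i : 'I_3) f : ser := fun s => f (i :: s).
Definition sc (a : R) f : ser := fun s => a * f s.

(** The l2 inner product of the coefficients on words of length [k]. Peeling off first letters makes
    every fact about degree [k] an induction on [k]. *)
Fixpoint ip (k : nat) f g : R :=
  if k is k'.+1 then \sum_(i < 3) ip k' (slice i f) (slice i g)
  else f [::] * g [::].

Definition nrm k f := Num.sqrt (ip k f f).

(** The weighted l1 sum of the l2 norms of the homogeneous parts, bounded through partial sums; a
    divergent series satisfies no such bound, so this also carries convergence for [|x| <= w]. *)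
Definition nle (w : R) f (M : R) :=
  forall K, \sum_(k < K) w ^+ k * nrm k f <= M.

Lemma eqle (x y : R) : x = y -> x <= y.
Proof. by move=> ->. Qed.

Lemma eq_ip k f f' g g' :
  (forall s, size s = k -> f s = f' s) -> (forall s, size s = k -> g s = g' s) ->
  ip k f g = ip k f' g'.
Proof.
elim: k f f' g g' => [|k IH] f f' g g' ff gg /=; first by rewrite ff ?gg.
apply: eq_bigr => i _; apply: IH => s ss; rewrite /slice.
  by apply: ff; rewrite /= ss.
by apply: gg; rewrite /= ss.
Qed.

Lemma ipC k f g : ip k f g = ip k g f.
Proof.
by elim: k f g => [|k IH] f g /=; [rewrite mulrC | apply: eq_bigr => i _].
Qed.

Lemma ipDl k f f' g : ip k (f + f') g = ip k f g + ip k f' g.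
Proof.
elim: k f f' g => [|k IH] f f' g /=; first by rewrite -mulrDl.
by rewrite -big_split /=; apply: eq_bigr => i _; rewrite -IH.
Qed.

Lemma ipZl k a f g : ip k (sc a f) g = a * ip k f g.
Proof.
elim: k f g => [|k IH] f g /=; first by rewrite /sc mulrA.
by rewrite mulr_sumr; apply: eq_bigr => i _; rewrite -IH.
Qed.

Lemma ipDr k f g g' : ip k f (g + g') = ip k f g + ip k f g'.
Proof. by rewrite ipC ipDl !(ipC k f). Qed.

Lemma ipZr k a f g : ip k f (sc a g) = a * ip k f g.
Proof. by rewrite ipC ipZl ipC. Qed.

Lemma scN1 f : sc (-1) f = - f.
Proof. by apply/funext => s; rewrite /sc mulN1r. Qed.

Lemma ip0l k g : ip k 0 g = 0.
Proof.
have -> : (0 : ser) = sc 0 0 by apply/funext => s; rewrite /sc mul0r.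
by rewrite ipZl mul0r.
Qed.

Lemma ip_suml (I : Type) (r : seq I) (P : pred I) k (F : I -> ser) g :
  ip k (\sum_(i <- r | P i) F i) g = \sum_(i <- r | P i) ip k (F i) g.
Proof.
by elim/big_rec2: _ => [|i x y _ <-]; [rewrite ip0l | rewrite ipDl].
Qed.

Lemma ip_ge0 k f : 0 <= ip k f f.
Proof.
elim: k f => [|k IH] f /=; first by rewrite -expr2 sqr_ge0.
by apply: sumr_ge0 => i _.
Qed.

Lemma ip_CS k f g : ip k f g ^+ 2 <= ip k f f * ip k g g.
Proof.
have H t : 0 <= ip k f f + 2 * t * ip k f g + t ^+ 2 * ip k g g.
  have := ip_ge0 k (f + sc t g).
  rewrite !ipDl !ipDr !ipZl !ipZr (ipC k g f) => /le_trans; apply.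
  by apply: eqle; ring.
have [g0|g0] := eqVneq (ip k g g) 0.
  have [->|n0] := eqVneq (ip k f g) 0; first by rewrite expr0n /= mulr_ge0 ?ip_ge0.
  (* When [ip k g g = 0] the quadratic is affine in [t], and this [t] would give it the value -1. *)
  have := H (- (ip k f f + 1) / (2 * ip k f g)).
  have -> : 2 * (- (ip k f f + 1) / (2 * ip k f g)) * ip k f g = - (ip k f f + 1).
    by field.
  rewrite g0; lra.
have gp : 0 < ip k g g by rewrite lt_def g0 ip_ge0.
have := H (- ip k f g / ip k g g).
have -> : ip k f f + 2 * (- ip k f g / ip k g g) * ip k f g +
  (- ip k f g / ip k g g) ^+ 2 * ip k g g
  = (ip k f f * ip k g g - ip k f g ^+ 2) / ip k g g by field.
by rewrite pmulr_lge0 ?invr_gt0 // subr_ge0.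
Qed.

Lemma nrm_ge0 k f : 0 <= nrm k f.
Proof. exact: sqrtr_ge0. Qed.

Lemma nrm_sq k f : nrm k f ^+ 2 = ip k f f.
Proof. by rewrite sqr_sqrtr ?ip_ge0. Qed.

Lemma eq_nrm k f f' : (forall s, size s = k -> f s = f' s) -> nrm k f = nrm k f'.
Proof. by move=> ff; rewrite /nrm (eq_ip ff ff). Qed.

Lemma nrmD k f g : nrm k (f + g) <= nrm k f + nrm k g.
Proof.
rewrite -(@ler_pXn2r _ 2) ?nnegrE ?addr_ge0 ?nrm_ge0 //.
rewrite sqrrD !nrm_sq ipDl !ipDr (ipC k g f).
have : ip k f g <= nrm k f * nrm k g.
  rewrite (le_trans (ler_norm _)) // -(@ler_pXn2r _ 2) ?nnegrE ?mulr_ge0 ?nrm_ge0 //.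
  by rewrite exprMn !nrm_sq real_normK ?num_real // ip_CS.
rewrite -[_ *+ 2]mulr_natr; lra.
Qed.

Lemma nrmZ k a f : nrm k (sc a f) = `|a| * nrm k f.
Proof.
by rewrite /nrm ipZl ipZr mulrA -expr2 sqrtrM ?sqr_ge0 // sqrtr_sqr.
Qed.

Lemma nrmN k f : nrm k (- f) = nrm k f.
Proof. by rewrite -scN1 nrmZ normrN1 mul1r. Qed.

Lemma nrm0 k : nrm k 0 = 0.
Proof. by rewrite /nrm ip0l sqrtr0. Qed.

Lemma nrm_sum (I : Type) (r : seq I) (P : pred I) k (F : I -> ser) :
  nrm k (\sum_(i <- r | P i) F i) <= \sum_(i <- r | P i) nrm k (F i).
Proof.
elim/big_ind2: _ => [|x1 x2 y1 y2 h1 h2|//]; first by rewrite nrm0.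
by rewrite (le_trans (nrmD _ _ _)) // lerD.
Qed.

Lemma coef_le_nrm f s : `|f s| <= nrm (size s) f.
Proof.
rewrite -(@ler_pXn2r _ 2) ?nnegrE ?nrm_ge0 // nrm_sq real_normK ?num_real //.
elim: s f => [|i s IH] f /=; first by rewrite expr2.
rewrite (bigD1 i) //= (le_trans (IH (slice i f))) // lerDl.
by apply: sumr_ge0 => j _; apply: ip_ge0.
Qed.

Section NormBounds.
Variable w : R.
Hypothesis w1 : 1 <= w.

Let w0 : 0 <= w. Proof. exact: le_trans w1. Qed.

Lemma nle_ge0 f M : nle w f M -> 0 <= M.
Proof. by move=> /(_ 0); rewrite big_ord0. Qed.

Lemma nle_le f M M' : nle w f M -> M <= M' -> nle w f M'.
Proof. by move=> fM MM K; apply: le_trans MM. Qed.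

Lemma nleD f g M N : nle w f M -> nle w g N -> nle w (f + g) (M + N).
Proof.
move=> fM gN K; apply: (le_trans _ (lerD (fM K) (gN K))).
rewrite -big_split /=; apply: ler_sum => k _.
by rewrite -mulrDr ler_wpM2l ?exprn_ge0 ?nrmD.
Qed.

Lemma nleN f M : nle w f M -> nle w (- f) M.
Proof. by move=> fM K; under eq_bigr do rewrite nrmN. Qed.

Lemma nleZ a f M : nle w f M -> nle w (sc a f) (`|a| * M).
Proof.
move=> fM K; under eq_bigr do rewrite nrmZ mulrCA.
by rewrite -mulr_sumr ler_wpM2l.
Qed.

Lemma nle0 : nle w 0 0.
Proof. by move=> K; rewrite big1 // => k _; rewrite nrm0 mulr0. Qed.

Lemma nle_sum (I : Type) (r : seq I) (P : pred I) (F : I -> ser) (M : I -> R) :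
  (forall i, P i -> nle w (F i) (M i)) ->
  nle w (\sum_(i <- r | P i) F i) (\sum_(i <- r | P i) M i).
Proof.
move=> H; elim/big_ind2: _ => [|x1 x2 y1 y2 h1 h2|//]; first exact: nle0.
exact: nleD.
Qed.

Lemma nle_coef f M s : nle w f M -> `|f s| <= M.
Proof.
move=> /(_ (size s).+1); rewrite big_ord_recr /=; apply: le_trans.
have h : nrm (size s) f <= w ^+ size s * nrm (size s) f.
  by rewrite ler_peMl ?nrm_ge0 // exprn_ege1.
rewrite (le_trans (coef_le_nrm f s)) // (le_trans h) // lerDr.
by apply: sumr_ge0 => k _; rewrite mulr_ge0 ?exprn_ge0 ?nrm_ge0.
Qed.

End NormBounds.

Lemma nle_nrm w f g M a : 0 <= w -> 0 <= a ->
  (forall k, nrm k g <= a * nrm k f) -> nle w f M -> nle w g (a * M).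
Proof.
move=> w0 a0 H fM K; apply: (@le_trans _ _ (a * \sum_(k < K) w ^+ k * nrm k f)).
  rewrite mulr_sumr; apply: ler_sum => k _.
  by rewrite mulrCA ler_wpM2l ?exprn_ge0.
by rewrite ler_wpM2l.
Qed.

Definition tens (j : nat) f g : ser := fun s => f (take j s) * g (drop j s).

Definition mul f g : ser := fun s => \sum_(j < (size s).+1) tens j f g s.

(** A word of length [j + m] splits uniquely after [j] letters, so the sum over words factors. *)
Lemma ip_tens j m f f' g g' :
  ip (j + m) (tens j f g) (tens j f' g') = ip j f f' * ip m g g'.
Proof.
elim: j f f' => [|j IH] f f' /=.
  rewrite -mulrA (mulrC (f' _)) mulrCA mulrA.
  have -> : tens 0 f g = sc (f [::]) g.
    by apply/funext => s; rewrite /tens take0 drop0.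
  have -> : tens 0 f' g' = sc (f' [::]) g'.
    by apply/funext => s; rewrite /tens take0 drop0.
  by rewrite add0n ipZl ipZr; ring.
by rewrite mulr_suml; apply: eq_bigr => i _; rewrite -IH.
Qed.

Lemma nrm_tens j m f g : nrm (j + m) (tens j f g) = nrm j f * nrm m g.
Proof. by rewrite /nrm ip_tens sqrtrM ?ip_ge0. Qed.

Lemma mul_deg n f g s : size s = n -> mul f g s = (\sum_(j < n.+1) tens j f g) s.
Proof. by move=> <-; rewrite fct_sumE. Qed.

Lemma nrm_mul n f g :
  nrm n (mul f g) <= \sum_(j < n.+1) nrm j f * nrm (n - j) g.
Proof.
rewrite (eq_nrm (@mul_deg n f g)) (le_trans (nrm_sum _ _ _ _)) //.
apply: ler_sum => j _; have jn : (j <= n)%N by rewrite -ltnS.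
by have := nrm_tens j (n - j) f g; rewrite (subnKC jn) => ->.
Qed.

Lemma cauchy_le (a b : nat -> R) K : (forall n, 0 <= a n) -> (forall n, 0 <= b n) ->
  \sum_(n < K) \sum_(j < n.+1) a j * b (n - j)%N <=
  (\sum_(n < K) a n) * (\sum_(n < K) b n).
Proof.
move=> a0 b0; elim: K => [|K IH]; first by rewrite !big_ord0 mul0r.
have E : \sum_(n < K.+1) \sum_(j < n.+1) a j * b (n - j)%N =
         \sum_(j < K.+1) a j * \sum_(m < (K.+1 - j)%N) b m.
  elim: {IH} K => [|K IH].
    by rewrite !big_ord1 /= ?subn0 ?big_ord1.
  rewrite big_ord_recr /= IH.
  under [RHS]eq_bigr => j _.
    have jK : (j <= K.+1)%N by rewrite -ltnS.
    rewrite subSn // big_ord_recr /= mulrDr; over.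
  rewrite big_split /=; congr (_ + _).
  by rewrite [RHS]big_ord_recr /= subnn big_ord0 mulr0 addr0.
rewrite {IH}E mulr_suml; apply: ler_sum => j _; rewrite ler_wpM2l //.
rewrite (big_ord_widen K.+1 (fun m => b m)) ?leq_subr //.
by rewrite [leRHS](bigID (fun m : 'I_K.+1 => (m < K.+1 - j)%N)) /= lerDl sumr_ge0.
Qed.

Lemma nle_mul w f g M N : 0 <= w -> nle w f M -> nle w g N -> nle w (mul f g) (M * N).
Proof.
move=> w0 fM gN K.
apply: (@le_trans _ _ ((\sum_(n < K) w ^+ n * nrm n f) * (\sum_(n < K) w ^+ n * nrm n g))).
  apply: (le_trans _ (@cauchy_le (fun n => w ^+ n * nrm n f)
    (fun n => w ^+ n * nrm n g) K _ _)) => [|n|n].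
  - apply: ler_sum => n _; apply: (@le_trans _ _ (w ^+ n * \sum_(j < n.+1) nrm j f * nrm (n - j) g)).
      by rewrite ler_wpM2l ?exprn_ge0 ?nrm_mul.
    rewrite mulr_sumr; apply: ler_sum => j _; have jn : (j <= n)%N by rewrite -ltnS.
    have -> : w ^+ n = w ^+ j * w ^+ (n - j) by rewrite -exprD subnKC.
    by apply: eqle; ring.
  - by rewrite mulr_ge0 ?exprn_ge0 ?nrm_ge0.
  - by rewrite mulr_ge0 ?exprn_ge0 ?nrm_ge0.
apply: ler_pM => //; by apply: sumr_ge0 => n _; rewrite mulr_ge0 ?exprn_ge0 ?nrm_ge0.
Qed.

Lemma ser_mulDl f f' g : mul (f + f') g = mul f g + mul f' g.
Proof.
apply/funext => s; rewrite /mul [RHS]/GRing.add /= -big_split /=.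
by apply: eq_bigr => j _; rewrite /tens -mulrDl.
Qed.

Lemma ser_mulDr f g g' : mul f (g + g') = mul f g + mul f g'.
Proof.
apply/funext => s; rewrite /mul [RHS]/GRing.add /= -big_split /=.
by apply: eq_bigr => j _; rewrite /tens -mulrDr.
Qed.

Lemma ser_mulNl f g : mul (- f) g = - mul f g.
Proof.
apply/funext => s; rewrite /mul [RHS]/GRing.opp /= -sumrN.
by apply: eq_bigr => j _; rewrite /tens -mulNr.
Qed.

Lemma ser_mulNr f g : mul f (- g) = - mul f g.
Proof.
apply/funext => s; rewrite /mul [RHS]/GRing.opp /= -sumrN.
by apply: eq_bigr => j _; rewrite /tens -mulrN.
Qed.

Definition cst_ser (a : R) : ser := fun s => if s is [::] then a else 0.

Definition lin_ser (d : 'rV[R]_3) : ser := fun s => if s is [:: j] then d 0 j else 0.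

Lemma ip_vanish k f g : (forall s, size s = k -> f s = 0) -> ip k f g = 0.
Proof. by move=> f0; rewrite (@eq_ip k f 0 g g) ?ip0l. Qed.

Lemma nrm_cst k a : nrm k (cst_ser a) = if k is 0 then `|a| else 0.
Proof.
case: k => [|k]; first by rewrite /nrm /= -expr2 sqrtr_sqr.
by rewrite /nrm ip_vanish ?sqrtr0 // => -[|? ?].
Qed.

Lemma nrm_lin k d : nrm k (lin_ser d) = if k is 1 then enorm d else 0.
Proof.
case: k => [|[|k]].
- by rewrite /nrm /= mulr0 sqrtr0.
- by rewrite /nrm /enorm /=; under eq_bigr do rewrite /slice /= -expr2.
- by rewrite /nrm ip_vanish ?sqrtr0 // => -[|? [|? ?]].
Qed.

Lemma nle_cst w a : nle w (cst_ser a) `|a|.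
Proof.
case=> [|K]; first by rewrite big_ord0.
rewrite big_ord_recl /= nrm_cst expr0 mul1r big1 ?addr0 // => i _.
by rewrite nrm_cst mulr0.
Qed.

Lemma enorm_ge0 n (d : 'rV[R]_n) : 0 <= enorm d.
Proof. exact: sqrtr_ge0. Qed.

Lemma nle_lin w d : 0 <= w -> nle w (lin_ser d) (w * enorm d).
Proof.
move=> w0 [|[|K]]; first by rewrite big_ord0 mulr_ge0 ?enorm_ge0.
  by rewrite big_ord1 nrm_lin mulr0 mulr_ge0 ?enorm_ge0.
rewrite 2!big_ord_recl /= !nrm_lin mulr0 add0r expr1 big1 ?addr0 // => i _.
by rewrite nrm_lin mulr0.
Qed.

End Words.
Arguments ser R : clear implicits.

(** * Coefficientwise limits and the contraction principle *)

Section Completeness.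
Context {R : realType}.
Implicit Types f g : ser R.

Lemma cvg_sumr {T : Type} {G : set_system T} {FG : Filter G}
    (I : Type) (r : seq I) (F : I -> T -> R) (l : I -> R) :
  (forall i, F i n @[n --> G] --> l i) ->
  (\sum_(i <- r) F i n) @[n --> G] --> \sum_(i <- r) l i.
Proof.
move=> H; elim: r => [|i r IH].
  rewrite big_nil; under eq_fun do rewrite big_nil; exact: cvg_cst.
rewrite big_cons; under eq_fun do rewrite big_cons.
by apply: cvgD.
Qed.

Lemma ip_cvg k (u : nat -> ser R) f :
  (forall s, u n s @[n --> \oo] --> f s) ->
  ip k (u n) (u n) @[n --> \oo] --> ip k f f.
Proof.
elim: k u f => [|k IH] u f H /=; first by apply: cvgM.
apply: (@cvg_sumr _ _ _ _ _ (fun i n => ip k (slice i (u n)) (slice i (u n)))) => i.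
by apply: IH => s; apply: H.
Qed.

Lemma nle_lim w (u : nat -> ser R) f M :
  (forall s, u n s @[n --> \oo] --> f s) ->
  (\forall n \near \oo, nle w (u n) M) -> nle w f M.
Proof.
move=> H uM K.
apply: (@cvgr_to_le nat \oo _ R (fun n => \sum_(k < K) w ^+ k * nrm k (u n))).
  apply: (@cvg_sumr _ _ _ 'I_K (index_enum 'I_K) (fun k n => w ^+ k * nrm k (u n))
    (fun k => w ^+ k * nrm k f)) => k.
  apply: cvgMr; apply: continuous_cvg; first exact: sqrt_continuous.
  exact: ip_cvg.
by near=> n; move: K; near: n.
Unshelve. all: by end_near.
Qed.

(** The iterates of [0] stay in the ball of radius [2 * d0], the only region where the contraction
    is used. They converge coefficient by coefficient, and [nle] bounds survive such limits, with
    constants uniform in [i]. *)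
Lemma banach_ser (I : Type) (w : R) (P : (I -> ser R) -> I -> ser R) (d0 delta : R) :
  1 <= w -> 0 <= d0 -> 2 * d0 <= delta ->
  (forall i, nle w (P 0 i) d0) ->
  (forall U V d, (forall i, nle w (U i) delta) -> (forall i, nle w (V i) delta) ->
     (forall i, nle w (U i - V i) d) -> forall i, nle w (P U i - P V i) (d / 2)) ->
  exists U : I -> ser R, (forall i, nle w (U i) (2 * d0)) /\ P U = U.
Proof.
move=> w1 d00 d0d P0 Plip.
have w0 : 0 <= w by lra.
pose U n := iter n P (0 : I -> ser R).
have half0 n : 0 <= (2^-1 : R) ^+ n by rewrite exprn_ge0.
have sub0 (X : I -> ser R) i : X i - (0 : I -> ser R) i = X i by rewrite subr0.
have z_le M i : 0 <= M -> nle w ((0 : I -> ser R) i) M.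
  by move=> ?; apply: (@nle_le _ _ _ 0) => //; exact: nle0.
have stay V i : (forall i, nle w (V i) (2 * d0)) -> nle w (P V i) (2 * d0).
  move=> HV; rewrite -[P V i](subrK (P 0 i)).
  apply: (@nle_le _ _ _ (2 * d0 / 2 + d0)); last by lra.
  apply: nleD => //; apply: Plip => [j|j|j].
  - exact: (nle_le (HV j)).
  - by apply: z_le; lra.
  - by rewrite sub0.
have UB n i : nle w (U n i) (2 * d0).
  elim: n i => [|n IH] i /=; first by apply: z_le; lra.
  by apply: stay.
have UBd n i : nle w (U n i) delta by apply: (nle_le (UB n i)).
have step n i : nle w (U n.+1 i - U n i) (d0 * 2^-1 ^+ n).
  elim: n i => [|n IH] i; first by rewrite /= expr0 mulr1 sub0.
  by rewrite exprSr mulrA; apply: (Plip (U n.+1) (U n)).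
have far n m i : nle w (U (n + m)%N i - U n i) (2 * d0 * 2^-1 ^+ n).
  (* The factor [1 - 2^-1 ^+ m] is the exact geometric sum, which makes the induction on [m]
     close. *)
  suff H : nle w (U (n + m)%N i - U n i) (2 * d0 * 2^-1 ^+ n * (1 - 2^-1 ^+ m)).
    apply: (nle_le H); apply: ler_piMr; last by rewrite lerBlDr lerDl.
    by rewrite !mulr_ge0.
  elim: m => [|m IH].
    by rewrite addn0 subrr expr0 subrr mulr0; exact: nle0.
  rewrite addnS -(subrK (U (n + m)%N i) (U (n + m).+1 i)) -addrA.
  apply: (nle_le (nleD w1 (step (n + m)%N i) IH)).
  by apply: eqle; rewrite exprD exprSr; field.
have cv i s : cvgn (fun n => U n i s).
  pose a n := U n.+1 i s - U n i s.
  have cva : cvgn (series a).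
    apply: normed_cvg; apply: (@series_le_cvg _ _ (geometric d0 2^-1)) => [n|n|n|].
    - exact: normr_ge0.
    - by rewrite /geometric /= mulr_ge0.
    - by rewrite /geometric /=; apply: (nle_coef w1 s (step n i)).
    - by apply: is_cvg_geometric_series; rewrite ger0_norm //; lra.
  have -> : (fun n => U n i s) = (fun n => series a n + U 0 i s).
    apply/funext => n; rewrite seriesEnat /= telescope_sumr // subrK //.
  by apply: is_cvgD => //; apply: is_cvg_cst.
pose L i s := limn (fun n => U n i s).
have UL i s : U n i s @[n --> \oo] --> L i s by exact: cv.
have close n i : nle w (L i - U n i) (2 * d0 * 2^-1 ^+ n).
  apply: (@nle_lim _ (fun m => U m i - U n i)) => [s|].
    by apply: cvgB; [exact: UL | exact: cvg_cst].
  exists n => // m /= nm; rewrite -(subnKC nm); exact: far.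
have LB i : nle w (L i) (2 * d0).
  by have := close 0 i; rewrite expr0 mulr1 sub0.
exists L; split => //; apply/funext => i; apply/funext => s.
apply/eqP; rewrite -subr_eq0 -normr_le0; apply/ler_addgt0Pl => e e0; rewrite addr0.
have [n _ Hn] : \forall n \near \oo, `|0 - geometric (2 * d0) 2^-1 n| < e.
  apply: cvgr_dist_lt => //; apply: cvg_geometric; rewrite ger0_norm; lra.
have := Hn n (leqnn n); rewrite /geometric /= sub0r normrN ger0_norm => [he|]; last first.
  by rewrite mulr_ge0 //; lra.
have H : nle w (P L i - L i) (2 * d0 * 2^-1 ^+ n / 2 + 2 * d0 * 2^-1 ^+ n.+1).
  rewrite -(subrK (P (U n) i) (P L i)) -addrA; apply: nleD => //.
    apply: (Plip L (U n)) => // j; exact: (nle_le (LB j)).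
  rewrite -opprB; apply: nleN; exact: (close n.+1 i).
apply: (le_trans (nle_coef w1 s H)); apply: (le_trans _ (ltW he)).
by apply: eqle; rewrite exprSr; field.
Qed.

End Completeness.

(** * Rotation fields and the energy identity *)

Section Rotations.
Context {R : realType}.
Implicit Types f g : ser R.

Definition o0 : 'I_3 := @Ordinal 3 0 isT.
Definition o1 : 'I_3 := @Ordinal 3 1 isT.
Definition o2 : 'I_3 := @Ordinal 3 2 isT.

Lemma sum3 (V : nmodType) (F : 'I_3 -> V) : \sum_i F i = F o0 + F o1 + F o2.
Proof.
rewrite !big_ord_recr big_ord0 /= add0r.
by congr (_ + _ + _); congr F; apply: val_inj.
Qed.

Lemma ord3E (P : 'I_3 -> Prop) : P o0 -> P o1 -> P o2 -> forall i, P i.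
Proof.
move=> p0 p1 p2 [[|[|[|//]]] h].
- by rewrite (_ : Ordinal h = o0) //; apply: val_inj.
- by rewrite (_ : Ordinal h = o1) //; apply: val_inj.
- by rewrite (_ : Ordinal h = o2) //; apply: val_inj.
Qed.

(** The Levi-Civita symbol. *)
Definition lc (a b c : 'I_3) : R :=
  match val a, val b, val c with
  | 0%N, 1%N, 2%N | 1%N, 2%N, 0%N | 2%N, 0%N, 1%N => 1
  | 0%N, 2%N, 1%N | 2%N, 1%N, 0%N | 1%N, 0%N, 2%N => -1
  | _, _, _ => 0
  end.

Lemma lcC a i j : lc a i j = - lc a j i.
Proof.
by move: a i j; do 3![elim/ord3E]; rewrite /lc /= ?oppr0 ?opprK.
Qed.

(** The commutation relations of so(3) on a single letter; the recursion of [rot] over letters lifts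
    them to [rot_comm]. *)
Lemma lc_comm a b i k :
  \sum_(j < 3) lc a i j * lc b j k - \sum_(j < 3) lc b i j * lc a j k =
  - \sum_(c < 3) lc a b c * lc c i k.
Proof.
by move: a b i k; do 4![elim/ord3E]; rewrite !sum3 /lc /=; ring.
Qed.

(* On polynomials this is the derivative along the rotation field x |-> e_a * x (cross product),
   see [ev_rot]. *)
Fixpoint rot (a : 'I_3) (f : ser R) (s : seq 'I_3) : R :=
  if s is i :: s' then rot a (slice i f) s' + \sum_(j < 3) lc a i j * f (j :: s')
  else 0.

Lemma rotD a f g : rot a (f + g) = rot a f + rot a g.
Proof.
apply/funext => s; elim: s f g => [|i s IH] f g /=; first by rewrite addrfctE addr0.
rewrite [LHS](_ : _ = rot a (slice i f + slice i g) s + \sum_j lc a i j * (f + g) (j :: s)) //.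
rewrite IH /= !addrfctE /= addrACA -big_split /=; congr (_ + _).
by apply: eq_bigr => j _; rewrite mulrDr.
Qed.

Lemma rotZ a c f : rot a (sc c f) = sc c (rot a f).
Proof.
apply/funext => s; elim: s f => [|i s IH] f /=; first by rewrite /sc mulr0.
rewrite [LHS](_ : _ = rot a (sc c (slice i f)) s + \sum_j lc a i j * (c * f (j :: s))) //.
rewrite IH /sc /= mulrDr mulr_sumr; congr (_ + _).
by apply: eq_bigr => j _; ring.
Qed.

Lemma rotN a f : rot a (- f) = - rot a f.
Proof. by rewrite -scN1 rotZ scN1. Qed.

Lemma rotB a f g : rot a (f - g) = rot a f - rot a g.
Proof. by rewrite rotD rotN. Qed.

Lemma slice_rot a i f :
  slice i (rot a f) = rot a (slice i f) + \sum_(j < 3) sc (lc a i j) (slice j f).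
Proof. by apply/funext => s; rewrite addrfctE fct_sumE. Qed.

(** [rot a] acts letter by letter through the antisymmetric matrix [lc a], so it generates rotations
    of the space of tensors of degree [k]. *)
Lemma rot_skew k a f g : ip k (rot a f) g = - ip k f (rot a g).
Proof.
elim: k f g => [|k IH] f g /=; first by rewrite mul0r mulr0 oppr0.
under eq_bigr do rewrite slice_rot ipDl IH ip_suml.
under [in RHS]eq_bigr do rewrite slice_rot ipDr (ipC _ _ (\sum__ _)) ip_suml.
rewrite !big_split /= sumrN opprD; congr (_ + _).
rewrite exchange_big -sumrN /=; apply: eq_bigr => i _.
rewrite -sumrN; apply: eq_bigr => j _.
by rewrite !ipZl (ipC _ (slice j g)) lcC mulNr.
Qed.

Lemma rot_comm a b f :
  rot a (rot b f) - rot b (rot a f) = - \sum_(c < 3) sc (lc a b c) (rot c f).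
Proof.
apply/funext => s; rewrite !(addrfctE, opprfctE) fct_sumE; elim: s f => [|i s IH] f /=.
  by rewrite subrr big1 ?oppr0 // => c _; rewrite /sc mulr0.
rewrite !slice_rot !rotD !addrfctE !sum3 !rotD !rotZ /sc !addrfctE /=.
have := IH (slice i f); rewrite !sum3 /sc => IHi.
have E (j : 'I_3) := lc_comm a b i j.
have E0 := E o0; have E1 := E o1; have E2 := E o2; rewrite !sum3 in E0 E1 E2.
transitivity (rot a (rot b (slice i f)) s - rot b (rot a (slice i f)) s
  + (lc a i o0 * lc b o0 o0 + lc a i o1 * lc b o1 o0 + lc a i o2 * lc b o2 o0 -
     (lc b i o0 * lc a o0 o0 + lc b i o1 * lc a o1 o0 + lc b i o2 * lc a o2 o0)) * f (o0 :: s)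
  + (lc a i o0 * lc b o0 o1 + lc a i o1 * lc b o1 o1 + lc a i o2 * lc b o2 o1 -
     (lc b i o0 * lc a o0 o1 + lc b i o1 * lc a o1 o1 + lc b i o2 * lc a o2 o1)) * f (o1 :: s)
  + (lc a i o0 * lc b o0 o2 + lc a i o1 * lc b o1 o2 + lc a i o2 * lc b o2 o2 -
     (lc b i o0 * lc a o0 o2 + lc b i o1 * lc a o1 o2 + lc b i o2 * lc a o2 o2)) * f (o2 :: s)).
  rewrite /slice; ring.
by rewrite E0 E1 E2 IHi /slice; ring.
Qed.

Definition cas f : ser R := \sum_(a < 3) rot a (rot a f).

Lemma casD f g : cas (f + g) = cas f + cas g.
Proof. by rewrite /cas -big_split; apply: eq_bigr => a _; rewrite !rotD. Qed.

Lemma casZ c f : cas (sc c f) = sc c (cas f).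
Proof.
rewrite /cas; under eq_bigr do rewrite !rotZ.
by apply/funext => s; rewrite /sc !fct_sumE mulr_sumr.
Qed.

Lemma casB f g : cas (f - g) = cas f - cas g.
Proof. by rewrite casD -!scN1 casZ. Qed.

(** The Casimir element is central: the commutators with [rot b] cancel in pairs because [lc] is
    totally antisymmetric. *)
Lemma cas_comm b f : rot b (cas f) = cas (rot b f).
Proof.
apply/funext => s.
have C a g : rot a (rot b g) s = rot b (rot a g) s - \sum_(c < 3) lc a b c * rot c g s.
  have /(congr1 (fun h => h s)) := rot_comm a b g.
  by rewrite !(addrfctE, opprfctE) fct_sumE => <-; rewrite [RHS]addrC subrK.
have D a g : rot a (rot b g) = rot b (rot a g) - \sum_(c < 3) sc (lc a b c) (rot c g).
  by rewrite -rot_comm [RHS]addrC subrK.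
rewrite /cas !sum3 !rotD !addrfctE !D !rotB !sum3 !rotD !rotZ !(addrfctE, opprfctE) /sc.
rewrite !C !sum3; move: b {C D}; elim/ord3E; rewrite /lc /=; ring.
Qed.

Lemma eq_rot k a f g : (forall s, size s = k -> f s = g s) ->
  forall s, size s = k -> rot a f s = rot a g s.
Proof.
elim: k f g => [|k IH] f g fg [|i s] //= [ss].
congr (_ + _); last by apply: eq_bigr => j _; rewrite fg //= ss.
by apply: IH => // s' ss'; apply: fg; rewrite /= ss'.
Qed.

Lemma eq_cas k f g : (forall s, size s = k -> f s = g s) ->
  forall s, size s = k -> cas f s = cas g s.
Proof.
move=> fg s ss; rewrite /cas !fct_sumE; apply: eq_bigr => a _.
by apply: (@eq_rot k) => //; apply: eq_rot.
Qed.

Lemma ip_cas k f g : ip k (cas f) g = - \sum_(a < 3) ip k (rot a f) (rot a g).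
Proof.
by rewrite ip_suml -sumrN; apply: eq_bigr => a _; rewrite rot_skew.
Qed.

Section Energy.
Variables (c : R) (k : nat) (f g : ser R).
Hypothesis c0 : 0 < c.
Hypothesis solve : forall s, size s = k -> cas g s - c * g s = c * f s.

Let dirichlet_ge0 : 0 <= \sum_(a < 3) ip k (rot a g) (rot a g).
Proof. by apply: sumr_ge0 => a _; apply: ip_ge0. Qed.

(* The rotations are skew for [ip], so this is [|cas g - c g|^2 = c^2 |f|^2] expanded; it bounds
   [g] and its first two rotational derivatives. *)
Let balance : c ^+ 2 * ip k f f =
  ip k (cas g) (cas g) + 2 * c * \sum_(a < 3) ip k (rot a g) (rot a g) + c ^+ 2 * ip k g g.
Proof.
have E : ip k (cas g + sc (- c) g) (cas g + sc (- c) g) = ip k (sc c f) (sc c f).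
  by apply: eq_ip => s ss; rewrite addrfctE /sc mulNr solve.
move: E; rewrite !ipDl !ipDr !ipZl !ipZr (ipC k g (cas g)) (ip_cas k g g) => E.
by rewrite expr2 -mulrA -E; ring.
Qed.

Lemma energy0 : nrm k g <= nrm k f.
Proof.
rewrite -(@ler_pXn2r _ 2) ?nnegrE ?nrm_ge0 // !nrm_sq.
rewrite -(ler_pM2l (exprn_gt0 2 c0)) balance lerDr addr_ge0 ?ip_ge0 //.
by rewrite mulr_ge0 // mulr_ge0 // ltW.
Qed.

(** Keeping only the Dirichlet term of [balance] gives [c |rot a g|^2 <= c^2 |f|^2]. The gain of
    [Num.sqrt c] is what keeps the later estimates uniform as [c] tends to 0. *)
Lemma energy1 a : nrm k (rot a g) <= Num.sqrt c * nrm k f.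
Proof.
rewrite -(@ler_pXn2r _ 2) ?nnegrE ?mulr_ge0 ?sqrtr_ge0 ?nrm_ge0 //.
rewrite exprMn !nrm_sq (sqr_sqrtr (ltW c0)) -(ler_pM2l c0) mulrA -expr2 balance.
apply: (@le_trans _ _ (2 * c * \sum_(a < 3) ip k (rot a g) (rot a g))); last first.
  by rewrite -addrA addrCA lerDl addr_ge0 ?ip_ge0 // mulr_ge0 ?ip_ge0 ?sqr_ge0.
have h : ip k (rot a g) (rot a g) <= \sum_(a < 3) ip k (rot a g) (rot a g).
  by rewrite (bigD1 a) //= lerDl; apply: sumr_ge0 => j _; apply: ip_ge0.
rewrite -mulrA mulrCA ler_wpM2l ?(ltW c0) // (le_trans h) // ler_peMl //; lra.
Qed.

(** Moving one rotation across the inner product and commuting it with [cas] shows that [|cas g|^2]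
    equals the sum of the squares of all second rotational derivatives. *)
Lemma energy2 a b : nrm k (rot a (rot b g)) <= c * nrm k f.
Proof.
rewrite -(@ler_pXn2r _ 2) ?nnegrE ?mulr_ge0 ?(ltW c0) ?nrm_ge0 //.
rewrite exprMn !nrm_sq balance.
apply: (@le_trans _ _ (ip k (cas g) (cas g))); last first.
  rewrite -addrA lerDl addr_ge0 // mulr_ge0 ?ip_ge0 ?sqr_ge0 //.
  by rewrite mulr_ge0 // ltW.
have E : ip k (cas g) (cas g) =
    \sum_(b < 3) \sum_(a < 3) ip k (rot a (rot b g)) (rot a (rot b g)).
  rewrite [in LHS]/cas ip_suml; apply: eq_bigr => e _.
  by rewrite rot_skew cas_comm ipC ip_cas opprK.
rewrite E (bigD1 b) //= (bigD1 a) //= -addrA lerDl addr_ge0 //.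
  by apply: sumr_ge0 => j _; apply: ip_ge0.
by apply: sumr_ge0 => i _; apply: sumr_ge0 => j _; apply: ip_ge0.
Qed.

End Energy.

Section FiniteDegree.
Variables (k : nat) (c : R).
Let V : vectType R := {ffun k.-tuple 'I_3 -> R^o}.

Definition ext_ser (v : V) : ser R :=
  fun s => if insub s is Some t then v (t : k.-tuple 'I_3) else 0.

Definition cas_map (v : V) : V :=
  [ffun t : k.-tuple 'I_3 => cas (ext_ser v) t - c * ext_ser v t].

Lemma cas_map_linear : linear cas_map.
Proof.
move=> a u v; apply/ffunP => t; rewrite !ffunE.
have -> : ext_ser (a *: u + v) = sc a (ext_ser u) + ext_ser v.
  apply/funext => s; rewrite addrfctE /sc /ext_ser.
  by case: insub => [t'|]; rewrite ?ffunE // mulr0 addr0.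
rewrite casD casZ !addrfctE /sc /GRing.scale /=; ring.
Qed.

HB.instance Definition _ := GRing.isLinear.Build R V V *:%R cas_map cas_map_linear.

(** By [energy0] the operator [cas - c] is injective on the coefficients of degree [k], a
    finite-dimensional space, hence invertible there. *)
Lemma cas_solve f : 0 < c ->
  exists g, forall s, size s = k -> cas g s - c * g s = c * f s.
Proof.
move=> c0.
have inj : injective (linfun cas_map).
  apply: raddf_inj => v v0'; apply/ffunP => t; rewrite ffunE.
  have v0 : cas_map v = 0 by rewrite -(lfunE (cas_map : {linear V -> V})); exact: v0'.
  have H s : size s = k -> cas (ext_ser v) s - c * ext_ser v s = c * (0 : ser R) s.
    move=> ss; rewrite mulr0.
    have := congr1 (fun u : V => u (Tuple (introT eqP ss))) v0.
    by rewrite !ffunE.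
  have := energy0 c0 H; rewrite nrm0 => n0.
  have := coef_le_nrm (ext_ser v) t; rewrite size_tuple => /le_trans/(_ n0).
  by rewrite normr_le0 /ext_ser valK => /eqP.
have ker0 : lker (linfun cas_map) == 0%VS by apply/lker0P.
pose u : V := [ffun t : k.-tuple 'I_3 => c * f t].
exists (ext_ser ((linfun cas_map)^-1%VF u)) => s ss.
have := lker0_lfunVK ker0 u; rewrite (lfunE (cas_map : {linear V -> V})) => E.
have := congr1 (fun w : V => w (Tuple (introT eqP ss))) E.
by rewrite !ffunE.
Qed.

End FiniteDegree.

(** [cas] preserves word length, so the solutions found in the separate degrees can be glued. *)
Lemma resolvent c : 0 < c -> exists T : ser R -> ser R,
  forall f s, cas (T f) s - c * T f s = c * f s.
Proof.
move=> c0.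
pose G f k := sval (cid (@cas_solve k c f c0)).
have GP f k s : size s = k -> cas (G f k) s - c * G f k s = c * f s.
  by rewrite /G; case: cid => g /= gP; apply: gP.
exists (fun f s => G f (size s) s) => f s.
rewrite -(GP f (size s)) //; congr (_ - _).
by apply: (@eq_cas (size s)) => // s' ->.
Qed.

End Rotations.

(** * Evaluation of series *)

Section CauchyProduct.
Context {R : realType}.
Implicit Types a b : nat -> R.

Lemma cauchy_triangle a b K :
  \sum_(n < K) \sum_(j < n.+1) a j * b (n - j)%N =
  \sum_(j < K) a j * \sum_(m < (K - j)%N) b m.
Proof.
elim: K => [|K IH]; first by rewrite !big_ord0.
rewrite big_ord_recr /= IH.
under [RHS]eq_bigr => j _.
  have jK : (j <= K)%N by rewrite -ltnS.
  rewrite subSn // big_ord_recr /= mulrDr; over.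
rewrite big_split /=; congr (_ + _).
by rewrite [RHS]big_ord_recr /= subnn big_ord0 mulr0 addr0.
Qed.

(** Both gaps run over the same index pairs, those of the square outside the triangle, so the signed
    gap is dominated by the absolute one. *)
Lemma cauchy_gap a b K :
  `|(\sum_(n < K) a n) * (\sum_(n < K) b n) -
    \sum_(n < K) \sum_(j < n.+1) a j * b (n - j)%N| <=
  (\sum_(n < K) `|a n|) * (\sum_(n < K) `|b n|) -
    \sum_(n < K) \sum_(j < n.+1) `|a j| * `|b (n - j)%N|.
Proof.
rewrite !cauchy_triangle (cauchy_triangle (fun n => `|a n|) (fun n => `|b n|)).
have E (u v : nat -> R) : (\sum_(n < K) u n) * (\sum_(n < K) v n) -
    \sum_(j < K) u j * \sum_(m < (K - j)%N) v m =
    \sum_(j < K) u j * \sum_(m < K | ~~ (m < K - j)%N) v m.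
  rewrite mulr_suml -sumrB; apply: eq_bigr => j _; rewrite -mulrBr; congr (_ * _).
  rewrite [X in _ - X](big_ord_widen K (fun m => v m)) ?leq_subr //.
  by rewrite (bigID (fun m : 'I_K => (m < K - j)%N)) /= addrAC subrr add0r.
rewrite E (E (fun n => `|a n|) (fun n => `|b n|)).
apply: (le_trans (ler_norm_sum _ _ _)); apply: ler_sum => j _.
by rewrite normrM ler_wpM2l // ler_norm_sum.
Qed.

(** The square of side [K] lies inside the triangle of side [K + K]. Together with [cauchy_le] this
    squeezes the absolute Cauchy product onto the product of the sums. *)
Lemma cauchy_half a b K : (forall n, 0 <= a n) -> (forall n, 0 <= b n) ->
  (\sum_(n < K) a n) * (\sum_(n < K) b n) <=
  \sum_(n < K + K) \sum_(j < n.+1) a j * b (n - j)%N.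
Proof.
move=> a0 b0; rewrite cauchy_triangle big_split_ord /= mulr_suml.
rewrite -[leLHS]addr0 lerD //; last first.
  by apply: sumr_ge0 => j _; rewrite mulr_ge0 // sumr_ge0.
apply: ler_sum => j _; rewrite ler_wpM2l //.
have -> : (K + K - j = K + (K - j))%N by rewrite addnBA // ltnW.
by rewrite big_split_ord /= lerDl sumr_ge0.
Qed.

Lemma cauchy_product a b (A B : R) :
  cvgn (series (fun n => `|a n|)) -> cvgn (series (fun n => `|b n|)) ->
  series a n @[n --> \oo] --> A -> series b n @[n --> \oo] --> B ->
  series (fun n => \sum_(j < n.+1) a j * b (n - j)%N) n @[n --> \oo] --> A * B.
Proof.
move=> ca cb cA cB.
pose na n := `|a n|; pose nb n := `|b n|.
pose P n := series na n * series nb n.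
pose C := series (fun n => \sum_(j < n.+1) na j * nb (n - j)%N).
have na0 n : 0 <= na n by exact: normr_ge0.
have nb0 n : 0 <= nb n by exact: normr_ge0.
have mono (u : nat -> R) : (forall n, 0 <= u n) -> {homo series u : n m / (n <= m)%N >-> n <= m}.
  move=> u0 n m nm; rewrite /series /= (big_cat_nat (leq0n n) nm) /= lerDl.
  by apply: sumr_ge0.
have Pl : P n @[n --> \oo] --> limn (series na) * limn (series nb) by apply: cvgM.
have CP n : C n <= P n.
  by rewrite /C /P /series /= !big_mkord; apply: cauchy_le.
have PC n : P n <= C (n + n)%N.
  by rewrite /C /P /series /= !big_mkord; apply: cauchy_half.
have homC : {homo C : n m / (n <= m)%N >-> n <= m}.
  by apply: mono => n; apply: sumr_ge0 => j _; rewrite mulr_ge0.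
have Pbd n : P n <= limn (series na) * limn (series nb).
  apply: ler_pM.
  - by rewrite /series /= sumr_ge0.
  - by rewrite /series /= sumr_ge0.
  - by apply: nondecreasing_cvgn_le => //; apply: mono.
  - by apply: nondecreasing_cvgn_le => //; apply: mono.
have cC : cvgn C.
  apply: nondecreasing_is_cvgn => //.
  exists (limn (series na) * limn (series nb)) => _ [n _ <-].
  exact: le_trans (CP n) (Pbd n).
have PCgap : (P n - C n) @[n --> \oo] --> 0.
  have CL : limn C = limn (series na) * limn (series nb).
    apply/eqP; rewrite eq_le; apply/andP; split.
      by apply: limr_le => //; near=> n; exact: le_trans (CP n) (Pbd n).
    apply: (@cvgr_to_le nat \oo _ R P) => //.
    near=> n; apply: (le_trans (PC n)); exact: nondecreasing_cvgn_le.
  rewrite -[X in _ --> X](subrr (limn C)); apply: cvgB; last exact: cC.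
  by rewrite CL.
have AB : (series a n * series b n) @[n --> \oo] --> A * B by apply: cvgM.
pose D n := series (fun n => \sum_(j < n.+1) a j * b (n - j)%N) n.
have gap : (D n - series a n * series b n) @[n --> \oo] --> 0.
  apply/cvgr0Pnorm_lt => e e0.
  have : \forall n \near \oo, `|P n - C n| < e by move/cvgr0Pnorm_lt: PCgap; apply.
  apply: filterS => n; apply: le_lt_trans.
  rewrite distrC (le_trans _ (ler_norm _)) //.
  rewrite /D /P /C /series /= !big_mkord.
  exact: cauchy_gap.
rewrite (_ : (fun n => _) = fun n => (D n - series a n * series b n) + series a n * series b n).
  by rewrite -[A * B]add0r; apply: cvgD.
by apply/funext => n; rewrite subrK.
Unshelve. all: by end_near.
Qed.

End CauchyProduct.

(** * Values of series at points *)

Section Evaluation.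
Context {R : realType}.
Implicit Types (f g : ser R) (x y h : 'rV[R]_3).

Lemma enorm_sq n (x : 'rV[R]_n) : enorm x ^+ 2 = \sum_(k < n) x 0 k ^+ 2.
Proof. by rewrite sqr_sqrtr // sumr_ge0 // => k _; exact: sqr_ge0. Qed.

Fixpoint evk (k : nat) f x : R :=
  if k is k'.+1 then \sum_(i < 3) x 0 i * evk k' (slice i f) x else f [::].

Fixpoint devk (k : nat) f x h : R :=
  if k is k'.+1 then
    \sum_(i < 3) (h 0 i * evk k' (slice i f) x + x 0 i * devk k' (slice i f) x h)
  else 0.

(** The partial derivative on words: the coefficient at [s] sums [f] over all ways to insert the
    letter [b] into [s]. *)
Fixpoint der (b : 'I_3) f (s : seq 'I_3) : R :=
  if s is i :: s' then f (b :: i :: s') + der b (slice i f) s' else f [:: b].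

Lemma wsum_le k f x (t : 'I_3 -> R) c : 0 <= c ->
  (forall i, `|t i| <= c * nrm k (slice i f)) ->
  `|\sum_(i < 3) x 0 i * t i| <= enorm x * c * nrm k.+1 f.
Proof.
move=> c0 H.
rewrite -(@ler_pXn2r _ 2) ?nnegrE ?mulr_ge0 ?enorm_ge0 ?nrm_ge0 //.
rewrite real_normK ?num_real // !exprMn enorm_sq nrm_sq /= !sum3.
have S i : t i ^+ 2 <= c ^+ 2 * ip k (slice i f) (slice i f).
  rewrite -nrm_sq -exprMn -[t i ^+ 2]real_normK ?num_real //.
  by rewrite ler_pXn2r ?nnegrE ?mulr_ge0 ?nrm_ge0 // H.
have CS : (x 0 o0 * t o0 + x 0 o1 * t o1 + x 0 o2 * t o2) ^+ 2 <=
   (x 0 o0 ^+ 2 + x 0 o1 ^+ 2 + x 0 o2 ^+ 2) * (t o0 ^+ 2 + t o1 ^+ 2 + t o2 ^+ 2).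
  rewrite -subr_ge0 (_ : _ - _ = (x 0 o0 * t o1 - x 0 o1 * t o0) ^+ 2 +
    (x 0 o0 * t o2 - x 0 o2 * t o0) ^+ 2 + (x 0 o1 * t o2 - x 0 o2 * t o1) ^+ 2); last by ring.
  by rewrite !addr_ge0 ?sqr_ge0.
apply: (le_trans CS); rewrite -mulrA ler_wpM2l ?addr_ge0 ?sqr_ge0 //.
by rewrite !mulrDr !lerD.
Qed.

Lemma evk_le k f x : `|evk k f x| <= enorm x ^+ k * nrm k f.
Proof.
elim: k f => [|k IH] f /=.
  by rewrite expr0 mul1r /nrm /= -expr2 sqrtr_sqr.
rewrite exprS; apply: wsum_le => [|i]; first by rewrite exprn_ge0 ?enorm_ge0.
exact: IH.
Qed.

Lemma eq_evk k f g x : (forall s, size s = k -> f s = g s) -> evk k f x = evk k g x.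
Proof.
elim: k f g => [|k IH] f g fg /=; first exact: fg.
by apply: eq_bigr => i _; congr (_ * _); apply: IH => s ss; apply: fg; rewrite /= ss.
Qed.

Lemma evkD k f g x : evk k (f + g) x = evk k f x + evk k g x.
Proof.
elim: k f g => [//|k IH] f g /=; rewrite -big_split; apply: eq_bigr => i _ /=.
by rewrite -mulrDr -IH.
Qed.

Lemma evkZ k c f x : evk k (sc c f) x = c * evk k f x.
Proof.
elim: k f => [//|k IH] f /=; rewrite mulr_sumr; apply: eq_bigr => i _ /=.
by rewrite mulrCA -IH.
Qed.

Lemma evk_sum (I : Type) (r : seq I) (P : pred I) k (F : I -> ser R) x :
  evk k (\sum_(i <- r | P i) F i) x = \sum_(i <- r | P i) evk k (F i) x.
Proof.
elim/big_rec2: _ => [|i u v _ <-]; last by rewrite evkD.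
have -> : (0 : ser R) = sc 0 0 by apply/funext => s; rewrite /sc mul0r.
by rewrite evkZ mul0r.
Qed.

Lemma evk_tens j m f g x : evk (j + m) (tens j f g) x = evk j f x * evk m g x.
Proof.
elim: j f => [|j IH] f /=.
  rewrite -evkZ add0n; congr (evk _ _ _).
  by apply/funext => s; rewrite /tens /sc take0 drop0.
rewrite mulr_suml; apply: eq_bigr => i _.
by rewrite -mulrA -IH.
Qed.

Lemma evk_mul k f g x :
  evk k (mul f g) x = \sum_(j < k.+1) evk j f x * evk (k - j) g x.
Proof.
rewrite (eq_evk _ (@mul_deg _ k f g)) evk_sum; apply: eq_bigr => j _.
have jk : (j <= k)%N by rewrite -ltnS.
by have := evk_tens j (k - j) f g x; rewrite (subnKC jk).
Qed.

Lemma devk_der k f x h : devk k.+1 f x h = \sum_(b < 3) h 0 b * evk k (der b f) x.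
Proof.
elim: k f => [|k IH] f.
  by apply: eq_bigr => i _; rewrite mulr0 addr0.
rewrite [LHS]big_split /=; under [X in _ + X]eq_bigr do rewrite -/(devk k.+1 _ x h) IH mulr_sumr.
rewrite exchange_big -big_split /=; apply: eq_bigr => b _.
rewrite mulr_sumr -big_split mulr_sumr /=; apply: eq_bigr => i _.
have -> : slice i (der b f) = slice i (slice b f) + der b (slice i f) by [].
by rewrite evkD; ring.
Qed.

Definition crossx (a : 'I_3) x : 'rV[R]_3 := \row_j \sum_(i < 3) x 0 i * lc a i j.

Lemma evk_rot k a f x : evk k (rot a f) x = devk k f x (crossx a x).
Proof.
elim: k f => [//|k IH] f /=.
under eq_bigr do rewrite slice_rot evkD mulrDr IH.
rewrite !big_split /= addrC; congr (_ + _).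
under [RHS]eq_bigr do rewrite mxE mulr_suml.
rewrite exchange_big; apply: eq_bigr => i _; rewrite evk_sum mulr_sumr.
by apply: eq_bigr => j _; rewrite evkZ mulrA.
Qed.

(** The letter can be inserted at [k + 1] positions, and fixing one letter of a word does not
    increase the norm. *)
Lemma nrm_der k b f : nrm k (der b f) <= k.+1%:R * nrm k.+1 f.
Proof.
have Sq k' f' : nrm k'.+1 f' ^+ 2 = \sum_i nrm k' (slice i f') ^+ 2.
  by rewrite nrm_sq /=; apply: eq_bigr => i _; rewrite nrm_sq.
have shb k' f' : nrm k' (slice b f') <= nrm k'.+1 f'.
  rewrite -(@ler_pXn2r _ 2) ?nnegrE ?nrm_ge0 // Sq (bigD1 b) //= lerDl.
  by apply: sumr_ge0 => i _; apply: sqr_ge0.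
elim: k f => [|k IH] f.
  rewrite mul1r (@eq_nrm _ 0 _ (slice b f)) ?shb //.
  by case.
pose G : ser R := fun s => if s is i :: s' then der b (slice i f) s' else 0.
rewrite (@eq_nrm _ _ _ (slice b f + G)); last by case.
apply: (le_trans (nrmD _ _ _)).
rewrite -[k.+2]addn1 natrD addrC mulrDl mul1r addn1; apply: lerD => //.
rewrite -(@ler_pXn2r _ 2) ?nnegrE ?mulr_ge0 ?nrm_ge0 //.
rewrite exprMn !Sq mulr_sumr; apply: ler_sum => i _.
rewrite -exprMn ler_pXn2r ?nnegrE ?mulr_ge0 ?nrm_ge0 //; exact: IH.
Qed.

Section Remainder.
Variables (rho : R) (x h : 'rV[R]_3).
Hypotheses (rho1 : 1 <= rho) (xr : enorm x <= rho) (xhr : enorm (x + h) <= rho).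

Let rho0 : 0 <= rho. Proof. exact: le_trans rho1. Qed.

Lemma evk_dist k f :
  `|evk k f (x + h) - evk k f x| <= k%:R * rho ^+ k * enorm h * nrm k f.
Proof.
elim: k f => [|k IH] f /=; first by rewrite subrr normr0 !mul0r.
have -> : \sum_(i < 3) (x + h) 0 i * evk k (slice i f) (x + h) -
          \sum_(i < 3) x 0 i * evk k (slice i f) x =
  \sum_(i < 3) x 0 i * (evk k (slice i f) (x + h) - evk k (slice i f) x) +
  \sum_(i < 3) h 0 i * evk k (slice i f) (x + h).
  by rewrite -sumrB -big_split /=; apply: eq_bigr => i _; rewrite mxE; ring.
apply: (le_trans (ler_normD _ _)).
have A := @wsum_le k f x _ (k%:R * rho ^+ k * enorm h) _ (fun i => IH (slice i f)).
have B := @wsum_le k f h (fun i => evk k (slice i f) (x + h)) (enorm (x + h) ^+ k).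
apply: (le_trans (lerD (A _) (B _ _))).
- by rewrite !mulr_ge0 ?exprn_ge0 ?enorm_ge0.
- by rewrite exprn_ge0 ?enorm_ge0.
- by move=> i; apply: evk_le.
rewrite -mulrDl ler_wpM2r ?nrm_ge0 //.
apply: (@le_trans _ _ (rho * (k%:R * rho ^+ k * enorm h) + enorm h * rho ^+ k)).
  rewrite lerD // ?ler_wpM2r ?mulr_ge0 ?exprn_ge0 ?enorm_ge0 //.
  by rewrite ler_wpM2l ?enorm_ge0 // lerXn2r ?nnegrE ?enorm_ge0.
rewrite exprS -[k.+1]addn1 natrD.
have : rho ^+ k * enorm h <= rho * rho ^+ k * enorm h.
  by rewrite -mulrA ler_peMl // mulr_ge0 ?exprn_ge0 ?enorm_ge0.
by rewrite mulrDl mulrDl mul1r; lra.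
Qed.

Lemma evk_taylor k f :
  `|evk k f (x + h) - evk k f x - devk k f x h| <=
  k%:R ^+ 2 * rho ^+ k * enorm h ^+ 2 * nrm k f.
Proof.
elim: k f => [|k IH] f /=; first by rewrite subrr subr0 normr0 expr0n /= !mul0r.
have -> : \sum_(i < 3) (x + h) 0 i * evk k (slice i f) (x + h) -
          \sum_(i < 3) x 0 i * evk k (slice i f) x -
          \sum_(i < 3) (h 0 i * evk k (slice i f) x + x 0 i * devk k (slice i f) x h) =
  \sum_(i < 3) x 0 i * (evk k (slice i f) (x + h) - evk k (slice i f) x -
                        devk k (slice i f) x h) +
  \sum_(i < 3) h 0 i * (evk k (slice i f) (x + h) - evk k (slice i f) x).
  by rewrite -!sumrB -big_split /=; apply: eq_bigr => i _; rewrite mxE; ring.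
apply: (le_trans (ler_normD _ _)).
have A := @wsum_le k f x _ (k%:R ^+ 2 * rho ^+ k * enorm h ^+ 2) _ (fun i => IH (slice i f)).
have B := @wsum_le k f h _ (k%:R * rho ^+ k * enorm h) _ (fun i => evk_dist k (slice i f)).
apply: (le_trans (lerD (A _) (B _))).
- by rewrite !mulr_ge0 ?exprn_ge0 ?enorm_ge0.
- by rewrite !mulr_ge0 ?exprn_ge0 ?enorm_ge0.
rewrite -mulrDl ler_wpM2r ?nrm_ge0 //.
apply: (@le_trans _ _ (rho * (k%:R ^+ 2 * rho ^+ k * enorm h ^+ 2) +
                       enorm h * (k%:R * rho ^+ k * enorm h))).
  by rewrite lerD // ?ler_wpM2r ?mulr_ge0 ?exprn_ge0 ?enorm_ge0.
rewrite [rho ^+ k.+1]exprS -natr1.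
have H : k%:R * rho ^+ k * enorm h ^+ 2 <= k%:R * (rho * rho ^+ k) * enorm h ^+ 2.
  by rewrite ler_wpM2r ?exprn_ge0 ?enorm_ge0 // ler_wpM2l // ler_peMl // exprn_ge0.
have H0 : 0 <= k%:R * (rho * rho ^+ k) * enorm h ^+ 2.
  by rewrite !mulr_ge0 ?exprn_ge0 ?enorm_ge0.
have H1 : 0 <= rho * rho ^+ k * enorm h ^+ 2 by rewrite !mulr_ge0 ?exprn_ge0 ?enorm_ge0.
move: H H0 H1; set p := rho ^+ k; set e := enorm h; set n := k%:R => H H0 H1.
lra.
Qed.

End Remainder.

Definition ev f x : R := limn (series (fun k => evk k f x)).

Lemma ev_cvg_abs w f M x : 0 <= w -> nle w f M -> enorm x <= w ->
  cvgn (series (fun k => `|evk k f x|)).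
Proof.
move=> w0 fM xw; apply: nondecreasing_is_cvgn => [n m nm|].
  by rewrite /series /= (big_cat_nat (leq0n n) nm) /= lerDl sumr_ge0.
exists M => _ [n _ <-]; rewrite /series /= big_mkord.
apply: le_trans (fM n); apply: ler_sum => k _.
apply: (le_trans (evk_le _ _ _)); rewrite ler_wpM2r ?nrm_ge0 //.
by rewrite lerXn2r ?nnegrE ?enorm_ge0.
Qed.

Lemma ev_cvg w f M x : 0 <= w -> nle w f M -> enorm x <= w ->
  series (fun k => evk k f x) n @[n --> \oo] --> ev f x.
Proof. by move=> w0 fM xw; apply: normed_cvg; apply: ev_cvg_abs xw. Qed.

Lemma ev_le w f M x : 0 <= w -> nle w f M -> enorm x <= w -> `|ev f x| <= M.
Proof.
move=> w0 fM xw.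
apply: (@cvgr_to_le nat \oo _ R (fun n => `|series (fun k => evk k f x) n|)).
  by apply: cvg_norm; exact: (ev_cvg w0 fM xw).
near=> n; rewrite /series /= big_mkord (le_trans (ler_norm_sum _ _ _)) //.
apply: le_trans (fM n); apply: ler_sum => k _.
apply: (le_trans (evk_le _ _ _)); rewrite ler_wpM2r ?nrm_ge0 //.
by rewrite lerXn2r ?nnegrE ?enorm_ge0.
Unshelve. all: by end_near.
Qed.

Lemma ev_lim f x l : series (fun k => evk k f x) n @[n --> \oo] --> l -> ev f x = l.
Proof. by move=> H; apply: cvg_lim. Qed.

Lemma evD w f g M N x : 0 <= w -> nle w f M -> nle w g N -> enorm x <= w ->
  ev (f + g) x = ev f x + ev g x.
Proof.
move=> w0 fM gN xw; apply: ev_lim.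
have -> : series (fun k => evk k (f + g) x) =
    (fun n => series (fun k => evk k f x) n + series (fun k => evk k g x) n).
  apply/funext => n; rewrite /series /= -big_split /=.
  by apply: eq_bigr => k _; rewrite evkD.
by apply: cvgD; [exact: (ev_cvg w0 fM xw) | exact: (ev_cvg w0 gN xw)].
Qed.

Lemma evZ w c f M x : 0 <= w -> nle w f M -> enorm x <= w -> ev (sc c f) x = c * ev f x.
Proof.
move=> w0 fM xw; apply: ev_lim.
have -> : series (fun k => evk k (sc c f) x) = (fun n => c * series (fun k => evk k f x) n).
  apply/funext => n; rewrite /series /= mulr_sumr.
  by apply: eq_bigr => k _; rewrite evkZ.
by apply: cvgMr; exact: (ev_cvg w0 fM xw).
Qed.

Lemma evM w f g M N x : 0 <= w -> nle w f M -> nle w g N -> enorm x <= w ->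
  ev (mul f g) x = ev f x * ev g x.
Proof.
move=> w0 fM gN xw; apply: ev_lim.
have -> : (fun k => evk k (mul f g) x) =
    (fun n => \sum_(j < n.+1) evk j f x * evk (n - j) g x).
  by apply/funext => n; rewrite evk_mul.
apply: (@cauchy_product R (fun n => evk n f x) (fun n => evk n g x)).
- exact: ev_cvg_abs xw.
- exact: ev_cvg_abs xw.
- exact: ev_cvg xw.
- exact: ev_cvg xw.
Qed.

Lemma series_finite (u : nat -> R) K : (forall k, (K <= k)%N -> u k = 0) ->
  series u n @[n --> \oo] --> \sum_(k < K) u k.
Proof.
move=> u0; apply: cvg_near_cst; exists K => // n /= Kn.
rewrite /series /= (big_cat_nat (leq0n K) Kn) /= big_mkord.
rewrite -[RHS]addr0; congr (_ + _).
by rewrite big_nat_cond big1 // => k /andP[/andP[Kk _] _]; exact: u0.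
Qed.

Lemma evk_vanish k f x : (forall s, size s = k -> f s = 0) -> evk k f x = 0.
Proof.
move=> f0; rewrite (eq_evk x (g := sc 0 f)) ?evkZ ?mul0r // => s ss.
by rewrite /sc f0 // mul0r.
Qed.

Lemma ev_cst c x : ev (cst_ser c) x = c.
Proof.
apply: ev_lim; have := @series_finite (fun k => evk k (cst_ser c) x) 1.
rewrite big_ord1 /=; apply => -[//|k] _; apply: evk_vanish; by case.
Qed.

Lemma ev_lin d x : ev (lin_ser d) x = \sum_(i < 3) x 0 i * d 0 i.
Proof.
apply: ev_lim; have := @series_finite (fun k => evk k (lin_ser d) x) 2.
rewrite big_ord_recr big_ord1 /= add0r; apply => -[|[|k]] // _; apply: evk_vanish.
by case=> [|? [|? ?]].
Qed.

End Evaluation.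

(** * Gradients and smooth functions *)

Section Gradients.
Context {R : realType} {n : nat}.
Implicit Types (x h v l : 'rV[R]_n).

Lemma entry_le_norm x j : `|x 0 j| <= `|x|.
Proof.
by rewrite [leRHS]/Num.Def.normr /= mx_normrE; apply: (le_bigmax _ _ (0, j)).
Qed.

Lemma norm_le_enorm x : `|x| <= enorm x.
Proof.
rewrite /Num.Def.normr /= mx_normrE; apply: bigmax_le => [|[i j] _] /=.
  exact: enorm_ge0.
rewrite (ord1 i) -(@ler_pXn2r _ 2) ?nnegrE ?enorm_ge0 // real_normK ?num_real //.
rewrite enorm_sq (bigD1 j) //= lerDl sumr_ge0 // => k _; exact: sqr_ge0.
Qed.

Lemma enorm_le_norm x : enorm x <= n%:R * `|x|.
Proof.
rewrite -(@ler_pXn2r _ 2) ?nnegrE ?enorm_ge0 ?mulr_ge0 // enorm_sq.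
apply: (@le_trans _ _ (\sum_(k < n) `|x| ^+ 2)).
  apply: ler_sum => k _; rewrite -real_normK ?num_real //.
  by rewrite ler_pXn2r ?nnegrE // entry_le_norm.
rewrite sumr_const card_ord -[`|x| ^+ 2 *+ n]mulr_natl exprMn ler_wpM2r ?sqr_ge0 //.
by rewrite -natrX ler_nat; case: (n) => // m; rewrite -[leqLHS]muln1 expnS expn1 leq_mul.
Qed.

Definition lform l v : R := \sum_(b < n) v 0 b * l 0 b.

Lemma lform_linear l : linear (lform l).
Proof.
move=> a u v; transitivity (a * lform l u + lform l v); last by [].
rewrite /lform mulr_sumr -big_split /=.
by apply: eq_bigr => b _; rewrite !mxE; ring.
Qed.

HB.instance Definition _ l :=
  GRing.isLinear.Build R 'rV[R]_n R *:%R (lform l) (lform_linear l).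

Lemma lform_continuous l : continuous (lform l).
Proof.
move=> v; apply: (@cvg_sumr R 'rV[R]_n (nbhs v) _ 'I_n (index_enum 'I_n)
  (fun (b : 'I_n) (v : 'rV_n) => v 0 b * l 0 b) (fun b => v 0 b * l 0 b)) => b.
by apply: cvgMl; apply: coord_continuous.
Qed.

Definition has_grad (F : 'rV[R]_n -> R) x l : Prop :=
  differentiable F x /\ forall v, 'd F x v = lform l v.

Lemma has_gradP (F : 'rV[R]_n -> R) x l :
  (forall e, 0 < e -> exists2 r, 0 < r &
     forall h, `|h| < r -> `|F (x + h) - F x - lform l h| <= e * `|h|) ->
  has_grad F x l.
Proof.
move=> H.
have E : F \o shift x = cst (F x) + lform l +o_ (0 : 'rV[R]_n) id.
  apply/eqaddoP => e e0; have [r r0 Hr] := H e e0.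
  apply/nbhs_ballP; exists r => //= h; rewrite -ball_normE /= sub0r normrN => hr.
  suff -> : (F \o shift x - (cst (F x) + lform l)) h = F (x + h) - F x - lform l h.
    exact: Hr.
  transitivity (F (h + x) - (F x + lform l h)); first by [].
  by rewrite (addrC x) opprD addrA.
have D := diff_unique (@lform_continuous l) E.
split; last by move=> v; rewrite D.
by apply/diff_locallyP; rewrite D; split => //; exact: lform_continuous.
Qed.

Lemma has_grad_eq (F : 'rV[R]_n -> R) x l l' : has_grad F x l -> l = l' -> has_grad F x l'.
Proof. by move=> H <-. Qed.

Lemma has_gradD F G x l m : has_grad F x l -> has_grad G x m ->
  has_grad (fun y => F y + G y) x (l + m).
Proof.
move=> [dF lF] [dG lG]; split; first exact: differentiableD.
move=> v; rewrite (_ : (fun _ => _) = F + G) // diffD //.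
transitivity ('d F x v + 'd G x v); first by [].
rewrite lF lG /lform -big_split /=.
by apply: eq_bigr => b _; rewrite !mxE mulrDr.
Qed.

Lemma has_gradM F G x l m : has_grad F x l -> has_grad G x m ->
  has_grad (fun y => F y * G y) x (F x *: m + G x *: l).
Proof.
move=> [dF lF] [dG lG]; split; first exact: differentiableM.
move=> v; rewrite (_ : (fun _ => _) = F * G) // diffM //.
transitivity (F x * 'd G x v + G x * 'd F x v); first by [].
rewrite lF lG.
rewrite /lform !mulr_sumr -big_split /=.
by apply: eq_bigr => b _; rewrite !mxE; ring.
Qed.

Lemma has_gradC c x : has_grad (fun=> c) x 0.
Proof.
split; first exact: differentiable_cst.
by move=> v; rewrite diff_cst /lform big1 // => b _; rewrite mxE mulr0.
Qed.

Lemma has_gradV F x l : has_grad F x l -> F x != 0 ->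
  has_grad (fun y => (F y)^-1) x (- (F x) ^- 2 *: l).
Proof.
move=> [dF lF] F0; split; first exact: differentiableV.
move=> v; rewrite diffV //.
transitivity (- (F x) ^- 2 * 'd F x v); first by [].
rewrite lF.
rewrite /lform mulr_sumr.
by apply: eq_bigr => b _; rewrite !mxE; ring.
Qed.

Lemma has_grad_coord x b : has_grad (fun y => y 0 b) x (delta_mx 0 b).
Proof.
apply: has_gradP => e e0; exists 1 => // h _.
rewrite /lform (bigD1 b) //= big1 ?addr0 => [|i ib]; last first.
  by rewrite mxE eqxx (negPf ib) mulr0.
by rewrite !mxE !eqxx mulr1 (addrC (x 0 b)) addrK subrr normr0 mulr_ge0 // ltW.
Qed.

Lemma has_grad_scal (g : R -> R) (F : 'rV[R]_n -> R) x l (dg : R) :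
  is_derive (F x) (1 : R) g dg -> has_grad F x l ->
  has_grad (fun y => g (F y)) x (dg *: l).
Proof.
move=> [gd gE] [dF lF].
have dg' : differentiable g (F x) by apply/derivable1_diffP.
split; first exact: (differentiable_comp dF dg').
move=> v; rewrite (_ : (fun _ => _) = g \o F) // (diff_comp dF dg') /=.
rewrite (diff1E dg') /= derive1E gE lF.
transitivity (lform l v * dg); first by [].
rewrite /lform mulr_suml.
by apply: eq_bigr => b _; rewrite mxE; ring.
Qed.

(** Only the directional derivative of [g] is given, so the chain rule is applied to the curve
    [t |-> g (t *: v + u)], for which derivable and differentiable coincide. *)
Lemma has_grad_line (m : nat) F (g : 'rV[R]_m -> 'rV[R]_n) (u v : 'rV[R]_m) l :
  has_grad F (g u) l -> derivable g u v -> is_derive u v (F \o g) (lform l ('D_v g u)).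
Proof.
move=> [dF lF] dg.
pose c t := g (t *: v + u).
have c0 : c 0 = g u by rewrite /c scale0r add0r.
have dc : differentiable c 0 by apply/derivable1_diffP; exact: (derivable1P _ _ _).1 dg.
have dF' : differentiable F (c 0) by rewrite c0.
have dFc : differentiable (F \o c) 0 by exact: differentiable_comp.
have cE : 'd c 0 1 = 'D_v g u.
  rewrite -deriveE // /derive; congr (lim (_ @ 0^')).
  by apply/funext => t /=; rewrite addr0 c0 /c [t%:A]mulr1.
split.
  by apply/derivable1P; apply/derivable1_diffP.
have -> : 'D_v (F \o g) u = 'D_1 (F \o c) 0.
  rewrite /derive; congr (lim (_ @ 0^')).
  by apply/funext => t /=; rewrite addr0 c0 /c [t%:A]mulr1.
rewrite (deriveE _ dFc) (diff_comp dc dF') /= cE -lF.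
by rewrite c0.
Qed.

End Gradients.

Section GradComp.
Context {R : realType} {n m : nat}.

Lemma differentiable_row (G : 'rV[R]_n -> 'rV[R]_m) x :
  (forall j, differentiable (fun y => G y 0 j) x) -> differentiable G x.
Proof.
move=> H.
have -> : G = \sum_(j < m) (fun y => G y 0 j *: delta_mx 0 j).
  by apply/funext => y; rewrite fct_sumE -row_sum_delta.
apply: differentiable_sum => j.
exact: differentiableZl.
Qed.

Lemma has_grad_comp (F : 'rV[R]_m -> R) (G : 'rV[R]_n -> 'rV[R]_m) x l
    (M : 'M[R]_(m, n)) :
  has_grad F (G x) l -> (forall j, has_grad (fun y => G y 0 j) x (row j M)) ->
  has_grad (F \o G) x (l *m M).
Proof.
move=> [dF lF] HG.
have dG : differentiable G x by apply: differentiable_row => j; case: (HG j).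
split; first exact: differentiable_comp.
move=> v; rewrite (diff_comp dG dF) /= lF /lform.
under [RHS]eq_bigr do rewrite mxE mulr_sumr.
rewrite exchange_big; apply: eq_bigr => j _.
have -> : 'd G x v 0 j = 'd (fun y => G y 0 j) x v.
  rewrite -!deriveE //; last by case: (HG j).
  have dd : derivable G x v by apply: diff_derivable.
  by rewrite (derive_mx dd) mxE.
case: (HG j) => _ ->; rewrite /lform mulr_suml; apply: eq_bigr => b _.
by rewrite !mxE; ring.
Qed.

End GradComp.

(** * Differentiation of series *)

Section Analytic.
Context {R : realType}.
Implicit Types (f g : ser R) (x h : 'rV[R]_3).

(** Bounds at every radius below [w], not at [w] itself: differentiation costs an arbitrarily small
    part of the radius, so this form is stable under [der]. *)
Definition ser_an (w : R) f := forall rho, 0 <= rho < w -> exists M, nle rho f M.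

Lemma nle_mono (rho w : R) f M : 0 <= rho -> rho <= w -> nle w f M -> nle rho f M.
Proof.
move=> r0 rw fM K; apply: le_trans (fM K); apply: ler_sum => k _.
by rewrite ler_wpM2r ?nrm_ge0 // lerXn2r // nnegrE // (le_trans r0).
Qed.

Lemma nle_an w f M : nle w f M -> ser_an w f.
Proof.
by move=> fM rho /andP[r0 rw]; exists M; apply: nle_mono fM => //; apply: ltW.
Qed.

Lemma sq_geom (rho w : R) : 1 <= rho -> rho < w ->
  exists B, 0 <= B /\ forall k, k%:R ^+ 2 * rho ^+ k <= B * w ^+ k.
Proof.
(* [t] is small enough for [(1 + t)^2 <= q]; Bernoulli's inequality [k t <= (1 + t)^k], squared,
   then absorbs the factor [k^2] into [q^k]. *)
move=> r1 rw; pose q := w / rho; pose t := (q - 1) / (3 * q).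
have r0 : 0 < rho by lra.
have q1 : 1 < q by rewrite /q ltr_pdivlMr ?mul1r.
have t0 : 0 < t by rewrite /t divr_gt0 //; lra.
have tE : t * (3 * q) = q - 1 by rewrite /t divfK //; lra.
have t1 : t <= 1 by nra.
have tq : (1 + t) ^+ 2 <= q by nra.
have bern k : k%:R * t <= (1 + t) ^+ k.
  elim: k => [|k IH]; first by rewrite mul0r expr0.
  rewrite exprS -natr1.
  have : 1 <= (1 + t) ^+ k by rewrite exprn_ege1 //; lra.
  by move: IH; set a := (1 + t) ^+ k; set n := k%:R => IH a1; nra.
exists (t ^- 2); split; first by rewrite invr_ge0 exprn_ge0 // ltW.
move=> k; have -> : w ^+ k = q ^+ k * rho ^+ k by rewrite -exprMn divfK // gt_eqF.
rewrite mulrA ler_wpM2r ?exprn_ge0 ?(ltW r0) //.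
rewrite [leRHS]mulrC ler_pdivlMr ?exprn_gt0 // -exprMn.
apply: (@le_trans _ _ (((1 + t) ^+ 2) ^+ k)).
  have p0 : 0 <= 1 + t by lra.
  rewrite -exprM mulnC exprM; apply: lerXn2r (bern k); rewrite nnegrE ?exprn_ge0 //.
  by rewrite mulr_ge0 // ltW.
by rewrite lerXn2r // nnegrE ?exprn_ge0 //; lra.
Qed.

Lemma ser_an_der w b f : 1 < w -> ser_an w f -> ser_an w (der b f).
Proof.
move=> w1 fa rho /andP[r0 rw].
pose r1 := Num.max 1 rho; have r11 : 1 <= r1 by rewrite le_max lexx.
have r1w : r1 < w by rewrite gt_max w1.
have [r2 r12 r2w] : exists2 r2, r1 < r2 & r2 < w.
  by exists ((r1 + w) / 2); lra.
have [M fM] := fa r2 ltac:(apply/andP; split; lra).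
have [B [B0 HB]] := sq_geom r11 r12.
exists (B * M); apply: (@nle_mono _ r1) => //; first by rewrite le_max lexx orbT.
move=> K; apply: (@le_trans _ _ (\sum_(k < K) B * (r2 ^+ k.+1 * nrm k.+1 f))).
  apply: ler_sum => k _.
  apply: (@le_trans _ _ (r1 ^+ k.+1 * (k.+1%:R ^+ 2 * nrm k.+1 f))); last first.
    have := ler_wpM2r (nrm_ge0 k.+1 f) (HB k.+1).
    by rewrite -[X in X <= _]mulrA -[X in _ <= X]mulrA mulrCA.
  apply: ler_pM; rewrite ?exprn_ge0 ?nrm_ge0 //; first by lra.
    by rewrite exprS ler_peMl ?exprn_ge0 //; lra.
  apply: (le_trans (nrm_der k b f)); rewrite ler_wpM2r ?nrm_ge0 //.
  by rewrite expr2 ler_peMl // ler1n.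
rewrite -mulr_sumr ler_wpM2l //; have := fM K.+1; apply: le_trans.
by rewrite big_ord_recl lerDr mulr_ge0 ?nrm_ge0.
Qed.

Lemma series_shift_der f x h n :
  \sum_(k < n.+1) devk k f x h =
  \sum_(b < 3) h 0 b * series (fun k => evk k (der b f) x) n.
Proof.
rewrite big_ord_recl [X in X + _](_ : _ = 0) // add0r.
under eq_bigr do rewrite lift0 devk_der.
rewrite exchange_big; apply: eq_bigr => b _.
by rewrite /series /= big_mkord mulr_sumr.
Qed.

Lemma cvg_shift_der w f x h : 1 < w -> ser_an w f -> enorm x < w ->
  (\sum_(k < n.+1) devk k f x h) @[n --> \oo] --> \sum_(b < 3) h 0 b * ev (der b f) x.
Proof.
move=> w1 fa xw.
rewrite (_ : (fun n => _) = fun n =>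
  \sum_(b < 3) h 0 b * series (fun k => evk k (der b f) x) n); last first.
  by apply/funext => n; rewrite series_shift_der.
apply: (@cvg_sumr R nat \oo _ 'I_3 _ (fun b n => h 0 b * series (fun k => evk k (der b f) x) n)
  (fun b => h 0 b * ev (der b f) x)) => b.
have x0 := enorm_ge0 x.
have [M fM] := ser_an_der b w1 fa (rho := (enorm x + w) / 2) ltac:(apply/andP; split; lra).
apply: cvgMr; apply: (ev_cvg _ fM); lra.
Qed.

Lemma ev_has_grad w f x : 1 < w -> ser_an w f -> enorm x < w ->
  has_grad (ev f) x (\row_b ev (der b f) x).
Proof.
move=> w1 fa xw; have x0 := enorm_ge0 x.
(* The remainder estimate [evk_taylor] assumes a radius at least 1. The second radius [r2] beyond
   [r1] pays for its factor [k^2]. *)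
pose r1 := Num.max 1 ((enorm x + w) / 2).
have r11 : 1 <= r1 by rewrite le_max lexx.
have xr1 : (enorm x + w) / 2 <= r1 by rewrite le_max lexx orbT.
have r1w : r1 < w by rewrite gt_max w1 /=; lra.
have [r2 r12 r2w] : exists2 r2, r1 < r2 & r2 < w by exists ((r1 + w) / 2); lra.
have [M fM] := fa r2 ltac:(apply/andP; split; lra).
have [B [B0 HB]] := sq_geom r11 r12.
have M0 := nle_ge0 fM.
have triang (y z : 'rV[R]_3) : enorm (y + z) <= enorm y + enorm z.
  have := nrmD 1 (lin_ser y) (lin_ser z); rewrite !nrm_lin.
  suff -> : lin_ser y + lin_ser z = lin_ser (y + z) by rewrite nrm_lin.
  apply/funext => -[|i [|j s]]; rewrite addrfctE /= ?addr0 //.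
  by rewrite mxE.
have main h : enorm h <= (w - enorm x) / 2 ->
    `|ev f (x + h) - ev f x - \sum_(b < 3) h 0 b * ev (der b f) x| <= B * M * enorm h ^+ 2.
  move=> hw; have xh1 : enorm (x + h) <= r1 by have := triang x h; lra.
  have r2p : 0 <= r2 by lra.
  apply: (@cvgr_to_le nat \oo _ R (fun n =>
    `|series (fun k => evk k f (x + h)) n.+1 - series (fun k => evk k f x) n.+1 -
      \sum_(k < n.+1) devk k f x h|)).
    apply: cvg_norm; apply: cvgB; last exact: cvg_shift_der xw.
    apply: cvgB.
      rewrite (cvg_shiftS (fun n => series (fun k => evk k f (x + h)) n)).
      by apply: (ev_cvg r2p fM); lra.
    rewrite (cvg_shiftS (fun n => series (fun k => evk k f x) n)).
    by apply: (ev_cvg r2p fM); lra.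
  near=> n; rewrite /series /= !big_mkord -!sumrB.
  apply: (le_trans (ler_norm_sum _ _ _)).
  apply: (@le_trans _ _ (\sum_(k < n.+1) B * enorm h ^+ 2 * (r2 ^+ k * nrm k f))).
    apply: ler_sum => k _; apply: (le_trans (evk_taylor r11 _ xh1 k f)); first by lra.
    rewrite mulrA ler_wpM2r ?nrm_ge0 // [leRHS]mulrAC ler_wpM2r ?exprn_ge0 ?enorm_ge0 //.
  rewrite -mulr_sumr [leRHS]mulrAC ler_wpM2l ?mulr_ge0 ?exprn_ge0 ?enorm_ge0 //.
apply: has_gradP => e e0.
pose r := Num.min (((w - enorm x) / 2) / 3) (e / (9 * (B * M) + 1)).
have BM : 0 <= B * M by rewrite mulr_ge0.
exists r; first by rewrite lt_min !divr_gt0 //; lra.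
move=> h; rewrite lt_min => /andP[h1 h2].
have hn := enorm_le_norm h; have h0 := normr_ge0 h.
have -> : lform (\row_b ev (der b f) x) h = \sum_(b < 3) h 0 b * ev (der b f) x.
  by apply: eq_bigr => b _; rewrite mxE.
apply: (le_trans (main h _)); first by lra.
apply: (@le_trans _ _ (B * M * (3%:R * `|h|) ^+ 2)).
  by rewrite ler_wpM2l // lerXn2r ?nnegrE ?enorm_ge0 // mulr_ge0.
rewrite exprMn expr2 (expr2 `|h|) !mulrA ler_wpM2r //.
move: h2; rewrite ltr_pdivlMr; last by lra.
move=> h2; nra.
Unshelve. all: by end_near.
Qed.

Lemma ev_rot w f x a : 1 < w -> ser_an w f -> enorm x < w ->
  lform (\row_b ev (der b f) x) (crossx a x) = ev (rot a f) x.
Proof.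
move=> w1 fa xw; apply/esym/ev_lim.
rewrite -(cvg_shiftS (fun n => series (fun k => evk k (rot a f) x) n)).
rewrite (_ : lform _ _ = \sum_(b < 3) crossx a x 0 b * ev (der b f) x); last first.
  by apply: eq_bigr => b _; rewrite [X in _ * X]mxE.
have := @cvg_shift_der w f x (crossx a x) w1 fa xw.
rewrite (_ : (fun n => _) = fun n => series (fun k => evk k (rot a f) x) n.+1) //.
by apply/funext => n; rewrite /series /= big_mkord; apply: eq_bigr => k _; rewrite evk_rot.
Qed.

End Analytic.

(** * Smooth functions and a class stable under partial derivatives *)

Section Smooth.
Context {R : realType} {m : nat}.
Implicit Types (U : set 'rV[R]_m) (u v : 'rV[R]_m).

Lemma open_nbhs_mem U u : open U -> U u -> nbhs u U.
Proof. by move=> oU Uu; apply: open_nbhs_nbhs. Qed.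

Lemma Ck_on_eq (W : normedModType R) k U (f g : 'rV[R]_m -> W) : open U ->
  (forall u, U u -> f u = g u) -> Ck_on k U f -> Ck_on k U g.
Proof.
move=> oU; elim: k f g => [|k IH] f g fg /=;
  have near_fg u : U u -> \near u, f u = g u
    by move=> Uu; near=> y; apply: fg; near: y; apply: open_nbhs_mem.
  move=> H u Uu; have := H u Uu; rewrite /prop_for /continuous_at -fg // => c.
  exact: cvg_trans (near_eq_cvg (near_fg u Uu)) c.
move=> H a; have [Hd Hk] := H a.
split=> [u Uu|]; first exact: near_eq_derivable (near_fg u Uu) (Hd u Uu).
apply: IH Hk => u Uu; exact: near_eq_derive (near_fg u Uu).
Unshelve. all: by end_near.
Qed.

Lemma cvg_row {T : Type} {G : set_system T} {FG : Filter G} n (g : T -> 'rV[R]_n) (l : 'rV[R]_n) :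
  (forall j, g t 0 j @[t --> G] --> l 0 j) -> g t @[t --> G] --> l.
Proof.
move=> H; apply/cvgrPdist_le => e e0.
have : \forall x \near G, forall j, `|l 0 j - g x 0 j| <= e.
  by apply: filter_forall => j; exact: ((cvgrPdist_le _ _).1 (H j)).
apply: filterS => x Hx.
rewrite /Num.Def.normr /= mx_normrE (bigmax_le _ (ltW e0)) //= => -[i j] _ /=.
by rewrite !mxE (ord1 i).
Qed.

Lemma pderiv_coord n (f : 'rV[R]_m -> 'rV[R]_n) a u j :
  derivable f u (delta_mx 0 a) ->
  pderiv a (fun v => f v 0 j) u = pderiv a f u 0 j.
Proof. by move=> df; rewrite [in RHS]/pderiv (derive_mx df) mxE. Qed.

Lemma Ck_on_row n k U (f : 'rV[R]_m -> 'rV[R]_n) : open U ->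
  (forall j, Ck_on k U (fun u => f u 0 j)) -> Ck_on k U f.
Proof.
move=> oU; elim: k f => [|k IH] f H /=.
  move=> u Uu; apply: (@cvg_row _ (nbhs u)) => j; exact: H.
move=> a.
have df u : U u -> derivable f u (delta_mx 0 a).
  by move=> Uu; apply/derivable_mxP => i j; rewrite (ord1 i); case: (H j a) => + _; exact.
split => //; apply: IH => j; case: (H j a) => _; apply: Ck_on_eq => // u Uu.
by rewrite pderiv_coord //; apply: df.
Qed.

Lemma Ck_on_coord n k U (f : 'rV[R]_m -> 'rV[R]_n) j : open U ->
  Ck_on k U f -> Ck_on k U (fun u => f u 0 j).
Proof.
move=> oU; elim: k f => [|k IH] f H /=.
  move=> u Uu; apply: (@continuous_comp _ _ _ f (fun M : 'rV[R]_n => M 0 j) u (H u Uu)); exact: coord_continuous.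
move=> a; case: (H a) => df Hk; split.
  by move=> u Uu; move: (df u Uu) => /derivable_mxP; apply.
by apply: Ck_on_eq (IH _ Hk) => // u Uu; rewrite pderiv_coord //; apply: df.
Qed.

Lemma smooth_row n U (f : 'rV[R]_m -> 'rV[R]_n) : open U ->
  (forall j, smooth_on U (fun u => f u 0 j)) -> smooth_on U f.
Proof. by move=> oU H k; apply: Ck_on_row => // j; apply: H. Qed.

Lemma smooth_coord n U (f : 'rV[R]_m -> 'rV[R]_n) j : open U ->
  smooth_on U f -> smooth_on U (fun u => f u 0 j).
Proof. by move=> oU H k; apply: Ck_on_coord. Qed.

(* The scalar functions on [U] built from smooth ones by the operations needed below; the point is
   that this class is visibly stable under partial derivatives. *)
Inductive sm U : ('rV[R]_m -> R) -> Prop :=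
| sm_smooth f : smooth_on U f -> sm U f
| sm_cst c : sm U (fun=> c)
| sm_coord b : sm U (fun u => u 0 b)
| sm_add f g : sm U f -> sm U g -> sm U (fun u => f u + g u)
| sm_mul f g : sm U f -> sm U g -> sm U (fun u => f u * g u)
| sm_inv f : sm U f -> (forall u, U u -> f u != 0) -> sm U (fun u => (f u)^-1)
| sm_ev w s (g : 'rV[R]_m -> 'rV[R]_3) : 1 < w -> ser_an w s ->
    (forall b, sm U (fun u => g u 0 b)) -> (forall u, U u -> enorm (g u) < w) ->
    sm U (fun u => ev s (g u)).

Lemma sm_step U f : open U -> sm U f ->
  (forall u, U u -> {for u, continuous f}) /\
  forall a, exists f', sm U f' /\ forall u, U u -> is_derive u (delta_mx 0 a) f (f' u).
Proof.
move=> oU; elim.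
- move=> {}f sf; split; first exact: (sf 0%N).
  move=> a; exists (pderiv a f); split.
    by apply: sm_smooth => k; case: (sf k.+1 a).
  by move=> u Uu; apply: derivableP; case: (sf 1%N a) => + _; apply.
- move=> c; split=> [u _|a]; first exact: cst_continuous.
  by exists (fun=> 0); split; [exact: (@sm_cst U 0) | move=> u _; exact: is_derive_cst].
- move=> b; split=> [u _|a]; first exact: coord_continuous.
  exists (fun=> (delta_mx 0 a : 'rV[R]_m) 0 b); split; first exact: sm_cst.
  move=> u _; apply: is_derive_eq.
    apply: (has_grad_line (g := id) (has_grad_coord u b)); exact: derivable_id.
  rewrite derive_id /lform (bigD1 b) //= big1 ?addr0 => [|i ib].
    by rewrite [X in _ * X]mxE !eqxx mulr1.
  by rewrite [X in _ * X]mxE (negPf ib) andbF mulr0.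
- move=> {}f g _ [cf df] _ [cg dg]; split=> [u Uu|a].
    exact: (cvgD (cf u Uu) (cg u Uu)).
  have [f' [sf' Hf]] := df a; have [g' [sg' Hg]] := dg a.
  exists (fun u => f' u + g' u); split; first exact: sm_add.
  by move=> u Uu; have := Hf u Uu; have := Hg u Uu => ? ?; exact: is_deriveD.
- move=> {}f g sf [cf df] sg [cg dg]; split=> [u Uu|a].
    exact: (cvgM (cf u Uu) (cg u Uu)).
  have [f' [sf' Hf]] := df a; have [g' [sg' Hg]] := dg a.
  exists (fun u => f u * g' u + g u * f' u); split.
    by apply: sm_add; apply: sm_mul.
  by move=> u Uu; have := Hf u Uu; have := Hg u Uu => ? ?; exact: is_deriveM.
- move=> {}f sf [cf df] f0; split=> [u Uu|a].
    exact: (cvgV (f0 u Uu) (cf u Uu)).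
  have [f' [sf' Hf]] := df a.
  exists (fun u => - 1 * ((f u)^-1 * (f u)^-1 * f' u)); split.
    apply: sm_mul; first exact: sm_cst.
    by apply: sm_mul => //; apply: sm_mul; apply: sm_inv.
  move=> u Uu; have Hu := Hf u Uu; have f0u := f0 u Uu; case: (Hu) => dfu fE.
  apply: DeriveDef; first exact: derivableV.
  rewrite deriveV // fE.
  transitivity (- f u ^- 2 * f' u); first by [].
  by field.
- move=> w s g w1 sa sg IH gw.
  have Hg u : U u -> has_grad (ev s) (g u) (\row_b ev (der b s) (g u)).
    by move=> Uu; apply: (ev_has_grad w1 sa); apply: gw.
  split=> [u Uu|a].
    apply: (@continuous_comp _ _ _ g (ev s)).
      by apply: (@cvg_row _ (nbhs u)) => j; case: (IH j) => + _; exact.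
    by case: (Hg u Uu) => /differentiable_continuous.
  pose g' b := sval (cid ((IH b).2 a)).
  have g'P b : sm U (g' b) /\ forall u, U u -> is_derive u (delta_mx 0 a) (fun u => g u 0 b) (g' b u).
    by rewrite /g'; case: cid.
  have smT b : sm U (fun u => g' b u * ev (der b s) (g u)).
    apply: sm_mul; first by case: (g'P b).
    by apply: (sm_ev w1) => //; apply: ser_an_der.
  exists (fun u => g' o0 u * ev (der o0 s) (g u) + g' o1 u * ev (der o1 s) (g u)
                   + g' o2 u * ev (der o2 s) (g u)); split.
    apply: (sm_add (f := fun u => g' o0 u * ev (der o0 s) (g u) + g' o1 u * ev (der o1 s) (g u))) => //.
    by apply: (sm_add (f := fun u => g' o0 u * ev (der o0 s) (g u))).
  move=> u Uu.
  have dgu : derivable g u (delta_mx 0 a).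
    by apply/derivable_mxP => i j; rewrite (ord1 i); case: (g'P j) => _ /(_ u Uu) [].
  have gE b : ('D_(delta_mx 0 a) g u) 0 b = g' b u.
    by rewrite (derive_mx dgu) mxE; case: (g'P b) => _ /(_ u Uu) [].
  have := has_grad_line (Hg u Uu) dgu; by rewrite /lform sum3 !gE !mxE.
Qed.

Lemma sm_is_smooth U f : open U -> sm U f -> smooth_on U f.
Proof.
move=> oU sf k; elim: k f sf => [|k IH] f sf /=; have [cf df] := sm_step oU sf => // a.
have [f' [sf' Hf]] := df a; split; first by move=> u Uu; case: (Hf u Uu).
by apply: Ck_on_eq (IH _ sf') => // u Uu; case: (Hf u Uu).
Qed.

End Smooth.

(** * From continuous partial derivatives to differentiability *)

Section C1.
Context {R : realType}.

Lemma is_derive_along (V : normedModType R) (f : V -> R) (x v : V) (s : R) :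
  derivable f (x + s *: v) v ->
  is_derive s (1 : R) (fun t : R => f (x + t *: v)) ('D_v f (x + s *: v)).
Proof.
move=> df.
have E : (fun h : R => h^-1 *: (((fun t : R => f (x + t *: v)) \o shift s) (h *: 1) - f (x + s *: v))) =
         (fun h : R => h^-1 *: ((f \o shift (x + s *: v)) (h *: v) - f (x + s *: v))).
  by apply/funext => h /=; rewrite [h%:A]mulr1 scalerDl addrCA addrA.
by split; [rewrite /derivable E | rewrite /derive E].
Qed.

Lemma mvt_line (V : normedModType R) (f : V -> R) (x v : V) (t : R) :
  (forall s, `|s| <= `|t| -> derivable f (x + s *: v) v) ->
  exists2 s, `|s| <= `|t| & f (x + t *: v) - f x = t * 'D_v f (x + s *: v).
Proof.
move=> H; pose p s := f (x + s *: v).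
have D s : `|s| <= `|t| -> is_derive s (1 : R) p ('D_v f (x + s *: v)).
  by move=> st; apply: is_derive_along; apply: H.
have C a b : (forall s, s \in `[a, b] -> `|s| <= `|t|) -> {within `[a, b], continuous p}.
  move=> ab; apply: derivable_within_continuous => s /ab /D [//].
have p0 : p 0 = f x by rewrite /p scale0r addr0.
have [t0|t0] := leP 0 t.
  have B s : s \in `[0, t] -> `|s| <= `|t|.
    by rewrite in_itv /= => /andP[s0 st]; rewrite !ger0_norm.
  have [s s_in E] := MVT_segment t0 (fun s (hs : s \in `]0, t[) => D s (B s (subset_itv_oo_cc hs)))
    (C 0 t B).
  by exists s; [exact: B | rewrite -p0 -/(p t) E subr0 mulrC].
have B s : s \in `[t, 0] -> `|s| <= `|t|.
  by rewrite in_itv /= => /andP[s0 st]; rewrite !ler0_norm ?lerN2 // ltW.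
have [s s_in E] := MVT_segment (ltW t0) (fun s (hs : s \in `]t, 0[) => D s (B s (subset_itv_oo_cc hs)))
  (C t 0 B).
exists s; first exact: B.
by rewrite -p0 -/(p t) -opprB E sub0r mulrN opprK mulrC.
Qed.

Definition e0 : 'I_2 := @Ordinal 2 0 isT.
Definition e1 : 'I_2 := @Ordinal 2 1 isT.

Lemma sum2 (V : nmodType) (F : 'I_2 -> V) : \sum_i F i = F e0 + F e1.
Proof.
rewrite !big_ord_recr big_ord0 /= add0r.
by congr (_ + _); congr F; apply: val_inj.
Qed.

Lemma ord2E (P : 'I_2 -> Prop) : P e0 -> P e1 -> forall i, P i.
Proof.
move=> p0 p1 [[|[|//]] h].
- by rewrite (_ : Ordinal h = e0) //; apply: val_inj.
- by rewrite (_ : Ordinal h = e1) //; apply: val_inj.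
Qed.

Lemma row2E (h : 'rV[R]_2) :
  h = h 0 e0 *: delta_mx 0 e0 + h 0 e1 *: delta_mx 0 e1.
Proof. by rewrite {1}[h]row_sum_delta sum2. Qed.

(** [Ck_on] speaks of partial derivatives only. The mean value theorem along the two coordinate
    segments from [u] to [u + h] turns their continuity into a gradient. *)
Lemma C1_has_grad (U : set 'rV[R]_2) (f : 'rV[R]_2 -> R) u : open U -> U u ->
  Ck_on 1 U f -> has_grad f u (\row_a pderiv a f u).
Proof.
move=> oU Uu C1; apply: has_gradP => e e_gt0.
have P a : \forall y \near u, `|pderiv a f u - pderiv a f y| <= e / 2.
  have [_ c] := C1 a; have := c u Uu => /cvgrPdist_le; apply.
  by rewrite divr_gt0.
have : \forall y \near u, [/\ U y, `|pderiv e0 f u - pderiv e0 f y| <= e / 2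
                              & `|pderiv e1 f u - pderiv e1 f y| <= e / 2].
  near=> y; split; [|by near: y; exact: P..].
  by near: y; apply: open_nbhs_mem.
move/nbhs_ballP => [r /= r0 Hr]; exists r => // h hr.
pose d0 : 'rV[R]_2 := delta_mx 0 e0; pose d1 : 'rV[R]_2 := delta_mx 0 e1.
have h0 := entry_le_norm h e0; have h1 := entry_le_norm h e1.
have inb (s t : R) : `|s| <= `|h| -> `|t| <= `|h| -> ball u r (u + s *: d0 + t *: d1).
  move=> sh th; rewrite -ball_normE /= opprD addrA opprD addNKr -opprD normrN.
  apply: le_lt_trans hr; rewrite [leLHS]/Num.Def.normr /= mx_normrE; apply: bigmax_le => [|[i j] _] /=.
    exact: normr_ge0.
  rewrite (ord1 i) !mxE; move: j; elim/ord2E; rewrite !eqxx /=.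
    by rewrite mulr1 mulr0 addr0.
  by rewrite mulr0 mulr1 add0r.
have hE : u + h = u + h 0 e0 *: d0 + h 0 e1 *: d1 by rewrite {1}[h]row2E addrA.
have z0 : `|0 : R| <= `|h| by rewrite normr0 normr_ge0.
have D1 s : `|s| <= `|h 0 e1| -> derivable f (u + h 0 e0 *: d0 + s *: d1) d1.
  by move=> hs; apply: (C1 e1).1; case: (Hr _ (inb _ _ h0 (le_trans hs h1))).
have D0 s : `|s| <= `|h 0 e0| -> derivable f (u + s *: d0) d0.
  move=> hs; apply: (C1 e0).1; have := inb s 0 (le_trans hs h0) z0.
  by rewrite scale0r addr0 => /Hr [].
have [s1 s1h E1] := mvt_line D1.
have [s0 s0h E0] := mvt_line D0.
have B1 : `|pderiv e1 f u - pderiv e1 f (u + h 0 e0 *: d0 + s1 *: d1)| <= e / 2.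
  by case: (Hr _ (inb _ _ h0 (le_trans s1h h1))).
have B0 : `|pderiv e0 f u - pderiv e0 f (u + s0 *: d0)| <= e / 2.
  have := inb s0 0 (le_trans s0h h0) z0; rewrite scale0r addr0.
  by move=> /Hr [].
move: E0 E1; rewrite -/(pderiv e1 f _) -/(pderiv e0 f _).
set q1 := pderiv e1 f (_ + _) in B1 *; set q0 := pderiv e0 f (_ + _) in B0 * => E0 E1.
have -> : f (u + h) = f u + h 0 e0 * q0 + h 0 e1 * q1 by rewrite hE -E0 -E1; ring.
have -> : lform (\row_a pderiv a f u) h = h 0 e0 * pderiv e0 f u + h 0 e1 * pderiv e1 f u.
  by rewrite /lform sum2; congr (_ * _ + _ * _); rewrite mxE.
rewrite (_ : _ - _ = h 0 e1 * (q1 - pderiv e1 f u) + h 0 e0 * (q0 - pderiv e0 f u)); last by ring.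
apply: (le_trans (ler_normD _ _)); rewrite !normrM (distrC q1) (distrC q0).
rewrite [e]splitr mulrDl lerD // mulrC ler_pM //.
Unshelve. all: by end_near.
Qed.

End C1.

(** * Mean curvature of level sets in a conformal metric *)

Section LinearAlgebra.
Context {R : realType}.
Implicit Types (p q n v w : 'rV[R]_3) (H : 'M[R]_3).

Definition quad H v w : R := \sum_(j < 3) lform (row j H) v * w 0 j.

Definition gram p q : R := lform p p * lform q q - lform p q ^+ 2.

Definition cross p q : 'rV[R]_3 := \row_j \sum_(b < 3) \sum_(c < 3) lc j b c * p 0 b * q 0 c.

Lemma crossE p q :
  (cross p q 0 o0 = p 0 o1 * q 0 o2 - p 0 o2 * q 0 o1) *
  (cross p q 0 o1 = p 0 o2 * q 0 o0 - p 0 o0 * q 0 o2) *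
  (cross p q 0 o2 = p 0 o0 * q 0 o1 - p 0 o1 * q 0 o0).
Proof. by rewrite /cross !mxE !sum3 /lc /=; split; [split|]; ring. Qed.

Lemma row3P v w : v 0 o0 = w 0 o0 -> v 0 o1 = w 0 o1 -> v 0 o2 = w 0 o2 -> v = w.
Proof.
by move=> h0 h1 h2; apply/rowP => i; rewrite -[i]/(i : 'I_3); move: i; elim/ord3E.
Qed.

Lemma lformC p q : lform p q = lform q p.
Proof. by apply: eq_bigr => i _; rewrite mulrC. Qed.

Lemma lform_sq n : 0 <= lform n n.
Proof. by apply: sumr_ge0 => i _; rewrite -expr2 sqr_ge0. Qed.

Lemma lform_eq0 n : lform n n = 0 -> n = 0.
Proof.
rewrite /lform sum3 => E; have s i := sqr_ge0 (n 0 i).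
have := s o0; have := s o1; have := s o2; rewrite !expr2 => h2 h1 h0.
by apply: row3P; rewrite mxE; apply/eqP; rewrite -[_ == 0]orbb -mulf_eq0; apply/eqP; lra.
Qed.

Lemma lform_gt0 n : n != 0 -> 0 < lform n n.
Proof.
move=> n0; rewrite lt_def lform_sq andbT; apply: contra n0 => /eqP/lform_eq0 ->.
exact: eqxx.
Qed.

Lemma gramE p q : gram p q = lform (cross p q) (cross p q).
Proof. by rewrite /gram /lform !sum3 !crossE; ring. Qed.

Lemma gram_ge0 p q : 0 <= gram p q.
Proof. by rewrite gramE lform_sq. Qed.

(** The expansion of [n] in [p], [q] and [cross p q], cleared of denominators; the coefficients of
    [p] and [q] are combinations of the two vanishing products. *)
Lemma perp_cross p q n : lform p n = 0 -> lform q n = 0 ->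
  forall i, gram p q * n 0 i = lform (cross p q) n * cross p q 0 i.
Proof.
move=> pn qn i.
have -> : gram p q * n 0 i = lform (cross p q) n * cross p q 0 i
   + (lform q q * lform p n - lform p q * lform q n) * p 0 i
   + (lform p p * lform q n - lform p q * lform p n) * q 0 i.
  move: i; elim/ord3E; rewrite gramE /lform !sum3 !crossE; ring.
by rewrite pn qn; ring.
Qed.

(** The trace of [H] over the plane of [p] and [q] is the full trace minus the value on the unit
    normal, here multiplied out. After multiplication by [gram p q ^+ 2], [n] may be replaced by a
    multiple of [cross p q], where the identity is polynomial. *)
Lemma tangent_trace H p q n : lform p n = 0 -> lform q n = 0 ->
  lform n n * (lform q q * quad H p p - lform p q * (quad H p q + quad H q p) +
               lform p p * quad H q q) =
  gram p q * (lform n n * \tr H - quad H n n).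
Proof.
move=> pn qn.
have C := perp_cross pn qn; set t := lform (cross p q) n in C.
have E : lform q q * quad H p p - lform p q * (quad H p q + quad H q p) +
         lform p p * quad H q q = gram p q * \tr H - quad H (cross p q) (cross p q).
  rewrite gramE /quad /mxtrace /lform !sum3 !crossE !mxE; ring.
have Q : gram p q ^+ 2 * quad H n n = t ^+ 2 * quad H (cross p q) (cross p q).
  rewrite /quad /lform !sum3.
  transitivity (
   (row o0 H 0 o0 * (gram p q * n 0 o0) + row o0 H 0 o1 * (gram p q * n 0 o1) + row o0 H 0 o2 * (gram p q * n 0 o2)) * (gram p q * n 0 o0) +
   (row o1 H 0 o0 * (gram p q * n 0 o0) + row o1 H 0 o1 * (gram p q * n 0 o1) + row o1 H 0 o2 * (gram p q * n 0 o2)) * (gram p q * n 0 o1) +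
   (row o2 H 0 o0 * (gram p q * n 0 o0) + row o2 H 0 o1 * (gram p q * n 0 o1) + row o2 H 0 o2 * (gram p q * n 0 o2)) * (gram p q * n 0 o2)).
    by ring.
  by rewrite !C; ring.
have S : gram p q ^+ 2 * lform n n = t ^+ 2 * gram p q.
  rewrite [in RHS]gramE /lform !sum3.
  transitivity ((gram p q * n 0 o0) * (gram p q * n 0 o0) + (gram p q * n 0 o1) * (gram p q * n 0 o1)
     + (gram p q * n 0 o2) * (gram p q * n 0 o2)); first by ring.
  by rewrite !C; ring.
have [g0|g0] := eqVneq (gram p q) 0; last first.
  apply: (mulfI (expf_neq0 2 g0)); rewrite E.
  transitivity ((gram p q ^+ 2 * lform n n) * (gram p q * \tr H - quad H (cross p q) (cross p q))).
    by ring.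
  rewrite S.
  transitivity (gram p q * ((gram p q ^+ 2 * lform n n) * \tr H - gram p q ^+ 2 * quad H n n)).
    by rewrite S Q; ring.
  by ring.
have c0 : cross p q = 0 by apply: lform_eq0; rewrite -gramE.
rewrite E g0 c0 !mul0r sub0r /quad big1 ?oppr0 ?mulr0 // => j _.
by rewrite mxE mulr0.
Qed.

Lemma lformDl l l' v : lform (l + l') v = lform l v + lform l' v.
Proof. by rewrite /lform -big_split; apply: eq_bigr => b _; rewrite mxE mulrDr. Qed.

Lemma lformZl a l v : lform (a *: l) v = a * lform l v.
Proof. by rewrite /lform mulr_sumr; apply: eq_bigr => b _; rewrite mxE; ring. Qed.

Lemma lformNl l v : lform (- l) v = - lform l v.
Proof. by rewrite -scaleN1r lformZl mulN1r. Qed.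

Lemma tr_invmx2 (A B : 'M[R]_2) : A e0 e0 * A e1 e1 - A e0 e1 * A e1 e0 != 0 ->
  \tr (invmx A *m B) =
  (A e1 e1 * B e0 e0 - A e0 e1 * B e1 e0 - A e1 e0 * B e0 e1 + A e0 e0 * B e1 e1) /
  (A e0 e0 * A e1 e1 - A e0 e1 * A e1 e0).
Proof.
set D := _ - _ => D0.
pose X : 'M[R]_2 := \matrix_(i, j) (D^-1 *
  (if i == e0 then if j == e0 then A e1 e1 else - A e0 e1
   else if j == e0 then - A e1 e0 else A e0 e0)).
have AX : A *m X = 1%:M.
  apply/matrixP => i j; rewrite !mxE sum2 !mxE.
  by move: i j; do 2![elim/ord2E]; rewrite /=; rewrite ?mulr1n ?mulr0n;
    apply: (mulfI D0); rewrite /D; field.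
have [Au _] := mulmx1_unit AX.
have -> : invmx A = X by rewrite -[X](mulKmx Au) AX mulmx1.
rewrite /mxtrace sum2 !mxE !sum2 !mxE /=; field; exact: D0.
Qed.

End LinearAlgebra.

(** * Mean curvature of a parametrized surface in a conformal metric *)

Section ConformalCurvature.
Context {R : realType}.
Variables (Om : 'rV[R]_3 -> R) (f : 'rV[R]_2 -> 'rV[R]_3) (u : 'rV[R]_2) (G : 'rV[R]_3).
Let g : metric R := fun x => (Om x ^+ 2)%:M.
Hypotheses (om0 : 0 < Om (f u)) (dOm : has_grad Om (f u) G).
Local Notation o := (Om (f u)).
Variables (fa : 'I_2 -> 'rV[R]_3) (fab : 'I_2 -> 'I_2 -> 'rV[R]_3).
Hypotheses (faE : forall a, pderiv a f u = fa a)
  (fabE : forall a b, pderiv a (pderiv b f) u = fab a b).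

Lemma pderiv_grad n (F : 'rV[R]_n -> R) x l a : has_grad F x l -> pderiv a F x = l 0 a.
Proof.
move=> [dF lF]; rewrite /pderiv deriveE // lF /lform (bigD1 a) //= big1 ?addr0.
  by rewrite mxE !eqxx mul1r.
by move=> i ia; rewrite mxE eqxx (negPf ia) mul0r.
Qed.

Lemma pderiv_conformal l i j :
  pderiv l (fun y => g y i j) (f u) = 2 * o * G 0 l * (i == j)%:R.
Proof.
have -> : (fun y => g y i j) = (fun y => (i == j)%:R * (Om y * Om y)).
  by apply/funext => y; rewrite /g mxE; case: eqP => _; rewrite ?mulr1n ?mulr0n /=; ring.
have := has_gradM (has_gradC (i == j)%:R (f u)) (has_gradM dOm dOm).
by move=> /(pderiv_grad l) ->; rewrite !mxE; ring.
Qed.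

Lemma christoffel_conformal k i j : christoffel g (f u) k i j =
  o^-1 * (G 0 i * (j == k)%:R + G 0 j * (i == k)%:R - G 0 k * (i == j)%:R).
Proof.
rewrite /christoffel /g invmx_scalar -/g.
under eq_bigr do rewrite !pderiv_conformal mxE.
rewrite (bigD1 k) //= big1 ?addr0 => [|l lk]; last first.
  by rewrite eq_sym (negPf lk) mulr0n mul0r.
rewrite eqxx mulr1n; field; exact: lt0r_neq0.
Qed.

Lemma conformal_sum c (x y : 'rV[R]_3) k :
  \sum_(i < 3) \sum_(j < 3)
    c * (G 0 i * (j == k)%:R + G 0 j * (i == k)%:R - G 0 k * (i == j)%:R) * x 0 i * y 0 j =
  c * (lform G x * y 0 k + lform G y * x 0 k - lform x y * G 0 k).
Proof. by rewrite /lform !sum3; move: k; elim/ord3E => /=; ring. Qed.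

Lemma cov_hessian_conformal a b k : cov_hessian g f u a b 0 k =
  fab a b 0 k + o^-1 * (lform G (fa a) * fa b 0 k + lform G (fa b) * fa a 0 k -
                        lform (fa a) (fa b) * G 0 k).
Proof.
rewrite /cov_hessian mxE [in X in _ + X]mxE fabE !faE; congr (_ + _).
rewrite -conformal_sum; apply: eq_bigr => i _; apply: eq_bigr => j _.
by rewrite christoffel_conformal.
Qed.

Lemma inner_scalar c (v w : 'rV[R]_3) : inner c%:M v w = c * lform w v.
Proof.
rewrite /inner mul_mx_scalar -scalemxAl mxE; congr (_ * _).
by rewrite mxE; apply: eq_bigr => i _; rewrite mxE.
Qed.

(** Paired with the normal, the Christoffel terms containing a tangent vector drop out and only the
    one along [G] survives. It is proportional to the first fundamental form, so its trace
    contributes the last term. *)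
Lemma mean_curvature_conformal nu : gram (fa e0) (fa e1) != 0 ->
  unit_normal g f u nu ->
  gram (fa e0) (fa e1) * mean_curvature g f u nu =
  lform (fa e1) (fa e1) * lform nu (fab e0 e0) -
  lform (fa e0) (fa e1) * (lform nu (fab e0 e1) + lform nu (fab e1 e0)) +
  lform (fa e0) (fa e0) * lform nu (fab e1 e1) -
  2 * gram (fa e0) (fa e1) * lform G nu / o.
Proof.
move=> g0 [nuT _]; have o0' : o != 0 by apply: lt0r_neq0.
have T a : lform nu (fa a) = 0.
  have := nuT a; rewrite /g inner_scalar faE => /eqP; rewrite mulf_eq0 expf_eq0 /= (negPf o0') /=.
  by move/eqP.
have II a b : second_form g f u nu a b =
    o ^+ 2 * (lform nu (fab a b) - lform (fa a) (fa b) * lform G nu / o).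
  rewrite mxE inner_scalar; congr (_ * _).
  transitivity (lform nu (fab a b) + o^-1 * (lform G (fa a) * lform nu (fa b) +
     lform G (fa b) * lform nu (fa a) - lform (fa a) (fa b) * lform nu G)); last first.
    rewrite !T (lformC nu G) !mulr0.
    by move: (lform nu (fab a b)) (lform (fa a) (fa b)) (lform G nu) => x y z; field.
  rewrite /(lform nu) !sum3 !cov_hessian_conformal.
  move: (lform G (fa a)) (lform G (fa b)) (lform (fa a) (fa b)) => x y z; field; exact: o0'.
have FF a b : first_form g f u a b = o ^+ 2 * lform (fa a) (fa b).
  by rewrite mxE inner_scalar !faE lformC.
have D0 : first_form g f u e0 e0 * first_form g f u e1 e1 -
          first_form g f u e0 e1 * first_form g f u e1 e0 != 0.
  rewrite !FF (lformC (fa e1) (fa e0)).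
  rewrite (_ : _ - _ = o ^+ 4 * gram (fa e0) (fa e1)); last by rewrite /gram; ring.
  by rewrite mulf_neq0 // expf_neq0.
rewrite /mean_curvature (tr_invmx2 _ D0) !II !FF (lformC (fa e1) (fa e0)).
move: g0 D0; rewrite !FF (lformC (fa e1) (fa e0)) /gram.
move: (lform (fa e0) (fa e0)) (lform (fa e0) (fa e1)) (lform (fa e1) (fa e1)) => x y z.
move: (lform nu (fab e0 e0)) (lform nu (fab e0 e1)) (lform nu (fab e1 e0))
  (lform nu (fab e1 e1)) (lform G nu) => s00 s01 s10 s11 t.
by move=> g0 D0; field; rewrite o0' D0.
Qed.

End ConformalCurvature.

Section RankTwo.
Context {R : realType}.

(** By Cauchy-Schwarz the Gram determinant vanishes exactly on dependent pairs; this replaces the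
    rank condition of an immersion by a scalar one. *)
Lemma tangent_rankP (T : 'I_2 -> 'rV[R]_3) :
  (\rank (\matrix_(a < 2) T a) = 2%N) <-> gram (T e0) (T e1) != 0.
Proof.
pose A : 'M[R]_(2, 3) := \matrix_(a < 2) T a.
have lin (v : 'rV[R]_2) : v *m A = v 0 e0 *: T e0 + v 0 e1 *: T e1.
  apply/rowP => j; rewrite !mxE sum2 !mxE //.
have lf (x y : R) : lform (x *: T e0 + y *: T e1) (x *: T e0 + y *: T e1) =
   x ^+ 2 * lform (T e0) (T e0) + 2 * x * y * lform (T e0) (T e1) + y ^+ 2 * lform (T e1) (T e1).
  by rewrite /lform !sum3 !mxE; ring.
split=> [r2|g0]; last first.
  apply/eqP; rewrite -[_ == _]/(row_free A); apply: inj_row_free => v; rewrite lin => v0.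
  have := lf (v 0 e0) (v 0 e1); rewrite v0.
  rewrite [lform 0 0]big1 => [E|i _]; last by rewrite mxE mul0r.
  have := E; move: g0; rewrite /gram.
  set e := lform (T e0) (T e0); set k := lform (T e0) (T e1); set m := lform (T e1) (T e1).
  set x := v 0 e0; set y := v 0 e1 => g0 E'.
  have e0' : e != 0.
    apply: contra g0 => /eqP e0'; have /lform_eq0 t0 : lform (T e0) (T e0) = 0 by [].
    have k0 : k = 0 by rewrite /k t0 /lform big1 // => i _; rewrite mxE mulr0.
    by rewrite e0' k0 mul0r expr0n /= subrr.
  have g1 : 0 < e * m - k ^+ 2 by have := gram_ge0 (T e0) (T e1); rewrite lt_def g0.
  have Y : (e * x + k * y) ^+ 2 + (e * m - k ^+ 2) * y ^+ 2 = 0.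
    transitivity (e * (x ^+ 2 * e + 2 * x * y * k + y ^+ 2 * m)); first by ring.
    by rewrite -E' mulr0.
  have y0 : y = 0.
    apply/eqP; rewrite -sqrf_eq0; apply/eqP.
    by have := sqr_ge0 (e * x + k * y); have := sqr_ge0 y; nra.
  have x0 : x = 0.
    move: Y; rewrite y0 !mulr0 addr0 expr0n /= mulr0 addr0 => /eqP.
    by rewrite sqrf_eq0 mulf_eq0 (negPf e0') => /eqP.
  by apply/rowP => i; rewrite mxE; move: i; elim/ord2E.
apply/negP => /eqP g0.
have free : row_free A by apply/eqP.
have inj (x y : R) : x *: T e0 + y *: T e1 = 0 -> x = 0 /\ y = 0.
  move=> E; pose v : 'rV[R]_2 := \row_i (if i == e0 then x else y).
  have : v *m A = 0 by rewrite lin !mxE.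
  rewrite -(mul0mx _ A) => /(row_free_inj free) v0.
  by split; [have := congr1 (fun w : 'rV[R]_2 => w 0 e0) v0
            |have := congr1 (fun w : 'rV[R]_2 => w 0 e1) v0]; rewrite !mxE.
have [m0 k0] : lform (T e1) (T e1) = 0 /\ - lform (T e0) (T e1) = 0.
  apply: inj; apply: lform_eq0; rewrite lf.
  by transitivity (lform (T e1) (T e1) * gram (T e0) (T e1)); [rewrite /gram; ring | rewrite g0 mulr0].
have t0 := lform_eq0 m0.
have [_ /eqP] : (0 : R) = 0 /\ (1 : R) = 0 by apply: inj; rewrite t0 scale0r scaler0 addr0.
by rewrite oner_eq0.
Qed.

End RankTwo.

(** * Derivative tests at an interior maximum *)

Section SecondDerivativeTest.
Context {R : realType}.

Lemma is_derive_line n (F : 'rV[R]_n -> R) x l v (s : R) : has_grad F (x + s *: v) l ->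
  is_derive s (1 : R) (fun t => F (x + t *: v)) (lform l v).
Proof.
move=> [dF lF]; apply: is_derive_eq; last by rewrite -lF -deriveE.
by apply: is_derive_along; apply: diff_derivable.
Qed.

Lemma line_max (p p' : R -> R) (r d : R) : 0 < r ->
  (forall t, `|t| < r -> is_derive t (1 : R) p (p' t)) ->
  is_derive (0 : R) (1 : R) p' d -> (forall t, `|t| < r -> p t <= p 0) ->
  p' 0 = 0 /\ d <= 0.
Proof.
move=> r0 Dp Dp' pmax.
have itv t : t \in `](- r), r[ -> `|t| < r by rewrite in_itv /= ltr_norml.
have p'0 : p' 0 = 0.
  have r2 : - r < r by lra.
  have Dd t : t \in `](- r), r[ -> derivable p t 1 by move=> /itv/Dp [].
  have z : (0 : R) \in `](- r), r[ by rewrite in_itv /=; lra.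
  have := derive1_at_max (ltW r2) Dd z (fun t ht => pmax t (itv t ht)).
  have D0 := Dp 0 ltac:(by rewrite normr0).
  by case=> _ E; case: D0 => _ <-.
(* If [d > 0], then [p' s / s > 0] for all small [s > 0], whereas the mean value theorem on
   [[0, t1]] yields such an [s] with [p' s <= 0]. *)
split => //; rewrite leNgt; apply/negP => d0.
have : \forall t \near (0 : R)^', `|d - t^-1 *: (p' (t *: 1 + 0) - p' 0)| < d.
  have [dp' E] := Dp'; have := dp' => /cvgrPdist_lt H.
  have := H d d0; rewrite -[lim _]/('D_1 p' 0) E.
  by apply.
rewrite near_withinE => /nbhs_ballP [e /= e0 He].
pose t1 := Num.min e r / 2.
have m0 : 0 < Num.min e r by rewrite lt_min e0.
have t10 : 0 < t1 by rewrite divr_gt0.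
have me : Num.min e r <= e by rewrite ge_min lexx.
have mr : Num.min e r <= r by rewrite ge_min lexx orbT.
have t1e : t1 < e by rewrite /t1; lra.
have t1r : t1 < r by rewrite /t1; lra.
have Dc t : t \in `[0, t1] -> is_derive t (1 : R) p (p' t).
  rewrite in_itv /= => /andP[a b]; apply: Dp; rewrite ger0_norm //; lra.
have cp : {within `[0, t1], continuous p}.
  by apply: derivable_within_continuous => t /Dc [].
have [s s_in E] := @MVT R p p' 0 t1 t10 (fun t ht => Dc t (subset_itv_oo_cc ht)) cp.
move: s_in; rewrite in_itv /= => /andP[s0 st].
have := pmax t1 ltac:(rewrite gtr0_norm; lra); rewrite -subr_le0 E subr0 pmulr_lle0 // => p's.
have := He s ltac:(by rewrite /ball /= sub0r normrN gtr0_norm; lra) ltac:(by rewrite gt_eqF).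
rewrite addr0 [s%:A]mulr1 p'0 subr0.
have : s^-1 *: p' s <= 0 by rewrite /GRing.scale /= pmulr_rle0 // invr_gt0.
set z := s^-1 *: p' s => z0; rewrite ger0_norm; lra.
Qed.

Lemma line_in_open (U : set 'rV[R]_2) u0 v : open U -> U u0 ->
  exists2 r : R, 0 < r & forall t, `|t| < r -> U (u0 + t *: v).
Proof.
move=> oU U0.
have : \forall t \near (0 : R), U (u0 + t *: v).
  have c : (u0 + t *: v) @[t --> (0 : R)] --> u0 + (0 : R) *: v.
    apply: cvgD; first exact: cvg_cst.
    by apply: cvgZr_tmp; exact: cvg_id.
  by apply: c; rewrite scale0r addr0; apply: open_nbhs_mem.
move/nbhs_ballP => [r /= r0 Hr]; exists r => // t tr.
by apply: Hr; rewrite /ball /= sub0r normrN.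
Qed.

Lemma first_test (U : set 'rV[R]_2) (F : 'rV[R]_2 -> R) (l : 'rV[R]_2 -> 'rV[R]_2) u0 :
  open U -> U u0 -> (forall u, U u -> has_grad F u (l u)) ->
  (forall u, U u -> F u <= F u0) -> forall v, lform (l u0) v = 0.
Proof.
move=> oU U0 HF Fmax v.
have [r r0 inU] := line_in_open v oU U0.
have D t (ht : `|t| < r) := is_derive_line (HF _ (inU t ht)).
have itr t : t \in `]-r, r[ -> `|t| < r by rewrite in_itv /= ltr_norml.
have rr : - r <= r by rewrite ge0_cp // ltW.
have der t : t \in `]-r, r[ -> derivable (fun s : R => F (u0 + s *: v)) t (1 : R).
  by move=> /itr ht; case: (D t ht).
have z : 0 \in `]-r, r[ by rewrite in_itv /= oppr_lt0 r0.
have [t ht|_ E0] := derive1_at_max rr der z.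
  by rewrite scale0r addr0; apply: Fmax; apply: inU; exact: itr.
have [_ E1] := D 0 (itr 0 z).
by move: E1; rewrite E0 scale0r addr0.
Qed.

Lemma second_test (U : set 'rV[R]_2) (F : 'rV[R]_2 -> R) (Ga : 'rV[R]_2 -> 'rV[R]_2)
    (S : 'M[R]_2) u0 : open U -> U u0 ->
  (forall u, U u -> has_grad F u (Ga u)) ->
  (forall b, has_grad (fun u => Ga u 0 b) u0 (row b S)) ->
  (forall u, U u -> F u <= F u0) ->
  forall v, lform (Ga u0) v = 0 /\ \sum_(b < 2) lform (row b S) v * v 0 b <= 0.
Proof.
move=> oU U0 HF HG Fmax v.
have [r r0 inU] := line_in_open v oU U0.
have D b : is_derive (0 : R) (1 : R) (fun t => v 0 b * Ga (u0 + t *: v) 0 b)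
    (v 0 b * lform (row b S) v).
  have Db : is_derive (0 : R) (1 : R) (fun t => Ga (u0 + t *: v) 0 b) (lform (row b S) v).
    by apply: (is_derive_line (F := fun u => Ga u 0 b)); rewrite scale0r addr0.
  exact: is_deriveZ.
have D2 : is_derive (0 : R) (1 : R) (fun t => lform (Ga (u0 + t *: v)) v)
    (\sum_(b < 2) lform (row b S) v * v 0 b).
  have -> : (fun t => lform (Ga (u0 + t *: v)) v) =
      (fun t => v 0 e0 * Ga (u0 + t *: v) 0 e0 + v 0 e1 * Ga (u0 + t *: v) 0 e1).
    by apply/funext => t; rewrite /lform sum2.
  rewrite sum2 !(mulrC (lform _ _)); have D0 := D e0; have D1 := D e1; exact: is_deriveD.
have D1 t (ht : `|t| < r) := is_derive_line (HF _ (inU t ht)).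
have le0 t : `|t| < r -> F (u0 + t *: v) <= F (u0 + 0 *: v).
  by move=> ht; rewrite scale0r addr0; apply: Fmax; apply: inU.
have [E1 E2] := line_max r0 D1 D2 le0; split => //.
by move: E1; rewrite scale0r addr0.
Qed.

End SecondDerivativeTest.

(** * Comparison of a surface with the level sets of a function *)

Section LevelSets.
Context {R : realType}.

(* [|n|^2] times the mean curvature, for the conformal metric [Om^2 g_E] and up to a positive factor,
   of the level set through a point of a function with gradient [n] and Hessian [H] there;
   [o] and [G] are the value and gradient of [Om] at that point. *)
Definition level_curv (o : R) (G n : 'rV[R]_3) (H : 'M[R]_3) : R :=
  lform n n * \tr H - quad H n n + 2 * lform n n * lform G n / o.

(** The algebra of the comparison: where a surface is tangent to a level set of [h], its mean
    curvature is, up to positive factors and [lam], the trace of the Hessian of [h] restricted to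
    the surface minus [level_curv]. *)
Lemma balance_algebra (p q n G nu x00 x01 x10 x11 : 'rV[R]_3) (H : 'M[R]_3) lam o : o != 0 ->
  nu = lam *: n -> lform n p = 0 -> lform n q = 0 ->
  lform n n * (lform q q * lform nu x00 - lform p q * (lform nu x01 + lform nu x10) +
               lform p p * lform nu x11 - 2 * gram p q * lform G nu / o) =
  lam * (lform n n * (lform q q * (quad H p p + lform n x00) -
                      lform p q * (quad H p q + lform n x01 + (quad H q p + lform n x10)) +
                      lform p p * (quad H q q + lform n x11)) -
         gram p q * level_curv o G n H).
Proof.
move=> o0 -> np nq.
have := tangent_trace H (etrans (lformC p n) np) (etrans (lformC q n) nq).
rewrite /level_curv !lformZl (lformC G (_ *: _)) lformZl (lformC n G).
move: (quad H p p) (quad H p q) (quad H q p) (quad H q q) (quad H n n) (\tr H).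
move: (lform n x00) (lform n x01) (lform n x10) (lform n x11).
move: (lform p p) (lform p q) (lform q q) (lform n n) (lform G n) (gram p q).
move=> e k m nn gn D y00 y01 y10 y11 q00 q01 q10 q11 qn tr E.
transitivity (lam * (nn * (m * (q00 + y00) - k * (q01 + y01 + (q10 + y10)) + e * (q11 + y11))
  - nn * (m * q00 - k * (q01 + q10) + e * q11) - 2 * D * nn * gn / o)); first by field.
by rewrite E; field.
Qed.

Lemma quadratic2 (A : 'M[R]_2) v : \sum_(b < 2) lform (row b A) v * v 0 b =
  A e0 e0 * v 0 e0 ^+ 2 + (A e0 e1 + A e1 e0) * v 0 e0 * v 0 e1 + A e1 e1 * v 0 e1 ^+ 2.
Proof. by rewrite /lform !sum2 !mxE; ring. Qed.

Lemma neg_semidef_trace (e k m s00 s01 s10 s11 : R) :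
  (forall x y, s00 * x ^+ 2 + (s01 + s10) * x * y + s11 * y ^+ 2 <= 0) ->
  0 < e -> 0 <= e * m - k ^+ 2 -> m * s00 - k * (s10 + s01) + e * s11 <= 0.
Proof.
move=> Q e0p D0; rewrite -(pmulr_rle0 _ e0p).
have S00 : s00 <= 0 by have := Q 1 0; rewrite expr1n expr0n /= !mulr0 !addr0 mulr1.
apply: (@le_trans _ _ ((e * m - k ^+ 2) * s00)); last by rewrite mulr_ge0_le0.
rewrite -subr_le0; apply: le_trans (Q (- k) e).
by apply: eqle; ring.
Qed.

Lemma zero_trace (e k m s00 s01 s10 s11 : R) : s00 = 0 -> s01 = 0 -> s10 = 0 -> s11 = 0 ->
  m * s00 - k * (s10 + s01) + e * s11 = 0.
Proof. by move=> -> -> -> ->; ring. Qed.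

Lemma row_eq0 m n (A : 'M[R]_(m, n)) b a : row b A = 0 -> A b a = 0.
Proof. by move=> r0; have := congr1 (fun w : 'rV[R]_n => w 0 a) r0; rewrite !mxE. Qed.

Lemma has_grad_const n (U : set 'rV[R]_n) (F : 'rV[R]_n -> R) u l c : open U -> U u ->
  (forall y, U y -> F y = c) -> has_grad F u l -> l = 0.
Proof.
move=> oU Uu Fc HF; apply/rowP => a; rewrite -(pderiv_grad a HF) mxE /pderiv.
have E : \near u, F u = cst c u.
  by near=> y; apply: Fc; near: y; apply: open_nbhs_mem.
by rewrite (near_eq_derive _ E) derive_cst.
Unshelve. all: by end_near.
Qed.

Variables (Om : 'rV[R]_3 -> R) (f : 'rV[R]_2 -> 'rV[R]_3) (U : set 'rV[R]_2) (u0 : 'rV[R]_2).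
Variables (h : 'rV[R]_3 -> R) (N : 'rV[R]_3 -> 'rV[R]_3) (Hm : 'M[R]_3) (G : 'rV[R]_3).
Hypotheses (oU : open U) (Uu0 : U u0) (sf : smooth_on U f).
Hypothesis rank2 : \rank (\matrix_(a < 2) pderiv a f u0) = 2%N.
Hypotheses (om0 : 0 < Om (f u0)) (dOm : has_grad Om (f u0) G).
Hypothesis dh : forall u, U u -> has_grad h (f u) (N (f u)).
Hypothesis dN : forall j, has_grad (fun y => N y 0 j) (f u0) (row j Hm).
Hypothesis n0 : N (f u0) != 0.

Let g : metric R := fun x => (Om x ^+ 2)%:M.
Let Ga u : 'rV[R]_2 := \row_b lform (N (f u)) (pderiv b f u).
Let S : 'M[R]_2 := \matrix_(b, a) (quad Hm (pderiv a f u0) (pderiv b f u0) +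
  lform (N (f u0)) (pderiv a (pderiv b f) u0)).

Let coord_grad u j : U u ->
  has_grad (fun y => f y 0 j) u (row j (\matrix_(j < 3, a < 2) pderiv a f u 0 j)).
Proof.
move=> Uu; have C := smooth_coord j oU sf 1%N.
apply: (has_grad_eq (C1_has_grad oU Uu C)); apply/rowP => a; rewrite !mxE.
by apply: pderiv_coord; apply: (sf 1%N a).1.
Qed.

Let comp_grad u : U u -> has_grad (h \o f) u (Ga u).
Proof.
move=> Uu; apply: (has_grad_eq (has_grad_comp (dh Uu) (fun j => coord_grad j Uu))).
by apply/rowP => b; rewrite !mxE; apply: eq_bigr => j _; rewrite mxE mulrC.
Qed.

Lemma level_crit : (forall u, U u -> h (f u) <= h (f u0)) ->
  forall a, lform (N (f u0)) (pderiv a f u0) = 0.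
Proof.
move=> hmax a; have := first_test oU Uu0 comp_grad hmax (delta_mx 0 a).
rewrite /lform (bigD1 a) //= big1 ?addr0 => [|i ia]; first by rewrite mxE !eqxx mul1r mxE.
by rewrite mxE eqxx (negPf ia) mul0r.
Qed.

Let comp_hess b : has_grad (fun u => Ga u 0 b) u0 (row b S).
Proof.
have -> : (fun u => Ga u 0 b) = (fun u => pderiv b f u 0 o0 * N (f u) 0 o0 +
    pderiv b f u 0 o1 * N (f u) 0 o1 + pderiv b f u 0 o2 * N (f u) 0 o2).
  by apply/funext => u; rewrite mxE /lform sum3.
have HN j := has_grad_comp (dN j) (fun i => coord_grad i Uu0).
have HP j : has_grad (fun u => pderiv b f u 0 j) u0 (\row_a pderiv a (pderiv b f) u0 0 j).
  have sb : smooth_on U (pderiv b f) by move=> k; exact: (sf k.+1 b).2.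
  have C := smooth_coord j oU sb 1%N.
  apply: (has_grad_eq (C1_has_grad oU Uu0 C)); apply/rowP => a; rewrite !mxE.
  by apply: pderiv_coord; apply: (sb 1%N a).1.
have H3 j := has_gradM (HP j) (HN j).
apply: (has_grad_eq (has_gradD (has_gradD (H3 o0) (H3 o1)) (H3 o2))).
apply/rowP => a; rewrite !mxE /quad /lform !sum3 !mxE /=.
move: (pderiv a (pderiv b f) u0) (pderiv a f u0) (pderiv b f u0) (N (f u0)) => x y z w.
ring.
Qed.

Let p := pderiv e0 f u0.
Let q := pderiv e1 f u0.
Let n := N (f u0).
Let T := lform q q * S e0 e0 - lform p q * (S e1 e0 + S e0 e1) + lform p p * S e1 e1.

Let gram_gt0 : 0 < gram p q.
Proof.
rewrite lt_def gram_ge0 andbT.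
exact: (tangent_rankP (fun a => pderiv a f u0)).1.
Qed.

Let SE b a : S b a = quad Hm (pderiv a f u0) (pderiv b f u0) +
  lform n (pderiv a (pderiv b f) u0).
Proof. by rewrite mxE. Qed.

Let curvature_balance nu lam : nu = lam *: n -> unit_normal g f u0 nu ->
  lform n p = 0 -> lform n q = 0 ->
  lform n n * (gram p q * mean_curvature g f u0 nu) =
  lam * (lform n n * T - gram p q * level_curv (Om (f u0)) G n Hm).
Proof.
move=> nuE un np nq; have o0' : Om (f u0) != 0 by apply: lt0r_neq0.
rewrite (mean_curvature_conformal om0 dOm (fun a => erefl (pderiv a f u0))
  (fun a b => erefl (pderiv a (pderiv b f) u0)) (lt0r_neq0 gram_gt0) un).
rewrite /T !SE.
exact: (@balance_algebra p q n G nu _ _ _ _ Hm lam _ o0' nuE np nq).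
Qed.

(** At a maximum the Hessian of [h] along the surface has nonpositive trace [T]. For zero mean
    curvature, [curvature_balance] makes [level_curv] a positive multiple of [T]. *)
Lemma level_max : (forall u, U u -> h (f u) <= h (f u0)) ->
  (forall nu, unit_normal g f u0 nu -> mean_curvature g f u0 nu = 0) ->
  level_curv (Om (f u0)) G n Hm <= 0.
Proof.
move=> hmax mc0.
have TT := second_test oU Uu0 comp_grad comp_hess hmax.
have G0 := level_crit hmax.
have nn0 := lform_gt0 n0; have o0' : Om (f u0) != 0 by apply: lt0r_neq0.
(* Scales the gradient to unit length in the metric [Om^2 g_E], so that the curvature hypothesis
   applies to it. *)
pose lam := (Om (f u0) * Num.sqrt (lform n n))^-1.
have s0 : 0 < Num.sqrt (lform n n) by rewrite sqrtr_gt0.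
have lam0 : 0 < lam by rewrite invr_gt0 mulr_gt0.
have un : unit_normal g f u0 (lam *: n).
  split=> [a|]; rewrite /g inner_scalar.
    by rewrite lformZl G0 !mulr0.
  rewrite lformZl lformC lformZl.
  have := sqr_sqrtr (ltW nn0); rewrite /lam.
  move: (lform n n) (Num.sqrt (lform n n)) s0 => x s s0 <-.
  by field; rewrite o0' gt_eqF.
have := curvature_balance erefl un (G0 e0) (G0 e1).
rewrite mc0 // !mulr0 => /esym/eqP; rewrite mulf_eq0 gt_eqF //= subr_eq0 => /eqP E.
rewrite -(pmulr_rle0 _ gram_gt0) -E pmulr_rle0 //.
have Q x y : S e0 e0 * x ^+ 2 + (S e0 e1 + S e1 e0) * x * y + S e1 e1 * y ^+ 2 <= 0.
  have [_] := TT (\row_i if i == e0 then x else y).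
  by rewrite quadratic2 [X in _ * X ^+ 2 + _ * X * _]mxE [X in _ * _ * X]mxE [X in _ + _ * X ^+ 2]mxE.
have e0p : 0 < lform p p.
  rewrite lt_def lform_sq andbT; apply: contraTneq gram_gt0 => /lform_eq0 ->.
  by rewrite /gram /lform !sum3 !mxE -leNgt; apply: eqle; ring.
exact: (neg_semidef_trace Q e0p (gram_ge0 p q)).
Qed.

(** If [h] is constant along the surface, its first and second derivatives there vanish. Any unit
    normal is a multiple of the gradient, both being orthogonal to the tangent plane, and
    [curvature_balance] then leaves only [level_curv]. *)
Lemma level_const c nu : (forall u, U u -> h (f u) = c) ->
  level_curv (Om (f u0)) G n Hm = 0 ->
  unit_normal g f u0 nu -> mean_curvature g f u0 nu = 0.
Proof.
move=> hc M0 un.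
have Ga0 u : U u -> Ga u = 0.
  by move=> Uu; apply: (has_grad_const oU Uu hc (comp_grad Uu)).
have S0 b a : S b a = 0.
  have r0 : row b S = 0.
    apply: (has_grad_const (c := 0) oU Uu0 _ (comp_hess b)) => y Uy.
    by rewrite Ga0 // mxE.
  exact: row_eq0.
have G0 a : lform n (pderiv a f u0) = 0.
  by have := congr1 (fun w : 'rV[R]_2 => w 0 a) (Ga0 u0 Uu0); rewrite !mxE.
have o0' : Om (f u0) != 0 by apply: lt0r_neq0.
have nT a : lform (pderiv a f u0) nu = 0.
  case: un => /(_ a); rewrite /g inner_scalar => /eqP.
  by rewrite mulf_eq0 expf_eq0 /= (negPf o0') /= lformC => /eqP.
have C1 := perp_cross (nT e0) (nT e1).
have C2 := perp_cross (etrans (lformC _ _) (G0 e0)) (etrans (lformC _ _) (G0 e1)).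
rewrite -/p -/q in C1 C2; set s := lform (cross p q) nu in C1; set t := lform (cross p q) n in C2.
have g0 := lt0r_neq0 gram_gt0.
have t0 : t != 0.
  apply: contra n0 => /eqP t0; apply/eqP/rowP => i; rewrite mxE.
  by apply: (mulfI g0); rewrite C2 t0 mul0r mulr0.
have nuE : nu = (s / t) *: n.
  apply/rowP => i; rewrite mxE; apply: (mulfI g0).
  by rewrite C1 mulrCA C2 mulrA divfK.
have := curvature_balance nuE un (G0 e0) (G0 e1).
have T0 : T = 0 by exact: zero_trace (S0 e0 e0) (S0 e0 e1) (S0 e1 e0) (S0 e1 e1).
rewrite T0.
rewrite M0 !mulr0 subr0 mulr0 => /eqP.
rewrite mulf_eq0 gt_eqF ?lform_gt0 //= mulf_eq0 (negPf g0) /= => /eqP //.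
Qed.

End LevelSets.

Lemma level_curvN (R : realType) (o : R) (G n : 'rV[R]_3) H :
  level_curv o G (- n) (- H) = - level_curv o G n H.
Proof.
rewrite /level_curv (lformC G) !lformNl (lformC _ (- n)) lformNl opprK (lformC n G).
have -> : quad (- H) (- n) (- n) = - quad H n n.
  by rewrite /quad /lform !sum3 !mxE; ring.
by rewrite linearN /=; ring.
Qed.

(** * Radial solutions of the minimal surface equation *)

Section Contraction.
Context {R : realType}.
Variable J : finType.
Local Notation state := (option J -> ser R).
Variables (delta nu : R).
Hypotheses (delta0 : 0 < delta) (delta1 : delta <= 1) (nu0 : 0 <= nu) (nud : nu <= delta ^+ 2).
Implicit Types (P Q : state -> ser R) (U V : state) (K L : R).

Definition in_ball U := forall i, nle 2 (U i) delta.

(* [cls n K P]: [P] has size [K delta^n] and Lipschitz constant [K delta^(n-1)] on the ball of radius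
   [delta], and if [n > 0] then [P 0] is bounded by [K nu]. *)
Definition cls n K P : Prop :=
  [/\ 0 <= K,
      forall U, in_ball U -> nle 2 (P U) (K * delta ^+ n),
      forall U V d, in_ball U -> in_ball V -> (forall i, nle 2 (U i - V i) d) ->
        nle 2 (P U - P V) (K * delta ^+ n.-1 * d)
    & (0 < n)%N -> nle 2 (P 0) (K * nu)].

Let two0 : 0 <= 2 :> R. Proof. by []. Qed.
Let two1 : 1 <= 2 :> R. Proof. by rewrite ler1n. Qed.
Let dn0 n : 0 <= delta ^+ n. Proof. by rewrite exprn_ge0 // ltW. Qed.
Let dn1 n : delta ^+ n <= 1. Proof. by rewrite exprn_ile1 // ltW. Qed.

Let ball0 : in_ball 0.
Proof. by move=> i; apply: (@nle_le _ _ _ 0); [exact: nle0 | exact: ltW]. Qed.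

Let d_ge0 U V d : (forall i, nle 2 (U i - V i) d) -> 0 <= d.
Proof. by move=> /(_ None)/nle_ge0. Qed.

Lemma cls_le n n' K K' P : cls n K P -> (n' <= n)%N -> K <= K' -> cls n' K' P.
Proof.
move=> [K0 B L Z] nn KK; have K0' := le_trans K0 KK.
split => // [U bU|U V d bU bV Ud|n0].
- apply: (nle_le (B U bU)); apply: ler_pM => //.
  by apply: ler_wiXn2l => //; exact: ltW.
- apply: (nle_le (L U V d bU bV Ud)); rewrite ler_wpM2r ?(d_ge0 Ud) //.
  apply: ler_pM => //; apply: ler_wiXn2l => //; first exact: ltW.
  by case: (n) (n') nn => [|m] [|m'].
- by apply: (nle_le (Z (leq_trans n0 nn))); rewrite ler_wpM2r.
Qed.

Lemma cls_proj i : cls 1 1 (fun U => U i).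
Proof.
split => // [U bU|U V d bU bV Ud|_]; rewrite ?expr1 ?expr0 ?mul1r //.
by apply: (@nle_le _ _ _ 0) => //; exact: nle0.
Qed.

Lemma cls_op (op : ser R -> ser R) :
  (forall f M, nle 2 f M -> nle 2 (op f) M) ->
  (forall f g M, nle 2 (f - g) M -> nle 2 (op f - op g) M) ->
  cls 1 1 (fun U => op (U None)).
Proof.
move=> B L; split => // [U bU|U V d bU bV Ud|_]; rewrite ?expr1 ?expr0 ?mul1r.
- by apply: B.
- by apply: L.
- by apply: B; apply: (@nle_le _ _ _ 0) => //; exact: nle0.
Qed.

Lemma cls_fix f K : nle 2 f K -> cls 0 K (fun=> f).
Proof.
move=> fK; split; [exact: nle_ge0 fK|by rewrite expr0 mulr1| |by []].
move=> U V d bU bV Ud; rewrite subrr; apply: (@nle_le _ _ _ 0); first exact: nle0.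
by rewrite !mulr_ge0 ?(nle_ge0 fK) ?(d_ge0 Ud).
Qed.

Lemma cls_cst a K : `|a| <= K -> cls 0 K (fun=> cst_ser a).
Proof. by move=> aK; apply: cls_fix; apply: nle_le aK; apply: nle_cst. Qed.

Lemma cls_lin (d : 'rV[R]_3) : enorm d <= 1 -> cls 0 2 (fun=> lin_ser d).
Proof.
by move=> d1; apply: cls_fix; apply: (nle_le (nle_lin d two0)); rewrite ler_piMr.
Qed.

Lemma cls_add n K L P Q : cls n K P -> cls n L Q -> cls n (K + L) (fun U => P U + Q U).
Proof.
move=> [K0 B1 L1 Z1] [L0 B2 L2 Z2]; split; first exact: addr_ge0.
- by move=> U bU; rewrite mulrDl; apply: nleD => //; [apply: B1|apply: B2].
- move=> U V d bU bV Ud; rewrite opprD addrACA !mulrDl.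
  by apply: nleD => //; [apply: L1|apply: L2].
- by move=> n0; rewrite mulrDl; apply: nleD => //; [apply: Z1|apply: Z2].
Qed.

Lemma cls_opp n K P : cls n K P -> cls n K (fun U => - P U).
Proof.
move=> [K0 B1 L1 Z1]; split => // [U bU|U V d bU bV Ud|n0].
- by apply: nleN; apply: B1.
- by rewrite -opprD; apply: nleN; apply: L1.
- by apply: nleN; apply: Z1.
Qed.

Lemma cls_mul n m K L P Q : cls n K P -> cls m L Q ->
  cls (n + m) (2 * (K * L)) (fun U => mul (P U) (Q U)).
Proof.
move=> [K0 B1 L1 Z1] [L0 B2 L2 Z2].
have KL0 : 0 <= K * L by rewrite mulr_ge0.
split; first by rewrite mulr_ge0.
- move=> U bU; apply: (nle_le (nle_mul two0 (B1 U bU) (B2 U bU))).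
  rewrite exprD mulrACA ler_wpM2r ?mulr_ge0 // ler_peMl //.
- move=> U V d bU bV Ud; have d0 := d_ge0 Ud.
  have -> : mul (P U) (Q U) - mul (P V) (Q V) =
      mul (P U - P V) (Q U) + mul (P V) (Q U - Q V).
    by rewrite ser_mulDl ser_mulDr ser_mulNl ser_mulNr addrA subrK.
  have := nleD two1 (nle_mul two0 (L1 U V d bU bV Ud) (B2 U bU))
                    (nle_mul two0 (B1 V bV) (L2 U V d bU bV Ud)).
  move/nle_le; apply.
  have half e1 e2 : ((n + m).-1 <= e1 + e2)%N ->
      K * L * ((delta ^+ e1 * delta ^+ e2) * d) <= K * L * (delta ^+ (n + m).-1 * d).
    move=> le_e; rewrite ler_wpM2l // ler_wpM2r // -exprD.
    by apply: ler_wiXn2l => //; exact: ltW.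
  apply: (@le_trans _ _ (K * L * ((delta ^+ n.-1 * delta ^+ m) * d) +
                         K * L * ((delta ^+ n * delta ^+ m.-1) * d))).
    by apply: eqle; ring.
  apply: (@le_trans _ _ (K * L * (delta ^+ (n + m).-1 * d) + K * L * (delta ^+ (n + m).-1 * d))).
    by apply: lerD; apply: half; case: (n) (m) => [|?] [|?]; rewrite /= ?addn0 // addnS.
  by apply: eqle; ring.
- case: n B1 L1 Z1 => [|n] B1 L1 Z1 n0.
    apply: (nle_le (nle_mul two0 (B1 0 ball0) (Z2 n0))).
    by rewrite expr0 mulr1 mulrA ler_wpM2r // ler_peMl.
  apply: (nle_le (nle_mul two0 (Z1 isT) (B2 0 ball0))).
  apply: (@le_trans _ _ (K * nu * (L * 1))).
    by rewrite ler_wpM2l ?mulr_ge0 // ler_wpM2l.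
  by rewrite mulr1 mulrAC ler_wpM2r // ler_peMl.
Qed.

Lemma cls_sc n K P a : cls n K P -> cls n (`|a| * K) (fun U => sc a (P U)).
Proof.
move=> [K0 B1 L1 Z1]; split; first by rewrite mulr_ge0.
- by move=> U bU; rewrite -mulrA; apply: nleZ => //; apply: B1.
- move=> U V d bU bV Ud; have -> : sc a (P U) - sc a (P V) = sc a (P U - P V).
    by apply/funext => s; rewrite /sc !(addrfctE, opprfctE) mulrBr.
  by rewrite -!mulrA; apply: nleZ => //; rewrite mulrA; apply: L1.
- by move=> n0; rewrite -mulrA; apply: nleZ => //; apply: Z1.
Qed.

Lemma sc_sub a f g : sc a f - sc a g = sc a (f - g) :> ser R.
Proof. by apply/funext => s; rewrite /sc !(addrfctE, opprfctE) mulrBr. Qed.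

(** The reason for the unknown [(g j - 1) / delta]: in the equation for [F] the differences
    [g j - 1] appear linearly, and this factor lifts them from first to second order. *)
Lemma cls_sc_delta n K P : cls n.+1 K P -> cls n.+2 K (fun U => sc delta (P U)).
Proof.
move=> [K0 B1 L1 Z1]; have d1 := ltW delta0.
split => // [U bU|U V d bU bV Ud|_].
- apply: (nle_le (nleZ delta (B1 U bU))).
  by rewrite ger0_norm // [delta ^+ n.+2]exprS mulrCA.
- rewrite sc_sub; apply: (nle_le (nleZ delta (L1 U V d bU bV Ud))).
  by rewrite ger0_norm //= exprS !mulrA (mulrC delta).
- apply: (nle_le (nleZ delta (Z1 isT))); rewrite ger0_norm //.
  by rewrite ler_piMl ?mulr_ge0.
Qed.

(** A coefficient of size [nu <= delta ^+ 2] is worth two orders. This is how the terms with the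
    small parameters [eps j] are counted. *)
Lemma cls_pert K P a : cls 0 K P -> `|a| <= nu -> cls 2 K (fun U => sc a (P U)).
Proof.
move=> [K0 B1 L1 Z1] anu; have ad := le_trans anu nud.
split => // [U bU|U V d bU bV Ud|_].
- apply: (nle_le (nleZ a (B1 U bU))).
  by rewrite expr0 mulr1 mulrC ler_wpM2l.
- rewrite sc_sub; apply: (nle_le (nleZ a (L1 U V d bU bV Ud))).
  rewrite expr0 mulr1 mulrA ler_wpM2r ?(d_ge0 Ud) // mulrC ler_wpM2l // expr1.
  by apply: (le_trans ad); rewrite expr2 ler_piMl // ltW.
- apply: (nle_le (nleZ a (B1 0 ball0))).
  by rewrite expr0 mulr1 mulrC ler_wpM2l.
Qed.

Lemma cls_wsum n K (w : J -> R) (P : J -> state -> ser R) : 0 <= K ->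
  (forall j, 0 <= w j) -> \sum_j w j <= 1 -> (forall j, cls n K (P j)) ->
  cls n K (fun U => \sum_j sc (w j) (P j U)).
Proof.
move=> K0 w0 w1 HP.
have H (M : R) (F : J -> ser R) : 0 <= M -> (forall j, nle 2 (F j) M) ->
    nle 2 (\sum_j sc (w j) (F j)) M.
  move=> M0 FM; have := @nle_sum _ 2 two1 J (index_enum J) xpredT (fun j => sc (w j) (F j))
    (fun j => `|w j| * M) (fun j _ => nleZ (w j) (FM j)).
  move/nle_le; apply; rewrite -mulr_suml ler_piMl //.
  by rewrite (eq_bigr w) // => j _; rewrite ger0_norm.
split => // [U bU|U V d bU bV Ud|n0].
- by apply: H => [|j]; [rewrite mulr_ge0 | case: (HP j) => _ + _ _; apply].
- have -> : \sum_j sc (w j) (P j U) - \sum_j sc (w j) (P j V) =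
      \sum_j sc (w j) (P j U - P j V).
    by rewrite -sumrB; apply: eq_bigr => j _; rewrite sc_sub.
  apply: H => [|j]; first by rewrite !mulr_ge0 // (d_ge0 Ud).
  by case: (HP j) => _ _ + _; apply.
- by apply: H => [|j]; [rewrite mulr_ge0 | case: (HP j) => _ _ _; apply].
Qed.

(** Second order means Lipschitz constant [K delta <= 1 / 4] on the ball. The bound at [0] gives a
    fixed point of size proportional to [nu], much better than [delta]; the location of the surface
    rests on this. *)
Lemma cls_contraction K (P : state -> state) : 4 * (K * delta) <= 1 ->
  (forall i, cls 2 K (fun U => P U i)) ->
  exists U, (forall i, nle 2 (U i) (2 * (K * nu))) /\ in_ball U /\ P U = U.
Proof.
move=> Kd HP; have K0 : 0 <= K by case: (HP None).
have Kn : 2 * (K * nu) <= delta.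
  apply: (@le_trans _ _ (2 * (K * delta ^+ 2))); first by rewrite !ler_wpM2l.
  by rewrite expr2 !mulrA ler_piMl ?(ltW delta0) //; rewrite -mulrA; lra.
have Kn0 : 0 <= K * nu by rewrite mulr_ge0.
have P0 i : nle 2 (P 0 i) (K * nu) by case: (HP i) => _ _ _; apply.
have Plip U V d : in_ball U -> in_ball V -> (forall i, nle 2 (U i - V i) d) ->
    forall i, nle 2 (P U i - P V i) (d / 2).
  move=> bU bV Ud i; case: (HP i) => _ _ /(_ U V d bU bV Ud) + _; move/nle_le; apply.
  by rewrite expr1 mulrC ler_wpM2l ?(d_ge0 Ud) //; lra.
have [U [UB UE]] := banach_ser two1 Kn0 Kn P0 Plip.
by exists U; split => //; split => // i; exact: (nle_le (UB i)).
Qed.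

End Contraction.

(** * Evaluation as a ring homomorphism *)

Section EvaluationRelation.
Context {R : realType}.
Variable x : 'rV[R]_3.
Hypothesis x2 : enorm x <= 2.

(** The value is kept together with a bound because [ev] respects sums and products only of
    convergent series. *)
Definition evals (f : ser R) (r : R) : Prop := (exists M, nle 2 f M) /\ ev f x = r.

Let two0 : 0 <= 2 :> R. Proof. by []. Qed.
Let two1 : 1 <= 2 :> R. Proof. by rewrite ler1n. Qed.

Lemma evals_add f g r s : evals f r -> evals g s -> evals (f + g) (r + s).
Proof.
move=> [[M fM] <-] [[N gN] <-]; split; first by exists (M + N); apply: nleD.
exact: evD fM gN x2.
Qed.

Lemma evals_mul f g r s : evals f r -> evals g s -> evals (mul f g) (r * s).
Proof.
move=> [[M fM] <-] [[N gN] <-]; split; first by exists (M * N); apply: nle_mul.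
exact: evM fM gN x2.
Qed.

Lemma evals_sc a f r : evals f r -> evals (sc a f) (a * r).
Proof.
move=> [[M fM] <-]; split; first by exists (`|a| * M); apply: nleZ.
exact: evZ fM x2.
Qed.

Lemma evals_opp f r : evals f r -> evals (- f) (- r).
Proof. by move=> /(evals_sc (-1)); rewrite scN1 mulN1r. Qed.

Lemma evals_cst a : evals (cst_ser a) a.
Proof. by split; [exists `|a|; exact: nle_cst | exact: ev_cst]. Qed.

Lemma evals_lin d : evals (lin_ser d) (\sum_(i < 3) x 0 i * d 0 i).
Proof. by split; [exists (2 * enorm d); exact: nle_lin | exact: ev_lin]. Qed.

Lemma evals_sum (I : Type) (s : seq I) (P : pred I) (F : I -> ser R) (r : I -> R) :
  (forall i, evals (F i) (r i)) -> evals (\sum_(i <- s | P i) F i) (\sum_(i <- s | P i) r i).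
Proof.
move=> H; elim/big_rec2: _ => [|i u v _ uv]; last exact: evals_add.
have := evals_cst 0; congr (evals _ _).
by apply/funext => -[|? ?].
Qed.

Lemma evals_bdd f M : nle 2 f M -> evals f (ev f x).
Proof. by move=> fM; split => //; exists M. Qed.

End EvaluationRelation.

(** * The fixed point map for the minimal surface system *)

Section MinimalSurfaceMap.
Context {R : realType}.
Variable J : finType.
Local Notation state := (option J -> ser R).
Variables (delta c kap1 kap2 : R) (eps : J -> R) (d : J -> 'rV[R]_3) (wa wb : J -> R).
Variable T : ser R -> ser R.
Implicit Types (U : state) (a b : 'I_3) (j : J) (w : J -> R).

(* [lin_ser (dcr a d)] is the linear form x |-> d . (e_a * x). *)
Definition dcr a (e : 'rV[R]_3) : 'rV[R]_3 := \row_i \sum_(j < 3) lc a i j * e 0 j.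

(* The unknown [U] consists of [F = U None], which determines the radius function [k = 1 + v] through
   [v = T F], i.e. [(cas - c) v = c F], and of [(g j - 1) / delta = U (Some j)]. *)
Definition tv U := T (U None).
Definition tV a U := rot a (tv U).
(** The powers of [c] are those of [energy1] and [energy2], so [tS] and [tB] are bounded by [F] with
    constant 1 however small [c] is. *)
Definition tS a U := sc (Num.sqrt c)^-1 (rot a (tv U)).
Definition tB a b U := sc c^-1 (rot a (rot b (tv U))).
Definition th j U := sc delta (U (Some j)).
Definition tg j U := cst_ser 1 + th j U.
Definition tk U := cst_ser 1 + tv U.
Definition tkm U := tv U + tv U + mul (tv U) (tv U).
Definition tQ U := \sum_(a < 3) mul (tS a U) (tS a U).
Definition tH U := \sum_(a < 3) \sum_(b < 3) mul (tS a U) (mul (tS b U) (tB a b U)).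
Definition ta2 U := tkm U + sc c (tQ U).
Definition tA2 U := cst_ser 1 + ta2 U.
Definition tR j U := mul (tg j U) (mul (tg j U) (mul (tg j U)
  (mul (tk U) (lin_ser (d j)) + \sum_(a < 3) mul (lin_ser (dcr a (d j))) (tV a U)
   + - cst_ser (eps j)))).
Definition tchim w U := \sum_j sc (w j) (th j U).
Definition tchi w U := cst_ser 1 + tchim w U.
Definition tY kap w U := \sum_j sc (w j) (sc (kap * eps j) (tR j U)).
Definition tpert U := mul (tk U) (tY kap1 wb U + tY kap2 wa U) +
  mul (tchi wb U) (tY 1 wa U) + mul (tchi wa U) (tY 1 wb U).
Definition tX2 U := tchim wa U + tchim wb U + mul (tchim wa U) (tchim wb U).
Definition tX U := tX2 U + - tkm U.
Definition tZr U := sc 2^-1 (tX2 U + - mul (tv U) (tv U)) + sc 2^-1 (mul (tkm U) (tX U)) +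
  sc 2^-1 (tpert U).
Definition tZ U := tZr U + - tv U.
Definition tkw w U := tv U + tchim w U + mul (tv U) (tchim w U).
Definition tPsm U := sc (2 + kap1 + kap2)^-1
  (tkm U + sc kap1 (tkw wb U) + sc kap2 (tkw wa U) + tX2 U).
Definition ta1 U := tv U + tPsm U + mul (tv U) (tPsm U).
Definition tA1 U := cst_ser 1 + ta1 U.
Definition tFv U := U None + tv U.
(** A quarter of the graph equation reads [A1 (A2 (F + v) - k Q - c H) + A2 (Zr - v) = 0], with [Q]
    and [H] in their rescaled forms. By the choice of [c] the two linear terms in [v] cancel, [F]
    remains, and [tE0] is minus everything else. *)
Definition tE0 U := - mul (ta2 U) (tFv U) + - mul (ta1 U) (mul (tA2 U) (tFv U)) +
  mul (tA1 U) (mul (tk U) (tQ U) + sc c (tH U)) + - tZr U + - mul (ta2 U) (tZ U).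
(** The relation [g^2 (k^2 - 2 k eps D + eps^2) = k^2], with [D] the product of [d j] and [x], after
    inserting [g = 1 + delta h], dividing by [2 delta] and isolating [h]. *)
Definition tEj j U :=
  sc 2^-1 (mul (sc (eps j / delta) (sc 2 (mul (tk U) (lin_ser (d j))) + - cst_ser (eps j)))
             (mul (tg j U) (tg j U))) +
  - sc (delta / 2) (mul (tk U) (mul (tk U) (mul (U (Some j)) (U (Some j))))) +
  - mul (U (Some j)) (tkm U).

Definition ms_map U : state := fun i => if i is Some j then tEj j U else tE0 U.

Section Bounds.
Variable nu : R.
Hypotheses (delta0 : 0 < delta) (delta1 : delta <= 1) (nu0 : 0 <= nu) (nud : nu <= delta ^+ 2).
Hypotheses (c0 : 0 < c) (c1 : c <= 1) (kap10 : 0 <= kap1) (kap20 : 0 <= kap2).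
Hypothesis Tsolve : forall f s, cas (T f) s - c * T f s = c * f s.
Hypotheses (eps0 : forall j, 0 <= eps j) (eps_nu : forall j, eps j / delta <= nu)
  (eps_nu1 : forall j, kap1 * eps j <= nu) (eps_nu2 : forall j, kap2 * eps j <= nu).
Hypothesis d1 : forall j, enorm (d j) <= 1.
Hypotheses (wa0 : forall j, 0 <= wa j) (wa1 : \sum_j wa j <= 1)
  (wb0 : forall j, 0 <= wb j) (wb1 : \sum_j wb j <= 1).
Local Notation cls := (@cls R J delta nu).

(** [T] is a choice of solutions. The difference of two of them solves the equation for the
    difference of the data, so the energy estimates also give Lipschitz bounds. *)
Let Tsub (f g : ser R) s : cas (T f - T g) s - c * (T f - T g) s = c * (f - g) s.
Proof.
have Hf := Tsolve f s; have Hg := Tsolve g s.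
rewrite casB !(addrfctE, opprfctE) mulrBr.
rewrite mulrBr -Hf -Hg; ring.
Qed.

Let nle_one (f g : ser R) (M : R) : (forall k, nrm k g <= nrm k f) -> nle 2 f M -> nle 2 g M.
Proof.
move=> H fM; rewrite -[M]mul1r; apply: (@nle_nrm _ _ f) => // k.
by rewrite mul1r.
Qed.

Let op_cls (op : ser R -> ser R) :
  (forall f g, op f - op g = op (f - g)) ->
  (forall k f g, (forall s, size s = k -> cas g s - c * g s = c * f s) ->
     nrm k (op g) <= nrm k f) ->
  cls 1 1 (fun U => op (tv U)).
Proof.
move=> opB H; apply: (@cls_op R J delta nu nu0 (fun f => op (T f))) => [f M|f g M].
  by apply: nle_one => k; apply: H => s _; apply: Tsolve.
by rewrite opB; apply: nle_one => k; apply: H => s _; apply: Tsub.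
Qed.

Let sqrtc0 : 0 < Num.sqrt c. Proof. by rewrite sqrtr_gt0. Qed.

Lemma tv_cls : cls 1 1 tv.
Proof. by apply: (op_cls (op := id)) => // k f g H; apply: (energy0 c0). Qed.

Lemma tV_cls a : cls 1 1 (tV a).
Proof.
apply: (op_cls (op := rot a)) => [f g|k f g H]; first by rewrite rotB.
apply: (le_trans (energy1 c0 H a)); rewrite ler_piMl ?nrm_ge0 //.
by rewrite -sqrtr1 ler_wsqrtr.
Qed.

Lemma tS_cls a : cls 1 1 (tS a).
Proof.
apply: (op_cls (op := fun f => sc (Num.sqrt c)^-1 (rot a f))) => [f g|k f g H].
  by rewrite rotB sc_sub.
by rewrite nrmZ gtr0_norm ?invr_gt0 // ler_pdivrMl // (energy1 c0 H).
Qed.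

Lemma tB_cls a b : cls 1 1 (tB a b).
Proof.
apply: (op_cls (op := fun f => sc c^-1 (rot a (rot b f)))) => [f g|k f g H].
  by rewrite !rotB sc_sub.
by rewrite nrmZ gtr0_norm ?invr_gt0 // ler_pdivrMl // (energy2 c0 H).
Qed.

Let cle := @cls_le R J delta nu delta0 delta1 nu0.
Let cadd := @cls_add R J delta nu.
Let copp := @cls_opp R J delta nu.
Let cmul := @cls_mul R J delta nu delta0 delta1 nu0.

Let cst1 : cls 0 1 (fun=> cst_ser 1).
Proof. by apply: cls_cst => //; rewrite normr1. Qed.

Let csum3 n K (P : 'I_3 -> state -> ser R) : (forall a, cls n K (P a)) ->
  cls n (3 * K) (fun U => \sum_(a < 3) P a U).
Proof.
move=> H; have := cadd (cadd (H o0) (H o1)) (H o2).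
rewrite (_ : K + K + K = 3 * K); last by ring.
by congr (cls n _ _); apply/funext => U; rewrite sum3.
Qed.

Lemma tk_cls : cls 0 2 tk.
Proof. by apply: (cle (cadd cst1 (cle tv_cls _ (lexx _)))) => //; lra. Qed.

Lemma tkm_cls : cls 1 4 tkm.
Proof.
apply: (cle (cadd (cadd tv_cls tv_cls) (cle (cmul tv_cls tv_cls) _ (lexx _)))) => //; lra.
Qed.

Lemma th_cls j : cls 2 1 (th j).
Proof. apply: cls_sc_delta => //; exact: cls_proj. Qed.

Lemma tg_cls j : cls 0 2 (tg j).
Proof. by apply: (cle (cadd cst1 (cle (th_cls j) _ (lexx _)))) => //; lra. Qed.

Lemma tQ_cls : cls 2 6 tQ.
Proof.
apply: (cle (csum3 (fun a => cmul (tS_cls a) (tS_cls a)))) => //; lra.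
Qed.

Lemma tH_cls : cls 2 36 tH.
Proof.
apply: (cle (csum3 (fun a => csum3 (fun b => cmul (tS_cls a) (cmul (tS_cls b) (tB_cls a b)))))) => //; lra.
Qed.

Let csc n K P : cls n K P -> cls n K (fun U => sc c (P U)).
Proof.
move=> H; apply: (cle (cls_sc c H)) => //; case: H => K0 _ _ _.
by rewrite gtr0_norm // ler_piMl.
Qed.

Lemma ta2_cls : cls 1 10 ta2.
Proof.
apply: (cle (cadd tkm_cls (cle (csc tQ_cls) _ (lexx _)))) => //; lra.
Qed.

Lemma tA2_cls : cls 0 11 tA2.
Proof. by apply: (cle (cadd cst1 (cle ta2_cls _ (lexx _)))) => //; lra. Qed.

Let dcr1 a j : enorm (dcr a (d j)) <= 1.
Proof.
apply: le_trans (d1 j); rewrite -(@ler_pXn2r _ 2) ?nnegrE ?enorm_ge0 // !enorm_sq !sum3 !mxE !sum3.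
have := (sqr_ge0 (d j 0 o0), sqr_ge0 (d j 0 o1), sqr_ge0 (d j 0 o2)) => -[[h0 h1] h2].
by move: a; elim/ord3E; rewrite /lc /=; nra.
Qed.

Let eps1 j : eps j <= nu.
Proof.
apply: le_trans (eps_nu j); rewrite ler_pdivlMr // ler_piMr //.
Qed.

Let nu1 : nu <= 1.
Proof. by apply: (le_trans nud); rewrite exprn_ile1 // ltW. Qed.

Lemma tR_cls j : cls 0 (10 ^+ 4) (tR j).
Proof.
have cd := cls_lin J nu delta0 (d1 j).
have cda a := cls_lin J nu delta0 (dcr1 a j).
have ce : cls 0 1 (fun=> cst_ser (eps j)).
  by apply: cls_cst => //; rewrite ger0_norm //; apply: le_trans (eps1 j) nu1.
have inner := cadd (cadd (cmul tk_cls cd)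
  (cle (csum3 (fun a => cmul (cda a) (tV_cls a))) (leq0n _) (lexx _))) (copp ce).
apply: (cle (cmul (tg_cls j) (cmul (tg_cls j) (cmul (tg_cls j) inner)))) => //; lra.
Qed.

Lemma tchim_cls w : (forall j, 0 <= w j) -> \sum_j w j <= 1 -> cls 2 1 (tchim w).
Proof. by move=> w0 w1; apply: cls_wsum => // j; exact: th_cls. Qed.

Lemma tchi_cls w : (forall j, 0 <= w j) -> \sum_j w j <= 1 -> cls 0 2 (tchi w).
Proof.
by move=> w0 w1; apply: (cle (cadd cst1 (cle (tchim_cls w0 w1) (leq0n _) (lexx _)))) => //; lra.
Qed.

Lemma tY_cls kap w : (forall j, 0 <= w j) -> \sum_j w j <= 1 -> 0 <= kap ->
  (forall j, kap * eps j <= nu) -> cls 2 (10 ^+ 4) (tY kap w).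
Proof.
move=> w0 w1 k0 ke; apply: cls_wsum => // j.
apply: cls_pert; rewrite ?ger0_norm ?mulr_ge0 //; exact: tR_cls.
Qed.

Lemma tpert_cls : cls 2 (10 ^+ 6) tpert.
Proof.
have e1 j : 1 * eps j <= nu by rewrite mul1r.
have ya := tY_cls wa0 wa1 ler01 e1; have yb := tY_cls wb0 wb1 ler01 e1.
have y1 := tY_cls wb0 wb1 kap10 eps_nu1; have y2 := tY_cls wa0 wa1 kap20 eps_nu2.
apply: (cle (cadd (cadd (cmul tk_cls (cadd y1 y2)) (cmul (tchi_cls wb0 wb1) ya))
  (cmul (tchi_cls wa0 wa1) yb))) => //; lra.
Qed.

Lemma tX2_cls : cls 2 4 tX2.
Proof.
have ca := tchim_cls wa0 wa1; have cb := tchim_cls wb0 wb1.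
apply: (cle (cadd (cadd ca cb) (cle (cmul ca cb) _ (lexx _)))) => //; lra.
Qed.

Lemma tX_cls : cls 1 8 tX.
Proof.
apply: (cle (cadd (cle tX2_cls _ (lexx _)) (copp tkm_cls))) => //; lra.
Qed.

Let half : `|2^-1 : R| = 2^-1. Proof. by rewrite ger0_norm. Qed.

Lemma tZr_cls : cls 2 (10 ^+ 6) tZr.
Proof.
apply: (cle (cadd (cadd (cls_sc 2^-1 (cadd tX2_cls (copp (cmul tv_cls tv_cls))))
  (cls_sc 2^-1 (cmul tkm_cls tX_cls))) (cls_sc 2^-1 tpert_cls))) => //.
by rewrite half; lra.
Qed.

Lemma tZ_cls : cls 1 (10 ^+ 7) tZ.
Proof.
apply: (cle (cadd (cle tZr_cls _ (lexx _)) (copp tv_cls))) => //; lra.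
Qed.

Lemma tkw_cls w : (forall j, 0 <= w j) -> \sum_j w j <= 1 -> cls 1 4 (tkw w).
Proof.
move=> w0 w1; have cw := tchim_cls w0 w1.
apply: (cle (cadd (cadd tv_cls (cle cw _ (lexx _)))
  (cle (cmul tv_cls cw) _ (lexx _)))) => //; lra.
Qed.

Lemma tPsm_cls : cls 1 4 tPsm.
Proof.
have s0 : 0 < 2 + kap1 + kap2 by rewrite -addrA ltr_pwDl ?addr_ge0.
apply: (cle (cls_sc (2 + kap1 + kap2)^-1 (cadd (cadd (cadd tkm_cls
  (cls_sc kap1 (tkw_cls wb0 wb1))) (cls_sc kap2 (tkw_cls wa0 wa1)))
  (cle tX2_cls (isT : 1 <= 2)%N (lexx _))))) => //.
rewrite gtr0_norm ?invr_gt0 // (ger0_norm kap10) (ger0_norm kap20) ler_pdivrMl //; lra.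
Qed.

Lemma ta1_cls : cls 1 13 ta1.
Proof.
apply: (cle (cadd (cadd tv_cls tPsm_cls) (cle (cmul tv_cls tPsm_cls) _ (lexx _)))) => //; lra.
Qed.

Lemma tA1_cls : cls 0 14 tA1.
Proof. by apply: (cle (cadd cst1 (cle ta1_cls _ (lexx _)))) => //; lra. Qed.

Lemma tFv_cls : cls 1 2 tFv.
Proof.
by apply: (cle (cadd (cls_proj delta nu0 None) tv_cls)) => //; lra.
Qed.

Lemma tE0_cls : cls 2 (10 ^+ 9) tE0.
Proof.
apply: (cle (cadd (cadd (cadd (cadd (copp (cmul ta2_cls tFv_cls))
  (copp (cle (cmul ta1_cls (cmul tA2_cls tFv_cls)) (isT : 2 <= 2)%N (lexx _))))
  (cmul tA1_cls (cadd (cmul tk_cls tQ_cls) (csc tH_cls)))) (copp tZr_cls))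
  (copp (cmul ta2_cls tZ_cls)))) => //; lra.
Qed.

Lemma tEj_cls j : cls 2 (10 ^+ 9) (tEj j).
Proof.
have cd := cls_lin J nu delta0 (d1 j).
have ce : cls 0 1 (fun=> cst_ser (eps j)).
  by apply: cls_cst => //; rewrite ger0_norm //; apply: le_trans (eps1 j) nu1.
have z := cls_pert delta0 delta1 nud (cadd (cls_sc 2 (cmul tk_cls cd)) (copp ce))
  (a := eps j / delta) ltac:(by rewrite ger0_norm // divr_ge0 // ltW).
have ch := cls_proj delta nu0 (Some j).
apply: (cle (cadd (cadd (cls_sc 2^-1 (cmul z (cmul (tg_cls j) (tg_cls j))))
  (copp (cls_sc (delta / 2) (cmul tk_cls (cmul tk_cls (cmul ch ch))))))
  (copp (cmul ch tkm_cls)))) => //.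
have -> : `|delta / 2| = delta / 2 by rewrite ger0_norm // divr_ge0 // ltW.
rewrite half normr_nat; have := delta1; lra.
Qed.

Lemma ms_map_cls i : cls 2 (10 ^+ 9) (fun U => ms_map U i).
Proof. by case: i => [j|]; [exact: tEj_cls | exact: tE0_cls]. Qed.

End Bounds.
End MinimalSurfaceMap.

(** * Solution of the graph equation *)

Section GraphEquation.
Context {R : realType}.

(* The minimal surface equation for the radial graph r = r1 / k, after multiplication by a positive
   factor; [k], [ka], [kab] stand for the values of the function and its rotational derivatives. *)
Definition graph_eqn (J : finType) (kap1 kap2 : R) (eps : J -> R) (d : J -> 'rV[R]_3)
    (wa wb : J -> R) (x : 'rV[R]_3) (k : R) (ka : 'I_3 -> R) (kab : 'I_3 -> 'I_3 -> R)
    (g : J -> R) : Prop :=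
  let Q := \sum_(a < 3) ka a * ka a in
  let H := \sum_(a < 3) \sum_(b < 3) ka a * ka b * kab a b in
  let L := \sum_(a < 3) kab a a in
  let chi := 1 + \sum_j wa j * (g j - 1) in
  let psi := 1 + \sum_j wb j * (g j - 1) in
  let r j := g j * (g j * (g j * (k * lform (d j) x +
               \sum_(a < 3) lform (dcr a (d j)) x * ka a - eps j))) in
  let Y kap w := \sum_j w j * (kap * eps j * r j) in
  k * (k ^+ 2 + k * (kap1 * psi + kap2 * chi) + chi * psi) *
    ((k ^+ 2 + Q) * L - k * Q - H) +
  2 * (k ^+ 2 + Q) * (k ^+ 2 * (chi * psi - k ^+ 2) + k * (Y kap1 wb + Y kap2 wa) +
    psi * Y 1 wa + chi * Y 1 wb) = 0.

Lemma graph_eqn_algebra (c s kap1 kap2 v F chim psim Y1 Y2 Ya Yb : R)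
    (ka : 'I_3 -> R) (kab : 'I_3 -> 'I_3 -> R) :
  0 < c -> 0 < s -> s * s = c -> c * (2 + kap1 + kap2) = 4 ->
  \sum_(a < 3) kab a a = c * F + c * v ->
  let k := 1 + v in
  let S a := s^-1 * ka a in
  let B a b := c^-1 * kab a b in
  let Qv := \sum_(a < 3) S a * S a in
  let Hv := \sum_(a < 3) \sum_(b < 3) S a * (S b * B a b) in
  let km := v + v + v * v in
  let a2 := km + c * Qv in
  let X2 := chim + psim + chim * psim in
  let pert := k * (Y1 + Y2) + (1 + psim) * Ya + (1 + chim) * Yb in
  let Zr := 2^-1 * (X2 - v * v) + 2^-1 * (km * (X2 - km)) + 2^-1 * pert in
  let Psm := (2 + kap1 + kap2)^-1 * (km + kap1 * (v + psim + v * psim) +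
                                     kap2 * (v + chim + v * chim) + X2) in
  let a1 := v + Psm + v * Psm in
  F = - (a2 * (F + v)) - a1 * ((1 + a2) * (F + v)) + (1 + a1) * (k * Qv + c * Hv) - Zr -
      a2 * (Zr - v) ->
  let Q := \sum_(a < 3) ka a * ka a in
  let H := \sum_(a < 3) \sum_(b < 3) ka a * ka b * kab a b in
  let L := \sum_(a < 3) kab a a in
  k * (k ^+ 2 + k * (kap1 * (1 + psim) + kap2 * (1 + chim)) + (1 + chim) * (1 + psim)) *
    ((k ^+ 2 + Q) * L - k * Q - H) +
  2 * (k ^+ 2 + Q) * (k ^+ 2 * ((1 + chim) * (1 + psim) - k ^+ 2) + k * (Y1 + Y2) +
    (1 + psim) * Ya + (1 + chim) * Yb) = 0.
Proof.
move=> c0 s0 sc cE LE k S B Qv Hv km a2 X2 pert Zr Psm a1 EF Q H L.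
have cn : c != 0 by apply: lt0r_neq0.
have sn : s != 0 by apply: lt0r_neq0.
have QE : c * Qv = Q.
  by rewrite /Qv /Q /S mulr_sumr; apply: eq_bigr => a _; rewrite -sc; field.
have HE : c * (c * Hv) = H.
  rewrite /Hv /H /S /B !mulr_sumr; apply: eq_bigr => a _.
  rewrite !mulr_sumr; apply: eq_bigr => b _.
  by rewrite -sc; field.
(* [a1] was defined so that [1 + a1] is the leading coefficient of the equation, normalised to 1 at
   [k = chi = psi = 1]. *)
have a1E : 1 + a1 = k * (c / 4) *
    (k ^+ 2 + k * (kap1 * (1 + psim) + kap2 * (1 + chim)) + (1 + chim) * (1 + psim)).
  have kE : (2 + kap1 + kap2)^-1 = c / 4.
    have n0 : 2 + kap1 + kap2 != 0.
      by apply: contra_eq_neq cE => ->; rewrite mulr0 eq_sym pnatr_eq0.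
    by apply: (mulIf n0); rewrite mulVf // mulrAC cE mulfV // pnatr_eq0.
  rewrite /a1 /Psm /X2 /km /k kE.
  have -> : c = 4 / (2 + kap1 + kap2) by rewrite -cE mulfK // -invr_eq0 kE mulf_neq0 // invr_eq0 pnatr_eq0.
  field; by rewrite -invr_eq0 kE mulf_neq0 // invr_eq0 pnatr_eq0.
have E1 : (1 + a1) * ((1 + a2) * (F + v) - k * Qv - c * Hv) + (1 + a2) * (Zr - v) = 0.
  rewrite -[RHS](subrr F) [X in _ = F - X]EF; ring.
have A2E : 1 + a2 = k ^+ 2 + Q by rewrite /a2 QE /km /k; ring.
move: E1; rewrite a1E A2E.
have LE' : L = c * (F + v) by rewrite /L LE mulrDr.
set Ps := k ^+ 2 + k * _ + _ => E1.
transitivity (4 * (k * (c / 4) * Ps * ((k ^+ 2 + Q) * (F + v) - k * Qv - c * Hv) +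
   (k ^+ 2 + Q) * (Zr - v))); last by rewrite E1 mulr0.
rewrite LE' -HE -QE /Zr /pert /X2 /km /k; move: (Qv) (Hv) (Ps) => q h p.
by field.
Qed.

Theorem graph_eqn_solution : exists K eps0 : R, 0 < K /\ 0 < eps0 /\
  forall (J : finType) (mu kap1 kap2 : R) (eps : J -> R) (d : J -> 'rV[R]_3) (wa wb : J -> R),
  0 <= mu -> mu <= eps0 -> 0 <= kap1 -> 0 <= kap2 -> 2 <= kap1 + kap2 ->
  (forall j, 0 <= eps j) -> (forall j, eps j <= mu) ->
  (forall j, kap1 * eps j <= mu) -> (forall j, kap2 * eps j <= mu) ->
  (forall j, enorm (d j) <= 1) ->
  (forall j, 0 <= wa j) -> \sum_j wa j <= 1 -> (forall j, 0 <= wb j) -> \sum_j wb j <= 1 ->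
  exists X : ser R, [/\ nle 2 X (K * mu), (forall a, nle 2 (rot a X) (K * mu)),
    (forall a b, exists M, nle 2 (rot a (rot b X)) M) &
    forall x, enorm x <= 2 ->
    let k := 1 + ev X x in
    exists g : J -> R,
      (forall j, `|g j - 1| <= 2^-1 /\
         g j ^+ 2 * (k ^+ 2 - 2 * k * eps j * lform (d j) x + eps j ^+ 2) = k ^+ 2) /\
      graph_eqn kap1 kap2 eps d wa wb x k (fun a => ev (rot a X) x)
        (fun a b => ev (rot a (rot b X)) x) g].
Proof.
(* Small enough that the Lipschitz constant [10 ^+ 9 * delta] coming from [ms_map_cls] is at most
   1/4. *)
pose delta : R := (10 ^+ 10)^-1.
have delta0 : 0 < delta by rewrite invr_gt0 exprn_gt0.
have delta1 : delta <= 1 by rewrite invf_le1 ?exprn_gt0 // exprn_ege1 // ler1n.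
have Kd : 4 * (10 ^+ 9 * delta) <= 1.
  rewrite mulrA ler_pdivrMr ?exprn_gt0 // mul1r [leRHS]exprS ler_wpM2r ?exprn_ge0 //.
  by rewrite ler_nat.
clearbody delta.
(* The sources enter through [eps j / delta], so [nu = mu / delta], and [nu <= delta ^+ 2] forces
   [mu <= delta ^+ 3]. The first constant is the fixed point bound [2 * (10 ^+ 9 * nu)] expressed in
   [mu]. *)
exists (2 * (10 ^+ 9 * delta^-1)), (delta ^+ 3).
split; first by rewrite !mulr_gt0 // ?invr_gt0 // exprn_gt0.
split; first by rewrite exprn_gt0.
move=> J mu kap1 kap2 eps d wa wb mu0 mu1 k10 k20 k12 ep0 ep1 ke1 ke2 d1 wa0 wa1 wb0 wb1.
pose nu := mu / delta.
have nu0 : 0 <= nu by rewrite divr_ge0 // ltW.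
have nud : nu <= delta ^+ 2 by rewrite ler_pdivrMr // -exprSr.
have munu : mu <= nu by rewrite ler_pdivlMr // ler_piMr.
(* The zeroth order coefficient of the equation linearised at [k = 1]. It is at most 1 because
   [2 <= kap1 + kap2]. *)
pose c : R := 4 / (2 + kap1 + kap2).
have s4 : 4 <= 2 + kap1 + kap2 by lra.
have sp : 0 < 2 + kap1 + kap2 by apply: lt_le_trans s4.
have c0 : 0 < c by rewrite divr_gt0.
have c1 : c <= 1 by rewrite ler_pdivrMr // mul1r.
have cE : c * (2 + kap1 + kap2) = 4 by rewrite divfK // gt_eqF.
have [T Tsolve] := resolvent c0.
have ep_nu j : eps j / delta <= nu by rewrite ler_wpM2r ?invr_ge0 ?(ltW delta0).
have C := ms_map_cls delta0 delta1 nu0 nud c0 c1 k10 k20 Tsolve ep0 ep_nu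
  (fun j => le_trans (ke1 j) munu) (fun j => le_trans (ke2 j) munu) d1 wa0 wa1 wb0 wb1.
have [U [UB [Uball UE]]] := cls_contraction delta0 nu0 nud Kd C.
have KE : 2 * (10 ^+ 9 * nu) = 2 * (10 ^+ 9 * delta^-1) * mu by rewrite /nu; ring.
rewrite KE in UB.
pose X := T (U None).
have solve k : forall s, size s = k -> cas X s - c * X s = c * U None s.
  by move=> s _; apply: Tsolve.
have two0 : 0 <= 2 :> R by [].
have s0 : 0 < Num.sqrt c by rewrite sqrtr_gt0.
have X0 : nle 2 X (2 * (10 ^+ 9 * delta^-1) * mu).
  rewrite -[X in nle _ _ X]mul1r; apply: (@nle_nrm _ _ (U None)) => // k.
  by rewrite mul1r; exact: (energy0 c0 (solve k)).
have X1 a : nle 2 (rot a X) (2 * (10 ^+ 9 * delta^-1) * mu).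
  rewrite -[X in nle _ _ X]mul1r; apply: (@nle_nrm _ _ (U None)) => // k.
  apply: (le_trans (energy1 c0 (solve k) a)); rewrite ler_wpM2r ?nrm_ge0 //.
  by rewrite -sqrtr1 ler_wsqrtr.
have X2 a b : exists M, nle 2 (rot a (rot b X)) M.
  exists (c * (2 * (10 ^+ 9 * delta^-1) * mu)); apply: (@nle_nrm _ _ (U None)) => // [|k].
    exact: ltW.
  exact: (energy2 c0 (solve k)).
exists X; split => // x x2 /=.
have add := evals_add x2; have mul := evals_mul x2; have scal := evals_sc x2.
have opp := evals_opp x2; have cst := evals_cst x; have lin := evals_lin x.
have eX : evals x (tv T U) (ev X x) := evals_bdd x X0.
have eF : evals x (U None) (ev (U None) x) := evals_bdd x (UB None).
have eh j : evals x (U (Some j)) (ev (U (Some j)) x) := evals_bdd x (UB (Some j)).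
have eV a : evals x (tV T a U) (ev (rot a X) x) := evals_bdd x (X1 a).
have eVV a b : evals x (rot a (rot b X)) (ev (rot a (rot b X)) x).
  by have [M HM] := X2 a b; apply: evals_bdd HM.
have eS a : evals x (tS c T a U) ((Num.sqrt c)^-1 * ev (rot a X) x) := scal _ _ _ (eV a).
have eB a b : evals x (tB c T a b U) (c^-1 * ev (rot a (rot b X)) x) := scal _ _ _ (eVV a b).
have eth j : evals x (th delta j U) (delta * ev (U (Some j)) x) := scal _ _ _ (eh j).
have eg j : evals x (tg delta j U) (1 + delta * ev (U (Some j)) x) := add _ _ _ _ (cst 1) (eth j).
have ek : evals x (tk T U) (1 + ev X x) := add _ _ _ _ (cst 1) eX.
(* From here on the values left as [_] are assembled by unification along the definition of each
   series. *)
have ekm : evals x (tkm T U) _ := add _ _ _ _ (add _ _ _ _ eX eX) (mul _ _ _ _ eX eX).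
have eQ : evals x (tQ c T U) _ :=
  evals_sum x2 _ xpredT (fun a => mul _ _ _ _ (eS a) (eS a)).
have eH : evals x (tH c T U) _ :=
  evals_sum x2 _ xpredT (fun a => evals_sum x2 _ xpredT (fun b =>
    mul _ _ _ _ (eS a) (mul _ _ _ _ (eS b) (eB a b)))).
have ea2 : evals x (ta2 c T U) _ := add _ _ _ _ ekm (scal c _ _ eQ).
have eA2 : evals x (tA2 c T U) _ := add _ _ _ _ (cst 1) ea2.
have eR j : evals x (tR delta eps d T j U) _ :=
  mul _ _ _ _ (eg j) (mul _ _ _ _ (eg j) (mul _ _ _ _ (eg j)
    (add _ _ _ _ (add _ _ _ _ (mul _ _ _ _ ek (lin (d j)))
      (evals_sum x2 _ xpredT (fun a => mul _ _ _ _ (lin (dcr a (d j))) (eV a))))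
      (opp _ _ (cst (eps j)))))).
have ecm w : evals x (tchim delta w U) _ :=
  evals_sum x2 _ xpredT (fun j => scal (w j) _ _ (eth j)).
have ec w : evals x (tchi delta w U) _ := add _ _ _ _ (cst 1) (ecm w).
have eY kap w : evals x (tY delta eps d T kap w U) _ :=
  evals_sum x2 _ xpredT (fun j => scal (w j) _ _ (scal (kap * eps j) _ _ (eR j))).
have epert : evals x (tpert delta kap1 kap2 eps d wa wb T U) _ :=
  add _ _ _ _ (add _ _ _ _ (mul _ _ _ _ ek (add _ _ _ _ (eY kap1 wb) (eY kap2 wa)))
    (mul _ _ _ _ (ec wb) (eY 1 wa))) (mul _ _ _ _ (ec wa) (eY 1 wb)).
have eX2 : evals x (tX2 delta wa wb U) _ :=
  add _ _ _ _ (add _ _ _ _ (ecm wa) (ecm wb)) (mul _ _ _ _ (ecm wa) (ecm wb)).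
have eXX : evals x (tX delta wa wb T U) _ := add _ _ _ _ eX2 (opp _ _ ekm).
have eZr : evals x (tZr delta kap1 kap2 eps d wa wb T U) _ :=
  add _ _ _ _ (add _ _ _ _ (scal 2^-1 _ _ (add _ _ _ _ eX2 (opp _ _ (mul _ _ _ _ eX eX))))
    (scal 2^-1 _ _ (mul _ _ _ _ ekm eXX))) (scal 2^-1 _ _ epert).
have eZ : evals x (tZ delta kap1 kap2 eps d wa wb T U) _ := add _ _ _ _ eZr (opp _ _ eX).
have ekw w : evals x (tkw delta T w U) _ :=
  add _ _ _ _ (add _ _ _ _ eX (ecm w)) (mul _ _ _ _ eX (ecm w)).
have ePsm : evals x (tPsm delta kap1 kap2 wa wb T U) _ :=
  scal (2 + kap1 + kap2)^-1 _ _ (add _ _ _ _ (add _ _ _ _ (add _ _ _ _ ekm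
    (scal kap1 _ _ (ekw wb))) (scal kap2 _ _ (ekw wa))) eX2).
have ea1 : evals x (ta1 delta kap1 kap2 wa wb T U) _ :=
  add _ _ _ _ (add _ _ _ _ eX ePsm) (mul _ _ _ _ eX ePsm).
have eA1 : evals x (tA1 delta kap1 kap2 wa wb T U) _ := add _ _ _ _ (cst 1) ea1.
have eFv : evals x (tFv T U) _ := add _ _ _ _ eF eX.
have eE0 : evals x (tE0 delta c kap1 kap2 eps d wa wb T U) _ :=
  add _ _ _ _ (add _ _ _ _ (add _ _ _ _ (add _ _ _ _ (opp _ _ (mul _ _ _ _ ea2 eFv))
    (opp _ _ (mul _ _ _ _ ea1 (mul _ _ _ _ eA2 eFv))))
    (mul _ _ _ _ eA1 (add _ _ _ _ (mul _ _ _ _ ek eQ) (scal c _ _ eH))))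
    (opp _ _ eZr)) (opp _ _ (mul _ _ _ _ ea2 eZ)).
have eEj j : evals x (tEj delta eps d T j U) _ :=
  add _ _ _ _ (add _ _ _ _ (scal 2^-1 _ _ (mul _ _ _ _ (scal (eps j / delta) _ _
      (add _ _ _ _ (scal 2 _ _ (mul _ _ _ _ ek (lin (d j)))) (opp _ _ (cst (eps j)))))
      (mul _ _ _ _ (eg j) (eg j))))
    (opp _ _ (scal (delta / 2) _ _ (mul _ _ _ _ ek (mul _ _ _ _ ek (mul _ _ _ _ (eh j) (eh j)))))))
    (opp _ _ (mul _ _ _ _ (eh j) ekm)).
exists (fun j => 1 + delta * ev (U (Some j)) x); split.
  move=> j; split.
    rewrite addrC addKr normrM gtr0_norm //.
    have := ev_le two0 (Uball (Some j)) x2.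
    move=> hle; apply: (@le_trans _ _ (delta * 1)).
      by rewrite ler_wpM2l ?(ltW delta0) // (le_trans hle).
    rewrite mulr1; have h9 : delta <= 10 ^+ 9 * delta.
      by rewrite ler_peMl ?(ltW delta0) // exprn_ege1 // ler1n.
    by move: Kd h9; set z := 10 ^+ 9 * delta => Kd h9; lra.
  have : ev (U (Some j)) x = ev (tEj delta eps d T j U) x.
    by rewrite -[in LHS]UE.
  case: (eEj j) => _ ->; rewrite -/(lform (d j) x).
  move: (lform (d j) x) (ev (U (Some j)) x) (ev X x) => D h v E.
  set k := 1 + v.
  have E2 : 2 * (delta * h) = (2 * k * eps j * D - eps j ^+ 2) * (1 + delta * h) ^+ 2
      - k ^+ 2 * (delta * h) ^+ 2 - 2 * (delta * h) * (k ^+ 2 - 1).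
    rewrite {1}E /k; field; exact: lt0r_neq0.
  apply/eqP; rewrite -subr_eq0; apply/eqP.
  transitivity (2 * (delta * h) - ((2 * k * eps j * D - eps j ^+ 2) * (1 + delta * h) ^+ 2
      - k ^+ 2 * (delta * h) ^+ 2 - 2 * (delta * h) * (k ^+ 2 - 1))); first by ring.
  by rewrite -E2 subrr.
have LE : \sum_(a < 3) ev (rot a (rot a X)) x = c * ev (U None) x + c * ev X x.
  have ecas : evals x (cas X) (\sum_(a < 3) ev (rot a (rot a X)) x).
    by apply: (evals_sum x2) => a; exact: eVV.
  have ecas' : evals x (cas X) (c * ev (U None) x + c * ev X x).
    have -> : cas X = sc c (U None) + sc c X.
      by apply/funext => s; rewrite addrfctE /sc -(Tsolve (U None) s) subrK.
    exact: (add _ _ _ _ (scal c _ _ eF) (scal c _ _ eX)).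
  by case: ecas => _ <-; case: ecas' => _ <-.
have EF : ev (U None) x = ev (tE0 delta c kap1 kap2 eps d wa wb T U) x.
  by rewrite -[in LHS]UE.
case: eE0 EF => _ -> EF.
have ss : Num.sqrt c * Num.sqrt c = c by rewrite -expr2 sqr_sqrtr // ltW.
have A := graph_eqn_algebra c0 s0 ss cE LE EF.
rewrite /graph_eqn /=.
have E1 j : 1 + delta * ev (U (Some j)) x - 1 = delta * ev (U (Some j)) x.
  by rewrite addrC addKr.
have Ew w : \sum_j w j * (1 + delta * ev (U (Some j)) x - 1) =
    \sum_j w j * (delta * ev (U (Some j)) x).
  by apply: eq_bigr => j _; rewrite E1.
rewrite !Ew; exact: A.
Qed.

End GraphEquation.

(** * Radial level functions *)

Section LevelFunction.
Context {R : realType}.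
Implicit Types (x z v : 'rV[R]_3) (X f : ser R).

Lemma enorm_lform n (x : 'rV[R]_n) : enorm x ^+ 2 = lform x x.
Proof. by rewrite enorm_sq /lform; apply: eq_bigr => i _; rewrite expr2. Qed.

Lemma enorm_eq0 n (x : 'rV[R]_n) : (enorm x == 0) = (x == 0).
Proof.
apply/eqP/eqP => [x0|->]; last first.
  by rewrite /enorm big1 ?sqrtr0 // => i _; rewrite mxE expr0n.
have := enorm_sq x; rewrite x0 expr0n /= => /esym/eqP.
rewrite psumr_eq0 => [/allP H|i _]; last exact: sqr_ge0.
apply/rowP => i; rewrite mxE; apply/eqP; rewrite -sqrf_eq0.
by have := H i; rewrite mem_index_enum => /(_ isT).
Qed.

Lemma enorm_gt0 n (x : 'rV[R]_n) : x != 0 -> 0 < enorm x.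
Proof. by move=> x0; rewrite lt_def enorm_eq0 x0 enorm_ge0. Qed.

Lemma enormZ n a (x : 'rV[R]_n) : enorm (a *: x) = `|a| * enorm x.
Proof.
rewrite /enorm; under eq_bigr do rewrite mxE exprMn.
by rewrite -mulr_sumr sqrtrM ?sqr_ge0 // sqrtr_sqr.
Qed.

Lemma crossxE a x :
  (crossx a x 0 o0 = x 0 o1 * lc a o1 o0 + x 0 o2 * lc a o2 o0) *
  (crossx a x 0 o1 = x 0 o0 * lc a o0 o1 + x 0 o2 * lc a o2 o1) *
  (crossx a x 0 o2 = x 0 o0 * lc a o0 o2 + x 0 o1 * lc a o1 o2).
Proof.
by rewrite /crossx !mxE !sum3; move: a; elim/ord3E; rewrite /lc /=; (split; [split|]); ring.
Qed.

(** On the unit sphere the three rotation fields form a tight frame of the tangent plane. Tangential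
    gradients are thus recovered from rotational derivatives, with no coordinates on the sphere. *)
Lemma cross_frame l x :
  \sum_(a < 3) lform l (crossx a x) *: crossx a x = lform x x *: l - lform l x *: x.
Proof.
apply: row3P; rewrite !sum3 !mxE -?/(crossx _ _) /lform !sum3 !crossxE /lc /=; ring.
Qed.

(** The ambient gradient [l] depends on how [F] is extended off the sphere; the derivatives [D]
    along the rotation fields do not. *)
Definition rgrad (F : 'rV[R]_3 -> R) x (D : 'I_3 -> R) : Prop :=
  exists2 l, has_grad F x l & forall a, lform l (crossx a x) = D a.

Lemma rgrad_eq F x D D' : rgrad F x D -> D =1 D' -> rgrad F x D'.
Proof. by move=> [l Hl lD] DD; exists l => // a; rewrite -DD. Qed.

Lemma rgradD F G x D E : rgrad F x D -> rgrad G x E ->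
  rgrad (fun y => F y + G y) x (fun a => D a + E a).
Proof.
move=> [l Hl lD] [m Hm mE]; exists (l + m); first exact: has_gradD.
by move=> a; rewrite lformDl lD mE.
Qed.

Lemma rgradM F G x D E : rgrad F x D -> rgrad G x E ->
  rgrad (fun y => F y * G y) x (fun a => F x * E a + G x * D a).
Proof.
move=> [l Hl lD] [m Hm mE]; exists (F x *: m + G x *: l); first exact: has_gradM.
by move=> a; rewrite lformDl !lformZl lD mE.
Qed.

Lemma rgradC c x : rgrad (fun=> c) x (fun=> 0).
Proof.
exists 0; first exact: has_gradC.
by move=> a; rewrite /lform big1 // => i _; rewrite [X in _ * X]mxE mulr0.
Qed.

Lemma lform_delta n j (v : 'rV[R]_n) : lform (delta_mx 0 j) v = v 0 j.
Proof.
rewrite /lform (bigD1 j) //= big1 ?addr0 => [|i ij]; first by rewrite [X in _ * X]mxE !eqxx mulr1.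
by rewrite [X in _ * X]mxE eqxx (negPf ij) mulr0.
Qed.

Lemma rgrad_coord j x : rgrad (fun y => y 0 j) x (fun a => crossx a x 0 j).
Proof.
by exists (delta_mx 0 j); [exact: has_grad_coord | move=> a; rewrite lform_delta].
Qed.

Lemma rgrad_cross b j x :
  rgrad (fun y => crossx b y 0 j) x (fun a => crossx b (crossx a x) 0 j).
Proof.
have E (y : 'rV[R]_3) : crossx b y 0 j = y 0 o0 * lc b o0 j + y 0 o1 * lc b o1 j + y 0 o2 * lc b o2 j :> R.
  by rewrite mxE sum3.
have := rgradD (rgradD (rgradM (rgrad_coord o0 x) (rgradC (lc b o0 j) x))
  (rgradM (rgrad_coord o1 x) (rgradC (lc b o1 j) x)))
  (rgradM (rgrad_coord o2 x) (rgradC (lc b o2 j) x)).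
rewrite (_ : (fun y => _ : R) = (fun y => crossx b y 0 j)); last first.
  by apply/funext => y; rewrite E.
move/rgrad_eq; apply => a; rewrite (E (crossx a x)); ring.
Qed.

Lemma rgrad_ev f (w : R) x : 1 < w -> ser_an w f -> enorm x < w ->
  rgrad (ev f) x (fun a => ev (rot a f) x).
Proof.
move=> w1 fa xw; exists (\row_b ev (der b f) x); first exact: ev_has_grad xw.
by move=> a; apply: ev_rot xw.
Qed.

(** The rotation fields are dependent: their combination with coefficients [x 0 a] is the cross
    product of [x] with itself. *)
Lemma rgrad_radial F x D : rgrad F x D -> \sum_(a < 3) x 0 a * D a = 0.
Proof.
move=> [l _ lD]; under eq_bigr do rewrite -lD.
by rewrite sum3 /lform !sum3 !crossxE /lc /=; ring.
Qed.

Definition unitv z : 'rV[R]_3 := (enorm z)^-1 *: z.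

Lemma enorm_unitv z : z != 0 -> enorm (unitv z) = 1.
Proof.
move=> z0; have zp := enorm_gt0 z0.
by rewrite /unitv enormZ gtr0_norm ?invr_gt0 // mulVf // gt_eqF.
Qed.

Lemma lform_unitv z : z != 0 -> lform (unitv z) (unitv z) = 1.
Proof. by move=> z0; rewrite -enorm_lform enorm_unitv // expr1n. Qed.

Lemma has_grad_enorm z : z != 0 -> has_grad (@enorm R 3) z (unitv z).
Proof.
move=> z0; have zp := enorm_gt0 z0.
have sp : 0 < \sum_(k < 3) z 0 k ^+ 2 by rewrite -enorm_sq exprn_gt0.
have HS : has_grad (fun y : 'rV[R]_3 => \sum_(k < 3) y 0 k ^+ 2) z (2 *: z).
  have -> : (fun y : 'rV[R]_3 => \sum_(k < 3) y 0 k ^+ 2) =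
      (fun y => y 0 o0 * y 0 o0 + y 0 o1 * y 0 o1 + y 0 o2 * y 0 o2).
    by apply/funext => y; rewrite sum3 !expr2.
  have C j := has_gradM (has_grad_coord z j) (has_grad_coord z j).
  apply: (has_grad_eq (has_gradD (has_gradD (C o0) (C o1)) (C o2))).
  by apply: row3P; rewrite !mxE /=; ring.
apply: (has_grad_eq (has_grad_scal (is_derive1_sqrt sp) HS)).
rewrite /unitv -[Num.sqrt _]/(enorm z) scalerA; congr (_ *: _).
by field; rewrite gt_eqF.
Qed.

Lemma has_grad_unitv (F : 'rV[R]_3 -> R) z D : z != 0 -> rgrad F (unitv z) D ->
  has_grad (F \o unitv) z ((enorm z)^-1 *: \sum_(a < 3) D a *: crossx a (unitv z)).
Proof.
move=> z0 [l Hl lD]; have zp := enorm_gt0 z0.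
have zn : enorm z != 0 by rewrite gt_eqF.
pose M : 'M[R]_3 := \matrix_(j, i) ((enorm z)^-1 * ((j == i)%:R - unitv z 0 j * unitv z 0 i)).
have HG j : has_grad (fun y => unitv y 0 j) z (row j M).
  have -> : (fun y => unitv y 0 j) = (fun y => (enorm y)^-1 * y 0 j).
    by apply/funext => y; rewrite mxE.
  apply: (has_grad_eq (has_gradM (has_gradV (has_grad_enorm z0) zn) (has_grad_coord z j))).
  apply/rowP => i; rewrite !mxE eqxx /= (eq_sym i j); field; exact: zn.
apply: (has_grad_eq (has_grad_comp Hl HG)).
under eq_bigr do rewrite -lD.
rewrite cross_frame lform_unitv // scale1r.
apply/rowP => i; rewrite !mxE /lform.
under eq_bigr do rewrite mxE mulrCA mulrBr.
rewrite -mulr_sumr sumrB; congr (_ * (_ - _)).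
  rewrite (bigD1 i) //= eqxx mulr1 big1 ?addr0 // => b bi.
  by rewrite (negPf bi) mulr0.
rewrite mulr_suml; apply: eq_bigr => b _; rewrite [unitv z 0 i]mxE; ring.
Qed.

Section FrameAlgebra.
Variables (x : 'rV[R]_3) (k : R) (ka : 'I_3 -> R) (kab : 'I_3 -> 'I_3 -> R).

Definition frame_grad : 'rV[R]_3 := k *: x + \sum_(a < 3) ka a *: crossx a x.
Definition frame_hess a : 'rV[R]_3 := ka a *: x + k *: crossx a x +
  \sum_(b < 3) (kab a b *: crossx b x + ka b *: crossx b (crossx a x)).

Hypotheses (xx : lform x x = 1) (rad1 : \sum_(a < 3) x 0 a * ka a = 0)
  (rad2 : forall b, \sum_(a < 3) x 0 a * kab a b = 0).

Let Q := \sum_(a < 3) ka a * ka a.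

Lemma frame_grad_sq : lform frame_grad frame_grad = k ^+ 2 + Q.
Proof.
transitivity (k ^+ 2 * lform x x + Q * lform x x - (\sum_(a < 3) x 0 a * ka a) ^+ 2).
  rewrite /frame_grad /Q !sum3 /lform !sum3 !mxE !sum3 /lc /=; ring.
by rewrite xx rad1; ring.
Qed.

Lemma frame_grad_cross a : lform (crossx a x) frame_grad = ka a.
Proof.
transitivity (ka a * lform x x - x 0 a * (\sum_(a < 3) x 0 a * ka a)).
  rewrite /frame_grad !sum3 /lform !sum3 !mxE !sum3.
  by move: a; elim/ord3E; rewrite /lc /=; ring.
by rewrite xx rad1; ring.
Qed.

Lemma frame_hess_grad a : lform (frame_hess a) frame_grad = k * ka a + \sum_(b < 3) ka b * kab a b.
Proof.
have C b : lform (crossx b x) frame_grad = ka b := frame_grad_cross b.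
have X1 : lform x frame_grad = k.
  transitivity (k * lform x x); last by rewrite xx mulr1.
  by rewrite /frame_grad !sum3 /lform !sum3 !mxE !sum3 /lc /=; ring.
have XX b : lform (crossx b (crossx a x)) frame_grad =
    x 0 b * (lform (crossx a x) frame_grad * 0 + lform (delta_mx 0 a) frame_grad) - 
    (b == a)%:R * lform x frame_grad.
  rewrite lform_delta /lform !sum3 !crossxE.
  by move: a b {C}; do 2![elim/ord3E]; rewrite /lc /=; ring.
rewrite /frame_hess !lformDl !lformZl C X1 sum3 !lformDl !lformZl !C !XX lform_delta X1.
have E : frame_grad 0 a = k * x 0 a + \sum_(b < 3) ka b * crossx b x 0 a.
  by rewrite /frame_grad !sum3 !mxE.
have D : \sum_(b < 3) ka b * (b == a)%:R = ka a.
  by rewrite sum3; move: a {C XX E}; elim/ord3E => /=; ring.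
have := rad1; rewrite !sum3 => R1; move: D; rewrite sum3 => D.
transitivity (k * ka a + (ka o0 * kab a o0 + ka o1 * kab a o1 + ka o2 * kab a o2)
  + k * (ka a - (ka o0 * (o0 == a)%:R + ka o1 * (o1 == a)%:R + ka o2 * (o2 == a)%:R))
  + frame_grad 0 a * (x 0 o0 * ka o0 + x 0 o1 * ka o1 + x 0 o2 * ka o2)); last by rewrite D R1; ring.
ring.
Qed.

Lemma frame_hess_trace :
  \sum_(a < 3) lform (frame_hess a) (crossx a x) = 2 * k + \sum_(a < 3) kab a a.
Proof.
transitivity ((2 * k + \sum_(a < 3) kab a a) * lform x x -
  \sum_(b < 3) x 0 b * \sum_(a < 3) x 0 a * kab a b).
  rewrite !sum3 /frame_hess !sum3 !(lformDl, lformZl) /lform !sum3 !crossxE /lc /=.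
  ring.
by rewrite xx; under [X in _ - X]eq_bigr do rewrite rad2 mulr0; rewrite big1_eq; ring.
Qed.

End FrameAlgebra.

Section RadialGraph.
Variable X : ser R.
Hypotheses (Xan : ser_an 2 X) (Xan1 : forall a, ser_an 2 (rot a X)).

Definition kval x := 1 + ev X x.
Definition hlev z := enorm z * kval (unitv z).
Definition Nvec x := kval x *: x + \sum_(a < 3) ev (rot a X) x *: crossx a x.
Definition DN x a : 'rV[R]_3 := ev (rot a X) x *: x + kval x *: crossx a x +
  \sum_(b < 3) (ev (rot a (rot b X)) x *: crossx b x +
                 ev (rot b X) x *: crossx b (crossx a x)).
(** The Hessian of [hlev]: the gradient is homogeneous of degree 0, so its differential is assembled
    from rotational derivatives through the frame, with one factor [1 / |z|]. *)
Definition Hmx z : 'M[R]_3 := (enorm z)^-1 *: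
  \sum_(a < 3) (DN (unitv z) a)^T *m crossx a (unitv z).

Let one2 : 1 < 2 :> R. Proof. by rewrite ltr1n. Qed.

Let lt2 z : z != 0 -> enorm (unitv z) < 2.
Proof. by move=> /enorm_unitv ->. Qed.

Lemma rgrad_kval x : enorm x < 2 -> rgrad kval x (fun a => ev (rot a X) x).
Proof.
move=> x2; have := rgradD (rgradC 1 x) (rgrad_ev one2 Xan x2).
by move/rgrad_eq; apply => a; rewrite add0r.
Qed.

Lemma has_grad_hlev z : z != 0 -> has_grad hlev z (Nvec (unitv z)).
Proof.
move=> z0; have zn : enorm z != 0 by rewrite enorm_eq0.
have Hk := has_grad_unitv z0 (rgrad_kval (lt2 z0)).
apply: (has_grad_eq (has_gradM (has_grad_enorm z0) Hk)).
by rewrite scalerA mulfV // scale1r addrC.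
Qed.

Lemma has_grad_Nvec z j : z != 0 ->
  has_grad (fun y => Nvec (unitv y) 0 j) z (row j (Hmx z)).
Proof.
move=> z0; have x2 := lt2 z0; set x := unitv z in x2.
have C b := rgradM (rgrad_ev one2 (Xan1 b) x2) (rgrad_cross b j x).
have G := rgradD (rgradM (rgrad_kval x2) (rgrad_coord j x)) (rgradD (rgradD (C o0) (C o1)) (C o2)).
have {G}G : rgrad (fun y => Nvec y 0 j) x (fun a => DN x a 0 j).
  move: G; rewrite (_ : (fun y => _ : R) = (fun y => Nvec y 0 j)); last first.
    by apply/funext => y; rewrite /Nvec sum3 !mxE.
  move/rgrad_eq; apply => a; rewrite /DN sum3 !mxE -!/(crossx _ _ 0 j); ring.
apply: (has_grad_eq (has_grad_unitv z0 G)).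
apply/rowP => i; rewrite !mxE !summxE; congr (_ * _); apply: eq_bigr => a _.
by rewrite !mxE big_ord1 !mxE.
Qed.

Lemma Nvec_radial x : enorm x = 1 -> lform (Nvec x) x = kval x.
Proof.
move=> x1; have xx : lform x x = 1 by rewrite -enorm_lform x1 expr1n.
rewrite /Nvec lformDl lformZl xx mulr1 [X in _ + X](_ : _ = 0) ?addr0 //.
rewrite sum3 !lformDl !lformZl.
have Z a : lform (crossx a x) x = 0.
  by rewrite /lform sum3 !crossxE; move: a; elim/ord3E; rewrite /lc /=; ring.
by rewrite !Z !mulr0 !addr0.
Qed.

Lemma level_curv_graph (o : R) (G : 'rV[R]_3) z : z != 0 ->
  let x := unitv z in
  let k := kval x in
  let ka a := ev (rot a X) x in
  let kab a b := ev (rot a (rot b X)) x in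
  let Q := \sum_(a < 3) ka a * ka a in
  let H := \sum_(a < 3) \sum_(b < 3) ka a * ka b * kab a b in
  let L := \sum_(a < 3) kab a a in
  enorm z * level_curv o G (Nvec x) (Hmx z) =
  (k ^+ 2 + Q) * L - k * Q - H +
  2 * (k ^+ 2 + Q) * (enorm z * lform G (Nvec x) / o + k).
Proof.
move=> z0 x k ka kab Q H L.
have x2 : enorm x < 2 := lt2 z0.
have xx : lform x x = 1 by exact: lform_unitv.
have rad1 : \sum_(a < 3) x 0 a * ka a = 0 := rgrad_radial (rgrad_ev one2 Xan x2).
have rad2 b : \sum_(a < 3) x 0 a * kab a b = 0 := rgrad_radial (rgrad_ev one2 (Xan1 b) x2).
have zn : enorm z != 0 by rewrite enorm_eq0.
have NN : lform (Nvec x) (Nvec x) = k ^+ 2 + Q := frame_grad_sq k xx rad1.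
have XN a : lform (crossx a x) (Nvec x) = ka a := frame_grad_cross k xx rad1 a.
have DNN a : lform (DN x a) (Nvec x) = k * ka a + \sum_(b < 3) ka b * kab a b :=
  frame_hess_grad k kab xx rad1 a.
have DNX : \sum_(a < 3) lform (DN x a) (crossx a x) = 2 * k + L :=
  frame_hess_trace k ka xx rad2.
have HE i j : enorm z * Hmx z i j = \sum_(a < 3) DN x a 0 i * crossx a x 0 j.
  rewrite mxE mulrA mulfV // mul1r summxE; apply: eq_bigr => a _.
  by rewrite mxE big_ord1 mxE.
have TR : enorm z * \tr (Hmx z) = 2 * k + L.
  rewrite -DNX /mxtrace mulr_sumr; under eq_bigr do rewrite HE.
  rewrite exchange_big; apply: eq_bigr => a _; rewrite lformC.
  by apply: eq_bigr => i _; rewrite mulrC.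
have QD : enorm z * quad (Hmx z) (Nvec x) (Nvec x) = k * Q + H.
  transitivity (\sum_(a < 3) lform (DN x a) (Nvec x) * lform (crossx a x) (Nvec x)).
    transitivity (\sum_(j < 3) \sum_(i < 3) (enorm z * Hmx z j i) * (Nvec x 0 i * Nvec x 0 j)).
      rewrite /quad mulr_sumr; apply: eq_bigr => j _.
      rewrite /lform mulr_suml mulr_sumr; apply: eq_bigr => i _.
      by rewrite [X in _ * (_ * X * _)]mxE; ring.
    under eq_bigr do under eq_bigr do rewrite HE mulr_suml.
    under eq_bigr do rewrite exchange_big.
    rewrite exchange_big; apply: eq_bigr => a _.
    rewrite {1}/lform mulr_suml; apply: eq_bigr => j _.
    rewrite /lform mulr_sumr; apply: eq_bigr => i _; ring.
  rewrite /Q /H mulr_sumr -big_split; apply: eq_bigr => a _ /=.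
  rewrite DNN XN mulrDl mulr_suml; congr (_ + _); first by ring.
  by apply: eq_bigr => b _; ring.
rewrite /level_curv NN.
transitivity ((k ^+ 2 + Q) * (enorm z * \tr (Hmx z)) - enorm z * quad (Hmx z) (Nvec x) (Nvec x) +
  2 * (k ^+ 2 + Q) * (enorm z * lform G (Nvec x) / o)); first by ring.
by rewrite TR QD; ring.
Qed.

End RadialGraph.

End LevelFunction.

(** * The round sphere *)

Section Stereographic.
Context {R : realType}.
Implicit Types (u : 'rV[R]_2) (x y : 'rV[R]_3).

(** The two charts of the sphere are the stereographic projections from [(0, 0, pole b)]. *)
Definition pole (b : bool) : R := if b then 1 else -1.

Lemma pole_sq b : pole b * pole b = 1.
Proof. by case: b; rewrite /pole ?mulr1 // mulrNN mulr1. Qed.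

Definition plane_ix (a : 'I_2) : 'I_3 := if a == e0 then o0 else o1.

Definition stereo b x : 'rV[R]_2 := \row_a (x 0 (plane_ix a) * (1 - pole b * x 0 o2)^-1).

Definition istereo b u : 'rV[R]_3 := \row_j
  ((if j == o0 then 2 * u 0 e0 else if j == o1 then 2 * u 0 e1
    else pole b * (u 0 e0 * u 0 e0 + u 0 e1 * u 0 e1 - 1)) *
   (1 + (u 0 e0 * u 0 e0 + u 0 e1 * u 0 e1))^-1).

Lemma stereo_den u : 1 + (u 0 e0 * u 0 e0 + u 0 e1 * u 0 e1) != 0.
Proof.
by rewrite gt_eqF // ltr_pwDl // addr_ge0 // -expr2 sqr_ge0.
Qed.

Lemma istereo_sphere b u : enorm (istereo b u) = 1.
Proof.
apply/eqP; rewrite -(@eqrXn2 _ 2) ?enorm_ge0 //; apply/eqP.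
rewrite enorm_lform /lform sum3 !mxE /= expr1n.
have d := stereo_den u; have s := pole_sq b.
move: d; set p := u 0 e0; set q := u 0 e1 => d.
transitivity ((4 * (p * p + q * q) + (pole b * pole b) * (p * p + q * q - 1) ^+ 2) /
  (1 + (p * p + q * q)) ^+ 2); first by field.
by rewrite s; field.
Qed.

Lemma istereo_pole b u : 1 - pole b * istereo b u 0 o2 != 0.
Proof.
have d := stereo_den u; have s := pole_sq b.
have -> : 1 - pole b * istereo b u 0 o2 = 2 / (1 + (u 0 e0 * u 0 e0 + u 0 e1 * u 0 e1)).
  rewrite mxE /= !mulrA s mul1r; field; exact: d.
by rewrite mulf_neq0 ?invr_eq0.
Qed.

Lemma istereoK b u : stereo b (istereo b u) = u.
Proof.
have d := stereo_den u; have s := pole_sq b.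
have E : 1 - pole b * istereo b u 0 o2 = 2 / (1 + (u 0 e0 * u 0 e0 + u 0 e1 * u 0 e1)).
  rewrite mxE /= !mulrA s mul1r; field; exact: d.
apply/rowP => a; rewrite mxE E mxE.
by move: a; elim/ord2E; rewrite /plane_ix /=; field.
Qed.

Lemma stereoK b x : enorm x = 1 -> 1 - pole b * x 0 o2 != 0 -> istereo b (stereo b x) = x.
Proof.
move=> x1 d; have s := pole_sq b.
have xx : x 0 o0 * x 0 o0 + x 0 o1 * x 0 o1 = (1 - pole b * x 0 o2) * (1 + pole b * x 0 o2).
  have := enorm_lform x; rewrite x1 expr1n /lform sum3 => E.
  transitivity (1 - (pole b * pole b) * (x 0 o2 * x 0 o2)); last by ring.
  by rewrite s mul1r E; ring.
have N : stereo b x 0 e0 * stereo b x 0 e0 + stereo b x 0 e1 * stereo b x 0 e1 =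
    (1 + pole b * x 0 o2) / (1 - pole b * x 0 o2).
  rewrite !mxE /plane_ix /=.
  transitivity ((x 0 o0 * x 0 o0 + x 0 o1 * x 0 o1) / (1 - pole b * x 0 o2) ^+ 2); first by field.
  by rewrite xx; field.
have N2 : 1 + (1 + pole b * x 0 o2) / (1 - pole b * x 0 o2) = 2 / (1 - pole b * x 0 o2).
  by field.
apply/rowP => j; rewrite mxE N N2 !mxE /plane_ix /=.
move: j; elim/ord3E => /=; last first.
- transitivity ((pole b * pole b) * x 0 o2); last by rewrite s mul1r.
  by field.
- by field.
- by field.
Qed.

Lemma istereo_sm b U j : sm U (fun u => istereo b u 0 j).
Proof.
have e : (fun u => istereo b u 0 j) = (fun u => (if j == o0 then 2 * u 0 e0 else
   if j == o1 then 2 * u 0 e1 else pole b * (u 0 e0 * u 0 e0 + u 0 e1 * u 0 e1 + -1)) *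
   (1 + (u 0 e0 * u 0 e0 + u 0 e1 * u 0 e1))^-1).
  by apply/funext => u; rewrite mxE.
have sq : sm U (fun u => u 0 e0 * u 0 e0 + u 0 e1 * u 0 e1).
  by apply: sm_add; apply: sm_mul; apply: sm_coord.
rewrite e; apply: sm_mul; last first.
  apply: sm_inv; last by move=> u _; exact: stereo_den.
  by apply: (sm_add (f := fun=> 1)) => //; apply: sm_cst.
move: j {e}; elim/ord3E => /=.
- by apply: sm_mul; [apply: sm_cst | apply: sm_coord].
- by apply: sm_mul; [apply: sm_cst | apply: sm_coord].
- apply: sm_mul; first exact: sm_cst.
  by apply: (sm_add sq); exact: sm_cst.
Qed.

Lemma pole_has_grad b x : exists l, has_grad (fun y => 1 - pole b * y 0 o2) x l.
Proof.
have HD := has_gradD (has_gradC 1 x) (has_gradM (has_gradC (- pole b) x) (has_grad_coord x o2)).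
eexists; rewrite (_ : (fun y => 1 - pole b * y 0 o2) =
  (fun y : 'rV[R]_3 => 1 + - pole b * y 0 o2)); first exact: HD.
by apply/funext => y; rewrite mulNr.
Qed.

Lemma stereo_pole_has_grad b x a : 1 - pole b * x 0 o2 != 0 ->
  exists l, has_grad (fun y => stereo b y 0 a) x l.
Proof.
move=> d; have [l HD] := pole_has_grad b x.
have := has_gradM (has_grad_coord x (plane_ix a)) (has_gradV HD d).
rewrite (_ : (fun y => _ : R) = (fun y => stereo b y 0 a)); last first.
  by apply/funext => y; rewrite mxE.
by move=> H; eexists; exact: H.
Qed.

(** The gradients of the components of [G] are dual to the tangent vectors of [f], so by the
    Binet-Cauchy identity their cross products have inner product 1 and the Gram determinant cannot
    vanish. *)
Lemma left_inverse_rank (f : 'rV[R]_2 -> 'rV[R]_3) (G : 'rV[R]_3 -> 'rV[R]_2) u :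
  (forall a, derivable f u (delta_mx 0 a)) ->
  (forall a, exists l, has_grad (fun y => G y 0 a) (f u) l) ->
  (forall v, G (f v) = v) ->
  \rank (\matrix_(a < 2) pderiv a f u) = 2%N.
Proof.
move=> df HG GK; apply/tangent_rankP.
have [l0 H0] := HG e0; have [l1 H1] := HG e1.
have D b l a : has_grad (fun y => G y 0 b) (f u) l ->
    lform l (pderiv a f u) = (a == b)%:R.
  move=> H; have [_ <-] := has_grad_line H (df a).
  have -> : (fun y => G y 0 b) \o f = (fun v => v 0 b) by apply/funext => v /=; rewrite GK.
  by have := pderiv_grad a (has_grad_coord u b); rewrite /pderiv => ->; rewrite mxE eqxx.
set p := pderiv e0 f u; set q := pderiv e1 f u.
have D00 : lform l0 p = 1 := D e0 l0 e0 H0.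
have D01 : lform l0 q = 0 := D e0 l0 e1 H0.
have D10 : lform l1 p = 0 := D e1 l1 e0 H1.
have D11 : lform l1 q = 1 := D e1 l1 e1 H1.
clearbody p q; apply/eqP; rewrite gramE => /lform_eq0 c0.
have : lform (cross l0 l1) (cross p q) = 1.
  transitivity (lform l0 p * lform l1 q - lform l0 q * lform l1 p).
    by rewrite /lform !sum3 !crossE; ring.
  by rewrite D00 D01 D10 D11; ring.
rewrite c0 /lform big1 => [/eqP|i _]; last by rewrite mxE mul0r.
by rewrite eq_sym oner_eq0.
Qed.

End Stereographic.

(** * The sphere as a closed surface *)

Section SphereSurface.
Context (R : realType).

Definition sphere : topologicalType := set_type (@unit_sphere R).

Definition spt (x : sphere) : 'rV[R]_3 := set_val x.

Lemma sphereP (x : sphere) : enorm (spt x) = 1.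
Proof. exact: (set_valP (x : set_type (@unit_sphere R))). Qed.

Definition to_sphere (v : 'rV[R]_3) (h : enorm v = 1) : sphere :=
  SigSub (mem_set (h : unit_sphere v)).

Lemma sphere_val_continuous : continuous spt.
Proof. exact: initial_continuous. Qed.

Definition spole b : set sphere := [set x | 1 - pole b * spt x 0 o2 != 0].

Lemma open_pole b : open [set x : 'rV[R]_3 | 1 - pole b * x 0 o2 != 0].
Proof.
have -> : [set x : 'rV[R]_3 | 1 - pole b * x 0 o2 != 0] =
    (fun x : 'rV[R]_3 => 1 - pole b * x 0 o2) @^-1` [set y | y != 0] by [].
apply: open_comp; last first.
  have -> : [set y : R | y != 0] = ~` [set 0].
    by apply/seteqP; split => y /= /eqP.
  by rewrite openC; apply: accessible_closed_set1; apply: hausdorff_accessible; exact: Rhausdorff.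
move=> x _; have [l [H _]] := pole_has_grad b x; exact: differentiable_continuous.
Qed.

Lemma open_spole b : open (spole b).
Proof.
apply: (@open_comp _ _ spt [set x | 1 - pole b * x 0 o2 != 0]).
  by move=> x _; exact: sphere_val_continuous.
exact: open_pole.
Qed.

Definition spar b (u : 'rV[R]_2) : sphere := to_sphere (istereo_sphere b u).

Lemma istereo_continuous b : continuous (@istereo R b).
Proof.
move=> u; apply: (@cvg_row _ _ (nbhs u)) => j.
by have [c _] := @sm_step R 2 setT _ openT (istereo_sm b setT j); exact: (c u I).
Qed.

Lemma spar_continuous b : continuous (spar b).
Proof.
exact: (@continuous_comp_initial (set_type (@unit_sphere R)) 'rV[R]_2 'rV[R]_3 set_val
  (spar b) (@istereo_continuous b)).
Qed.

Definition sphere_chart (b : bool) : chart (R := R) sphere.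
Proof.
refine (@Chart R sphere (spole b) setT (fun x => stereo b (spt x)) (spar b) _ _ _ _ _ _ _ _).
- exact: open_spole.
- exact: openT.
- by [].
- by move=> u _; exact: istereo_pole.
- by move=> x dx; apply: val_inj; apply: stereoK => //; exact: sphereP.
- by move=> u _; exact: istereoK.
- rewrite continuous_open_subspace; last exact: open_spole.
  move=> x /set_mem dx; apply: (@cvg_row _ _ (nbhs x)) => a.
  have [l H] := stereo_pole_has_grad a dx.
  apply: (@continuous_comp _ _ _ spt (fun y => stereo b y 0 a) x).
    exact: sphere_val_continuous.
  by case: H => /differentiable_continuous.
- by apply: continuous_subspaceT; exact: spar_continuous.
Defined.

Lemma sphere_compact : compact [set: sphere].
Proof.
have cS : compact (@unit_sphere R).
  apply: bounded_closed_compact.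
    exists 1; split => // M M1 x x1; apply: ltW; apply: le_lt_trans M1.
    by rewrite -x1 norm_le_enorm.
  have -> : @unit_sphere R = (fun x : 'rV[R]_3 => \sum_(i < 3) x 0 i ^+ 2) @^-1` [set 1].
    apply/seteqP; split => x /=; rewrite /unit_sphere /= => H.
      by rewrite -enorm_sq H expr1n.
    by rewrite /enorm H sqrtr1.
  apply: closed_comp => [x _|]; last first.
    by apply: accessible_closed_set1; apply: hausdorff_accessible; exact: Rhausdorff.
  apply: (@cvg_sumr R _ (nbhs x) _ 'I_3 _ (fun i (x : 'rV[R]_3) => x 0 i ^+ 2)
    (fun i => x 0 i ^+ 2)) => i.
  under eq_fun do rewrite expr2; rewrite expr2.
  by apply: cvgM; apply: coord_continuous.
move=> F PF _.
have G1 : (spt @ F) (@unit_sphere R).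
  by apply: (@filterS _ F _ setT); [move=> x _; exact: (sphereP x) | exact: filterT].
have [p [p1 pcl]] := cS (spt @ F) _ G1.
exists (to_sphere p1); split => // A B FA [_ /= [[W oW <-] Wp WB]].
have GA : (spt @ F) (spt @` A).
  by apply: (@filterS _ F _ A) => // y Ay; exists y.
have [q [[x Ax <-] Wx]] := pcl _ W GA (open_nbhs_nbhs (conj oW Wp)).
by exists x; split => //; apply: WB.
Qed.

Lemma sphere_hausdorff : hausdorff_space sphere.
Proof.
move=> x y xy; apply: val_inj; apply: (@norm_hausdorff R 'rV[R]_3) => A B Ax By.
have [||z [Az Bz]] := xy (spt @^-1` A) (spt @^-1` B).
- exact: sphere_val_continuous.
- exact: sphere_val_continuous.
- by exists (spt z).
Qed.

Lemma sphere_atlas : smooth_atlas [set c | exists b, c = sphere_chart b].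
Proof.
split=> [x|_ _ [b ->] [b' ->]].
  have [d|d] := eqVneq (1 - pole true * spt x 0 o2 : R) 0; last first.
    by exists (sphere_chart true); [exists true|].
  exists (sphere_chart false); first by exists false.
  rewrite /= /spole /= /pole; move: d; rewrite /pole mul1r mulN1r opprK => /eqP d.
  by apply/eqP => d'; lra.
rewrite /= setTI.
have oU : open (spar b @^-1` spole b').
  by apply: open_comp; [move=> u _; exact: spar_continuous | exact: open_spole].
apply: smooth_row => // a; apply: sm_is_smooth => //.
have -> : (fun u => ((fun x : sphere => stereo b' (spt x)) \o spar b) u 0 a) =
    (fun u => istereo b u 0 (plane_ix a) * (1 + - pole b' * istereo b u 0 o2)^-1).
  by apply/funext => u /=; rewrite mxE mulNr.
apply: sm_mul; first exact: istereo_sm.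
apply: sm_inv => [|u Uu]; last by rewrite mulNr.
apply: (sm_add (f := fun=> 1)); first exact: sm_cst.
by apply: sm_mul; [exact: sm_cst | exact: istereo_sm].
Qed.

Lemma sphere_nonempty : [set: sphere] !=set0.
Proof. by exists (spar true 0). Qed.

Definition sphere_surface : closed_surface R :=
  ClosedSurface sphere_atlas sphere_nonempty sphere_hausdorff sphere_compact.

End SphereSurface.

(** * The conformal factor along a ray *)

Section SignAnalysis.
Context {R : realType}.

Lemma normM_le (u v p q : R) : `|u| <= p -> `|v| <= q -> `|u * v| <= p * q.
Proof. by move=> up vq; rewrite normrM ler_pM. Qed.

(** Here [s] is a radius in units of the distance to another source, [c] the cosine of the angle,
    and the relation for [g] is the law of cosines. Subtracting two such relations factors as
    [(g - g') (g + g')], which controls [g - g'] by [s - s']. *)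
Lemma kernel_lip (s s' c l k g g' : R) : 0 <= s <= 100^-1 -> 0 <= s' <= 100^-1 ->
  `|c| <= 1 -> `|l| <= 2 -> `|k| <= 2 -> 0 < g -> 0 < g' ->
  g ^+ 2 * (1 - 2 * s * c + s ^+ 2) = 1 -> g' ^+ 2 * (1 - 2 * s' * c + s' ^+ 2) = 1 ->
  `|g - g'| <= 2 * `|s - s'| /\
  `|s * (l - s * k) * g ^+ 3 - s' * (l - s' * k) * g' ^+ 3| <= 10 * `|s - s'|.
Proof.
move=> /andP[s0 s1] /andP[t0 t1] c1 l2 k2 g0 g0' gE gE'.
(* The quadratic factor lies between [(1 - u)^2] and [(1 + u)^2], which traps [v] between
   [1 / (1 + u)] and [1 / (1 - u)]. *)
have B (u v : R) : 0 <= u <= 100^-1 -> 0 < v -> v ^+ 2 * (1 - 2 * u * c + u ^+ 2) = 1 ->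
    98 / 100 <= v <= 102 / 100.
  move=> /andP[u0 u1] v0 vE; move: c1; rewrite ler_norml => /andP[c1 c2].
  have v2 := mulr_gt0 v0 v0.
  have cu1 : 0 <= u * (1 - c) by apply: mulr_ge0 => //; lra.
  have cu2 : 0 <= u * (1 + c) by apply: mulr_ge0 => //; lra.
  have H1 : v * (1 - u) <= 1.
    have [h|h] := leP (v * (1 - u)) 1 => //; nra.
  have H2 : 1 <= v * (1 + u).
    have [h|h] := leP 1 (v * (1 + u)) => //; nra.
  apply/andP; split; nra.
have /andP[ga gb] := B _ _ (introT andP (conj s0 s1)) g0 gE.
have /andP[ga' gb'] := B _ _ (introT andP (conj t0 t1)) g0' gE'.
pose De := `|s - s'|.
have De0 : 0 <= De by exact: normr_ge0.
have G2 : `|g - g'| <= 6 / 5 * De.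
  have E : (g - g') * (g + g') = (g * g') ^+ 2 * ((s - s') * (2 * c - (s + s'))).
    transitivity (g ^+ 2 * (g' ^+ 2 * (1 - 2 * s' * c + s' ^+ 2)) -
                  g' ^+ 2 * (g ^+ 2 * (1 - 2 * s * c + s ^+ 2))); last by ring.
    by rewrite gE gE'; ring.
  have gg : `|g + g'| = g + g' by rewrite gtr0_norm // addr_gt0.
  have P1 : `|g * g'| <= 102 / 100 * (102 / 100) by apply: normM_le; rewrite gtr0_norm.
  have c2 : `|2 * c - (s + s')| <= 202 / 100.
    by move: c1; rewrite !ler_norml => /andP[? ?]; apply/andP; split; lra.
  have P2 : `|(g * g') ^+ 2 * ((s - s') * (2 * c - (s + s')))| <=
      (102 / 100 * (102 / 100)) ^+ 2 * (De * (202 / 100)).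
    apply: normM_le; last exact: normM_le.
    by rewrite normrX lerXn2r // nnegrE; lra.
  move: P2; rewrite -E normrM gg => P2.
  have N0 : 0 <= `|g - g'| by exact: normr_ge0.
  have : `|g - g'| * (196 / 100) <= `|g - g'| * (g + g') by rewrite ler_wpM2l //; lra.
  lra.
split; first by move: G2; rewrite /De => G2; have := normr_ge0 (s - s'); lra.
have E : s * (l - s * k) * g ^+ 3 - s' * (l - s' * k) * g' ^+ 3 =
  (s - s') * (l - (s + s') * k) * g ^+ 3 +
  s' * (l - s' * k) * ((g - g') * (g ^+ 2 + g * g' + g' ^+ 2)) by ring.
rewrite E; apply: le_trans (ler_normD _ _) _.
have g3 : `|g ^+ 3| <= (102 / 100) ^+ 3.
  by rewrite normrX lerXn2r ?nnegrE ?gtr0_norm //; lra.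
have L1 : `|l - (s + s') * k| <= 2 + 2 / 100 * 2.
  apply: le_trans (ler_normB _ _) _; apply: lerD => //; apply: normM_le => //.
  by rewrite ger0_norm; clear -s0 s1 t0 t1; lra.
have L2 : `|l - s' * k| <= 2 + 2 / 100 * 2.
  apply: le_trans (ler_normB _ _) _; apply: lerD => //; apply: normM_le => //.
  by rewrite ger0_norm; clear -s0 s1 t0 t1; lra.
have g2 : `|g ^+ 2 + g * g' + g' ^+ 2| <= 4.
  by rewrite ger0_norm; clear -ga gb ga' gb'; nra.
have T1 : `|(s - s') * (l - (s + s') * k) * g ^+ 3| <= De * (2 + 2 / 100 * 2) * (102 / 100) ^+ 3.
  by apply: normM_le => //; exact: normM_le.
have T2 : `|s' * (l - s' * k) * ((g - g') * (g ^+ 2 + g * g' + g' ^+ 2))| <=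
   100^-1 * (2 + 2 / 100 * 2) * (6 / 5 * De * 4).
  apply: normM_le; last exact: normM_le.
  by apply: normM_le => //; rewrite ger0_norm.
move: T1 T2 De0; rewrite /De; clear.
move: `|_ * _ * g ^+ 3| `|_ * (_ * (g ^+ 2 + _ + _))| `|s - s'| => u v D ? ? ?; lra.
Qed.

(* On the ray [p_i + t om] one has [chiBL = a (al / t + chi)] and [psiBL = b (be / t + psi)] with
   [a], [b] the hatted values and [chi], [psi] close to [1].  Then [rpot] is [t chiBL psiBL / (a b)],
   and [rflux / rpot] is [t <grad log (chiBL psiBL), N> + <N, om>] when [k = <N, om>] and [x], [y]
   are [t] times the derivatives of [chi], [psi] along [N]. *)
Definition rflux (al be k t chi psi x y : R) : R :=
  k * (- (al * be / t) + t * (chi * psi)) + al * y + be * x + t * (x * psi + y * chi).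
Definition rpot (al be t chi psi : R) : R :=
  al * be / t + al * psi + be * chi + t * (chi * psi).

Lemma rpot_gt0 (al be t chi psi : R) : 0 <= al -> 0 <= be -> 0 < t -> 0 < chi -> 0 < psi ->
  0 < rpot al be t chi psi.
Proof.
move=> a0 b0 t0 c0 p0; rewrite /rpot ltr_wpDl ?mulr_gt0 // !addr_ge0 //.
- by rewrite divr_ge0 ?mulr_ge0 // ltW.
- by rewrite mulr_ge0 // ltW.
- by rewrite mulr_ge0 // ltW.
Qed.

Lemma near1_bounds (u e : R) : `|u - 1| <= e -> [/\ 1 - e <= u, u <= 1 + e & `|u| <= 1 + e].
Proof.
move=> ue; have := ue; rewrite ler_distl => /andP[-> ->]; split => //.
by rewrite -[u](subrK 1); apply: le_trans (ler_normD _ _) _; rewrite normr1 addrC lerD2l.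
Qed.

Lemma mul_near1 (u v : R) : 999 / 1000 <= u -> u <= 1001 / 1000 -> 999 / 1000 <= v ->
  v <= 1001 / 1000 -> 99 / 100 <= u * v <= 101 / 100.
Proof. by move=> *; apply/andP; split; nra. Qed.

Lemma mul_lip (t D e b b' u u' v v' : R) : 0 < t -> `|v| <= b -> `|u'| <= b' ->
  t * `|u - u'| <= e * D -> t * `|v - v'| <= e * D ->
  `|t * (u * v - u' * v')| <= e * D * b + b' * (e * D).
Proof.
move=> t0 vb ub uu vv.
rewrite (_ : t * _ = t * (u - u') * v + u' * (t * (v - v'))); last by ring.
by apply: le_trans (ler_normD _ _) _; apply: lerD; apply: normM_le => //; rewrite normrM gtr0_norm.
Qed.

(** The main part of the product is [d^2 ((k + q) S + (k - q) c)]. As [k] is near 1 and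
    [|q| <= 1/4], both coefficients are positive, and [c] near 1 gives a lower bound even when [S]
    is tiny. *)
Lemma flux_increment (q k S c D d R1 R2 : R) : 0 <= S -> `|k - 1| <= 100^-1 -> `|q| <= 4^-1 ->
  99 / 100 <= c <= 101 / 100 -> D = `|d| -> 0 < D -> `|R1| <= 20 / 1000 * D ->
  `|R2| <= 20 / 1000 * D -> 0 < d * (d * (k * S + k * c) + R1 - q * (d * (c - S) + R2)).
Proof.
move=> S0 k1 qb /andP[c1 c2] DE D0 R1b R2b.
have -> : d * (d * (k * S + k * c) + R1 - q * (d * (c - S) + R2)) =
  D ^+ 2 * ((k + q) * S + (k - q) * c) + d * R1 - d * (q * R2).
  by rewrite DE real_normK ?num_real //; ring.
have dD : `|d| <= D by rewrite DE.
have N1 := normM_le dD R1b; have N2 := normM_le dD (normM_le qb R2b).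
move: N1 N2; rewrite !ler_norml => /andP[N1 _] /andP[_ N2].
move: qb k1; rewrite !ler_norml => /andP[q1 q2] /andP[k1 k2].
have kS : 0 <= (k + q) * S by apply: mulr_ge0 => //; clear -k1 q1; lra.
have kc : 2^-1 <= (k - q) * c by clear -k1 q2 c1; nra.
have H : D ^+ 2 * 2^-1 <= D ^+ 2 * ((k + q) * S + (k - q) * c).
  by rewrite ler_wpM2l ?sqr_ge0 //; clear -kS kc; lra.
have D2 : 0 < D ^+ 2 by rewrite exprn_gt0.
move: H N1 N2 D2; rewrite (_ : D * (_ * D) = 20 / 1000 * D ^+ 2); last by ring.
rewrite (_ : D * (4^-1 * (_ * D)) = 5 / 1000 * D ^+ 2); last by field.
clear; move: (D ^+ 2) (D ^+ 2 * (_ + _)) (d * R1) (d * (q * R2)) => v u w z *; lra.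
Qed.

(** The comparison is always with a reference radius [T] at which the quotient [q] is at most 1/4 in
    size. If [q] were close to [k] or [-k], one of the two positive contributions in
    [flux_increment] would degenerate. *)
Lemma flux_quotient_increasing (al be k t T chi psi x y chi' psi' x' y' e D : R) :
  e = 1000^-1 -> D = `|t - T| ->
  0 <= al -> 0 <= be -> `|k - 1| <= 100^-1 -> 0 < t -> 0 < T ->
  `|chi - 1| <= e -> `|psi - 1| <= e -> `|x| <= e -> `|y| <= e ->
  `|chi' - 1| <= e -> `|psi' - 1| <= e -> `|x'| <= e -> `|y'| <= e ->
  t * `|chi - chi'| <= e * D -> t * `|psi - psi'| <= e * D ->
  t * `|x - x'| <= e * D -> t * `|y - y'| <= e * D ->
  al * `|psi - psi'| <= e * D -> be * `|chi - chi'| <= e * D ->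
  al * `|y - y'| <= e * D -> be * `|x - x'| <= e * D ->
  `|rflux al be k T chi' psi' x' y'| <= 4^-1 * rpot al be T chi' psi' -> t != T ->
  0 < (t - T) * (rflux al be k t chi psi x y / rpot al be t chi psi -
                 rflux al be k T chi' psi' x' y' / rpot al be T chi' psi').
Proof.
move=> eE DE a0 b0 k1 t0 T0 c1 p1 x1 y1 c1' p1' x1' y1' tc tp tx ty ap bc ay bx PP' tT.
have [c2 c3 Nc] := near1_bounds c1; have [p2 p3 Np] := near1_bounds p1.
have [c2' c3' Nc'] := near1_bounds c1'; have [p2' p3' Np'] := near1_bounds p1'.
have [_ _ Nk] := near1_bounds k1.
have e1 : 0 < 1 - e by rewrite eE; clear; lra.
have e2 : 0 < e by rewrite eE; clear; lra.
have b1 : 1 - e = 999 / 1000 by rewrite eE; field.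
have b2 : 1 + e = 1001 / 1000 by rewrite eE; field.
set P := rflux al be k t _ _ _ _; set P' := rflux _ _ _ T _ _ _ _ in PP' *.
set Phi := rpot _ _ t _ _; set Phi' := rpot _ _ T _ _ in PP' *.
have Phi0 : 0 < Phi by apply: rpot_gt0 => //; apply: lt_le_trans e1 _.
have Phi0' : 0 < Phi' by apply: rpot_gt0 => //; apply: lt_le_trans e1 _.
have D0 : 0 < D by rewrite DE normr_gt0 subr_eq0.
have eD : 0 <= e * D by rewrite mulr_ge0 // ltW.
have ee : e * (e * D) <= e * D by rewrite ler_piMl //; move: e1; rewrite subr_gt0 => /ltW.
have na (u : R) : `|al * u| = al * `|u| by rewrite normrM ger0_norm.
have nbe (u : R) : `|be * u| = be * `|u| by rewrite normrM ger0_norm.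
have t1 := mul_lip t0 Np Nc' tc tp.
have t2 := mul_lip t0 Np x1' tx tp.
have t3 := mul_lip t0 Nc y1' ty tc.
have t4 : `|(t - T) * (x' * psi' + y' * chi')| <= D * (e * (1 + e) + e * (1 + e)).
  apply: normM_le; first by rewrite DE.
  by apply: le_trans (ler_normD _ _) _; apply: lerD; apply: normM_le.
(* The difference of the singular terms [al * be / t] at the two radii is [-(t - T) S]; it raises
   the flux and lowers the potential. *)
pose S := al * be / (t * T).
have S0 : 0 <= S by rewrite divr_ge0 ?mulr_ge0 // ltW.
pose R1 := k * (t * (chi * psi - chi' * psi')) + al * (y - y') + be * (x - x') +
  t * (x * psi - x' * psi') + t * (y * chi - y' * chi') + (t - T) * (x' * psi' + y' * chi').
have EP : P - P' = (t - T) * (k * S + k * (chi' * psi')) + R1.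
  by rewrite /P /P' /rflux /R1 /S; clear -t0 T0; field; rewrite !gt_eqF.
pose R2 := t * (chi * psi - chi' * psi') + al * (psi - psi') + be * (chi - chi').
have EPhi : Phi - Phi' = (t - T) * (chi' * psi' - S) + R2.
  by rewrite /Phi /Phi' /rpot /R2 /S; clear -t0 T0; field; rewrite !gt_eqF.
have cp : 99 / 100 <= chi' * psi' <= 101 / 100.
  by move: c2' c3' p2' p3'; rewrite b1 b2 => *; exact: mul_near1.
have R1b : `|R1| <= 20 / 1000 * D.
  have t1' := normM_le Nk t1.
  apply: (@le_trans _ _ ((1 + 100^-1) * (e * D * (1 + e) + (1 + e) * (e * D)) +
    e * D + e * D + (e * D * (1 + e) + e * (e * D)) +
    (e * D * (1 + e) + e * (e * D)) + D * (e * (1 + e) + e * (1 + e)))).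
    by rewrite /R1; do ![apply: le_trans (ler_normD _ _) _; apply: lerD => //]; rewrite ?na ?nbe.
  rewrite (_ : D * _ = 2 * (1 + e) * (e * D)); last by ring.
  rewrite b2 (_ : 20 / 1000 * D = 20 * (e * D)); last by rewrite eE; field.
  by move: ee eD; clear; move: (e * D) (e * (e * D)) => v u *; lra.
have R2b : `|R2| <= 20 / 1000 * D.
  apply: (@le_trans _ _ (e * D * (1 + e) + (1 + e) * (e * D) + e * D + e * D)).
    by rewrite /R2; do ![apply: le_trans (ler_normD _ _) _; apply: lerD => //]; rewrite ?na ?nbe.
  rewrite b2 (_ : 20 / 1000 * D = 20 * (e * D)); last by rewrite eE; field.
  by move: eD; clear; move: (e * D) => v *; lra.
pose q := P' / Phi'.
have qb : `|q| <= 4^-1 by rewrite /q normrM normfV (gtr0_norm Phi0') ler_pdivrMr.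
have EQ : (P / Phi - P' / Phi') * Phi = P - P' - q * (Phi - Phi').
  move: Phi0 Phi0'; rewrite /q; clear; move: P P' Phi Phi' => u v w z w0 z0.
  by field; rewrite !gt_eqF.
rewrite -(pmulr_lgt0 _ Phi0) -mulrA EQ EP EPhi.
exact: flux_increment DE D0 R1b R2b.
Qed.

(** At [T = r1 / k] the relation [al * be = r1 ^+ 2] makes the two large terms combine to
    [r1 (chi psi - k^2)], which is small because all three factors are close to 1. *)
Lemma flux_small (al be k r1 chi psi x y e : R) : e = 1000^-1 ->
  0 <= al -> 0 <= be -> `|k - 1| <= 100^-1 -> 0 < r1 -> al * be = r1 ^+ 2 ->
  `|chi - 1| <= e -> `|psi - 1| <= e -> `|x| <= e -> `|y| <= e ->
  `|rflux al be k (r1 / k) chi psi x y| <= 4^-1 * rpot al be (r1 / k) chi psi.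
Proof.
move=> eE a0 b0 k1 r0 AE c1 p1 x1 y1.
have [k2 k3 _] := near1_bounds k1.
have k0 : 0 < k by clear -k2; lra.
have [c2 c3 Nc] := near1_bounds c1; have [p2 p3 Np] := near1_bounds p1.
have T0 : 0 < r1 / k by rewrite divr_gt0.
have r1T : r1 = k * (r1 / k) by rewrite mulrC divfK // gt_eqF.
have : al * be / (r1 / k) = k * r1 by rewrite AE; clear -r0 k0; field; rewrite !gt_eqF.
move: T0 r1T; move: (r1 / k) => T T0 r1T AT.
rewrite /rflux /rpot AT.
have E : k * (- (k * r1) + T * (chi * psi)) = r1 * (chi * psi - k ^+ 2) by rewrite r1T; ring.
rewrite {}E.
have b1 : 1 - e = 999 / 1000 by rewrite eE; field.
have b2 : 1 + e = 1001 / 1000 by rewrite eE; field.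
rewrite b1 in c2 p2; rewrite b2 in c3 p3.
have /andP[m1 m2] := mul_near1 c2 c3 p2 p3.
have cp : `|chi * psi - k ^+ 2| <= 4 / 100.
  by rewrite ler_norml; clear -m1 m2 k2 k3; apply/andP; split; nra.
have F1 : `|r1 * (chi * psi - k ^+ 2)| <= r1 * (4 / 100) by apply: normM_le => //; rewrite gtr0_norm.
have F2 : `|al * y| <= al * e by apply: normM_le => //; rewrite ger0_norm.
have F3 : `|be * x| <= be * e by apply: normM_le => //; rewrite ger0_norm.
have F4 : `|T * (x * psi + y * chi)| <= T * (e * (1 + e) + e * (1 + e)).
  apply: normM_le; first by rewrite gtr0_norm.
  by apply: le_trans (ler_normD _ _) _; apply: lerD; apply: normM_le.
have G1 : al * (999 / 1000) <= al * psi by rewrite ler_wpM2l.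
have G2 : be * (999 / 1000) <= be * chi by rewrite ler_wpM2l.
have G3 : T * (99 / 100) <= T * (chi * psi) by rewrite ler_wpM2l //; exact: ltW.
have G4 : r1 * (99 / 100) <= k * r1.
  by rewrite mulrC ler_wpM2r //; [exact: ltW | clear -k2; lra].
apply: (@le_trans _ _ (r1 * (4 / 100) + al * e + be * e + T * (e * (1 + e) + e * (1 + e)))).
  by do ![apply: le_trans (ler_normD _ _) _; apply: lerD => //].
rewrite b2 eE; move: G1 G2 G3 G4 T0 r0 a0 b0; clear.
move: (al * psi) (be * chi) (T * (chi * psi)) (k * r1) => *; lra.
Qed.

(** When [al * be = 0] the only negative main term disappears and [t chi psi] dominates the rest. *)
Lemma flux_gt0 (al be t chi psi x y e : R) : e = 1000^-1 ->
  al * be = 0 -> 0 < t -> `|chi - 1| <= e -> `|psi - 1| <= e -> `|x| <= e -> `|y| <= e ->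
  `|al * y| <= e * t -> `|be * x| <= e * t -> 0 < rflux al be 1 t chi psi x y.
Proof.
move=> eE A0 t0 c1 p1 x1 y1 ay bx; rewrite /rflux A0 mul0r oppr0 add0r mul1r.
have [c2 c3 Nc] := near1_bounds c1; have [p2 p3 Np] := near1_bounds p1.
have F4 : `|x * psi + y * chi| <= e * (1 + e) + e * (1 + e).
  by apply: le_trans (ler_normD _ _) _; apply: lerD; apply: normM_le.
have b1 : 1 - e = 999 / 1000 by rewrite eE; field.
have b2 : 1 + e = 1001 / 1000 by rewrite eE; field.
rewrite b1 in c2 p2; rewrite b2 in c3 p3 F4; rewrite eE in ay bx F4.
have /andP[m1 m2] := mul_near1 c2 c3 p2 p3.
move: ay bx F4; rewrite !ler_norml => /andP[ay _] /andP[bx _] /andP[xy _].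
have H : t * (9 / 10) <= t * (chi * psi + (x * psi + y * chi)).
  by rewrite ler_wpM2l //; [exact: ltW | clear -xy m1; lra].
move: ay bx H t0; rewrite mulrDr; clear.
move: (al * y) (be * x) (t * (chi * psi)) (t * (x * _ + _)) => *; lra.
Qed.

End SignAnalysis.

(** * Gradients of Newtonian potentials *)

Section PotentialGradient.
Context {R : realType}.

Lemma lform_normr (u v : 'rV[R]_3) : `|lform u v| <= enorm u * enorm v.
Proof.
have Q (s : R) : s ^+ 2 = 1 -> s * lform u v <= enorm u * enorm v.
  move=> s1; have [->|uz] := eqVneq u 0.
    have -> : lform 0 v = 0 by rewrite -(scale0r (0 : 'rV[R]_3)) lformZl mul0r.
    by rewrite mulr0 mulr_ge0 ?enorm_ge0.
  have [->|vz] := eqVneq v 0.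
    have -> : lform u 0 = 0 by rewrite lformC -(scale0r (0 : 'rV[R]_3)) lformZl mul0r.
    by rewrite mulr0 mulr_ge0 ?enorm_ge0.
  have up := enorm_gt0 uz; have vp := enorm_gt0 vz.
  have : 0 <= lform (enorm v *: u - (s * enorm u) *: v) (enorm v *: u - (s * enorm u) *: v).
    exact: lform_sq.
  rewrite lformDl lformNl !lformZl !(lformC _ (_ - _)) !lformDl !lformNl !lformZl -!enorm_lform (lformC v u).
  rewrite (_ : _ - _ = 2 * (enorm u * enorm v) * (enorm u * enorm v - s * lform u v)); last first.
    transitivity (enorm v ^+ 2 * enorm u ^+ 2 * (1 + s ^+ 2) - 2 * s * enorm u * enorm v * lform u v);
      first by ring.
    by rewrite s1; ring.
  by rewrite pmulr_rge0 ?subr_ge0 // !mulr_gt0.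
rewrite ler_norml; apply/andP; split; last by rewrite -[leLHS]mul1r; apply: Q; rewrite expr1n.
by rewrite lerNl -mulN1r; apply: Q; rewrite sqrrN expr1n.
Qed.

Lemma enorm_sub_sq (u v : 'rV[R]_3) t :
  enorm (u - t *: v) ^+ 2 = enorm u ^+ 2 - 2 * t * lform u v + t ^+ 2 * enorm v ^+ 2.
Proof.
rewrite !enorm_lform lformDl lformNl lformZl !(lformC _ (_ - _)) !lformDl !lformNl !lformZl.
by rewrite (lformC v u); ring.
Qed.

Lemma enorm_subC (u v : 'rV[R]_3) : enorm (u - v) = enorm (v - u).
Proof. by rewrite -opprB -scaleN1r enormZ normrN1 mul1r. Qed.

Lemma has_grad_translate (n : nat) (F : 'rV[R]_n -> R) x c l :
  has_grad F (x - c) l -> has_grad (fun y => F (y - c)) x l.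
Proof.
move=> HF; have := @has_grad_comp _ _ _ F (fun y => y - c) x l 1%:M HF.
rewrite mulmx1; apply => j; rewrite row1.
apply: (has_grad_eq (l := delta_mx 0 j + 0)); last by rewrite addr0.
rewrite (_ : (fun y => _ : R) = (fun y : 'rV[R]_n => y 0 j + - c 0 j)); last first.
  by apply/funext => y; rewrite !mxE.
by apply: has_gradD; [exact: has_grad_coord | exact: has_gradC].
Qed.

Lemma has_grad_sum (n : nat) (I : Type) (r : seq I) (F : I -> 'rV[R]_n -> R) x (l : I -> 'rV[R]_n) :
  (forall j, has_grad (F j) x (l j)) ->
  has_grad (fun y => \sum_(j <- r) F j y) x (\sum_(j <- r) l j).
Proof.
move=> H; elim: r => [|j r IH].
  by rewrite big_nil; under eq_fun do rewrite big_nil; exact: has_gradC.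
by rewrite big_cons; under eq_fun do rewrite big_cons; exact: has_gradD.
Qed.

Lemma has_grad_newton (w : R) (p x : 'rV[R]_3) : x != p ->
  has_grad (fun y => w / eucl_dist y p) x (- (w / enorm (x - p) ^+ 3) *: (x - p)).
Proof.
move=> xp; have d0 : x - p != 0 by rewrite subr_eq0.
have dp := enorm_gt0 d0.
apply: (@has_grad_translate _ (fun z => w / enorm z)).
apply: has_grad_eq (has_gradM (has_gradC w _) (has_gradV (has_grad_enorm d0) _)) _.
  by rewrite gt_eqF.
rewrite scaler0 addr0 /unitv !scalerA; congr (_ *: _).
by clear -dp; field; rewrite gt_eqF.
Qed.

End PotentialGradient.

(** * The two potentials in a neighbourhood of one source *)

Section NearSource.
Context {R : realType} {n : nat}.
Variables (B : brill_lindquist R n) (i : 'I_n).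
Implicit Types (w : 'I_n -> R) (om N : 'rV[R]_3) (t : R).

Definition rel j : 'rV[R]_3 := pt B j - pt B i.
Definition hatw w := 1 + \sum_(j < n | j != i) w j / enorm (rel j).

(* For [j = i] the weight is [0], because [enorm (rel i) = 0]. *)
Definition wt w j := w j / (enorm (rel j) * hatw w).
Definition gk om t j := enorm (rel j) / enorm (rel j - t *: om).
(** The part of the potential that is regular at [p_i], divided by its value [hatw w] at [p_i]. *)
Definition nreg w om t := 1 + \sum_j wt w j * (gk om t j - 1).
(** [t] times the derivative, in the direction [N] at the displacement [t *: om], of the function of
    position whose value there is [gk om t j]. *)
Definition gker om N t j := t / enorm (rel j) *
  (lform (rel j) N / enorm (rel j) - t / enorm (rel j) * lform N om) * gk om t j ^+ 3.
Definition nder w om N t := \sum_j wt w j * gker om N t j.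

Lemma rel_neq0 j : j != i -> rel j != 0.
Proof. by move=> ji; rewrite subr_eq0 (inj_eq (pt_inj (b := B))). Qed.

Lemma rel_gt0 j : j != i -> 0 < enorm (rel j).
Proof. by move=> ji; apply: enorm_gt0; exact: rel_neq0. Qed.

Lemma enorm_rel0 : enorm (rel i) = 0.
Proof. by apply/eqP; rewrite enorm_eq0 /rel subrr. Qed.

Lemma wt0 w : wt w i = 0.
Proof. by rewrite /wt enorm_rel0 mul0r invr0 mulr0. Qed.

Section Weights.
Variable w : 'I_n -> R.
Hypothesis w0 : forall j, 0 <= w j.

Lemma hatw_ge1 : 1 <= hatw w.
Proof. by rewrite lerDl sumr_ge0 // => j _; rewrite divr_ge0 // enorm_ge0. Qed.

Lemma hatw_gt0 : 0 < hatw w.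
Proof. by apply: lt_le_trans hatw_ge1. Qed.

Lemma wt_ge0 j : 0 <= wt w j.
Proof. by rewrite divr_ge0 // mulr_ge0 ?enorm_ge0 // ltW // hatw_gt0. Qed.

(** The summand 1 in [hatw] is what bounds the total weight, independently of the number and
    strength of the other sources. *)
Lemma wt_sum : \sum_j wt w j <= 1.
Proof.
have -> : \sum_j wt w j = (\sum_(j < n | j != i) w j / enorm (rel j)) / hatw w.
  rewrite mulr_suml (bigD1 i) //= wt0 add0r; apply: eq_bigr => j _.
  by rewrite /wt invfM mulrA.
by rewrite ler_pdivrMr ?hatw_gt0 // mul1r /hatw lerDr.
Qed.

(** The factor [tau] is traded against the inverse distance in the Lipschitz bound, so no distance
    survives in the result. It will be [t], [al] or [be], the sizes that multiply these differences
    in the flux. *)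
Lemma weighted_lip (f f' : 'I_n -> R) (t T tau dl : R) : 0 <= tau -> 0 <= dl ->
  (forall j, j != i -> tau <= dl * enorm (rel j)) ->
  (forall j, j != i -> `|f j - f' j| <= 10 * `|t / enorm (rel j) - T / enorm (rel j)|) ->
  tau * `|\sum_j wt w j * f j - \sum_j wt w j * f' j| <= 10 * dl * `|t - T|.
Proof.
move=> tau0 dl0 tauj fj.
apply: (@le_trans _ _ (\sum_j wt w j * (10 * dl * `|t - T|))); last first.
  by rewrite -mulr_suml ler_piMl ?wt_sum // !mulr_ge0.
rewrite -sumrB; apply: le_trans (ler_wpM2l tau0 (ler_norm_sum _ _ _)) _.
rewrite mulr_sumr; apply: ler_sum => j _; rewrite -mulrBr normrM ger0_norm ?wt_ge0 //.
rewrite mulrCA; have [->|ji] := eqVneq j i; first by rewrite wt0 !mul0r.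
rewrite ler_wpM2l ?wt_ge0 //; have ej := rel_gt0 ji.
apply: le_trans (ler_wpM2l tau0 (fj j ji)) _.
rewrite -mulrBl normrM (gtr0_norm (x := (enorm _)^-1)) ?invr_gt0 //.
have -> : tau * (10 * (`|t - T| / enorm (rel j))) = 10 * `|t - T| * (tau / enorm (rel j)).
  by field; rewrite gt_eqF.
rewrite -!mulrA (mulrC dl) ler_wpM2l // ler_wpM2l // ler_pdivrMr //; exact: tauj.
Qed.

End Weights.

Variables (om N : 'rV[R]_3).
Hypotheses (om1 : enorm om = 1) (N2 : enorm N <= 2).
Let k := lform N om.

Lemma gk_spec t j : j != i -> 0 <= t -> t <= 100^-1 * enorm (rel j) ->
  0 < enorm (rel j - t *: om) /\ 0 < gk om t j /\ gk om t j ^+ 2 * (1 - 2 * (t / enorm (rel j)) * (lform (rel j) om / enorm (rel j)) +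
                    (t / enorm (rel j)) ^+ 2) = 1.
Proof.
move=> ji t0 tj; have ej := rel_gt0 ji.
have := enorm_sub_sq (rel j) om t; rewrite om1 expr1n mulr1 => E.
have L := lform_normr (rel j) om; rewrite om1 mulr1 ler_norml in L; case/andP: L => L1 L2.
have rp : 0 < enorm (rel j - t *: om).
  rewrite lt_def enorm_ge0 andbT; apply/eqP => r0; move: E; rewrite r0.
  move: t0 tj ej L2; move: (lform _ _) (enorm _) => l e *; nra.
split => //; split; first by rewrite divr_gt0.
rewrite /gk; move: E rp ej; clear.
move: (enorm (rel j - _)) (enorm (rel j)) (lform _ _) => r e l E r0 e0.
have r2 : r ^+ 2 != 0 by rewrite expf_neq0 // gt_eqF.
have -> : 1 - 2 * (t / e) * (l / e) + (t / e) ^+ 2 = r ^+ 2 / e ^+ 2.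
  by rewrite E; field; rewrite gt_eqF.
by rewrite expr_div_n mulrA mulfVK // divff // expf_neq0 // gt_eqF.
Qed.

Lemma field_lip w t T tau : (forall j, 0 <= w j) -> 0 <= t -> 0 <= T -> 0 <= tau ->
  (forall j, j != i -> t <= 100^-2 * enorm (rel j)) ->
  (forall j, j != i -> T <= 100^-2 * enorm (rel j)) ->
  (forall j, j != i -> tau <= 100^-2 * enorm (rel j)) ->
  tau * `|nreg w om t - nreg w om T| <= 1000^-1 * `|t - T| /\
  tau * `|nder w om N t - nder w om N T| <= 1000^-1 * `|t - T|.
Proof.
move=> w0 t0 T0 tau0 tj Tj tauj.
have c1 : 100^-2 <= 100^-1 :> R by lra.
(* Links the Lipschitz constant 10 of the kernels and the range [100^-2] of [near_pt] to the
   tolerance [1000^-1] of the sign analysis. *)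
have E : 1000^-1 = 10 * 100^-2 :> R by field.
have d0 : 0 <= 100^-2 :> R by lra.
have K j : j != i -> `|gk om t j - gk om T j| <= 2 * `|t / enorm (rel j) - T / enorm (rel j)| /\
    `|gker om N t j - gker om N T j| <= 10 * `|t / enorm (rel j) - T / enorm (rel j)|.
  move=> ji; have ej := rel_gt0 ji.
  have tj' : t <= 100^-1 * enorm (rel j) by apply: le_trans (tj j ji) _; rewrite ler_wpM2r // ltW.
  have Tj' : T <= 100^-1 * enorm (rel j) by apply: le_trans (Tj j ji) _; rewrite ler_wpM2r // ltW.
  have [_ [g0 gE]] := gk_spec ji t0 tj'; have [_ [g0' gE']] := gk_spec ji T0 Tj'.
  apply: kernel_lip gE gE' => //.
  - by rewrite divr_ge0 ?(ltW ej) //= ler_pdivrMr.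
  - by rewrite divr_ge0 ?(ltW ej) //= ler_pdivrMr.
  - rewrite normrM normfV (gtr0_norm ej) ler_pdivrMr // mul1r.
    by have := lform_normr (rel j) om; rewrite om1 mulr1.
  - rewrite normrM normfV (gtr0_norm ej) ler_pdivrMr //.
    by apply: le_trans (lform_normr _ _) _; rewrite mulrC ler_wpM2r // ltW.
  - by have H := lform_normr N om; rewrite om1 mulr1 in H; exact: le_trans H N2.
rewrite E; split.
  rewrite /nreg opprD addrACA subrr add0r; apply: weighted_lip => // j ji.
  rewrite opprB addrA subrK.
  by apply: le_trans (K j ji).1 _; rewrite ler_wpM2r // ler_nat.
by apply: weighted_lip => // j ji; case: (K j ji).
Qed.

Lemma nreg0 w : nreg w om 0 = 1.
Proof.
rewrite /nreg big1 ?addr0 // => j _; have [->|ji] := eqVneq j i; first by rewrite wt0 mul0r.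
by rewrite /gk scale0r subr0 divff ?subrr ?mulr0 // gt_eqF // rel_gt0.
Qed.

Lemma nder0 w : nder w om N 0 = 0.
Proof. by rewrite /nder big1 // => j _; rewrite /gker !mul0r mulr0. Qed.

Lemma field_small w t : (forall j, 0 <= w j) -> 0 < t ->
  (forall j, j != i -> t <= 100^-2 * enorm (rel j)) ->
  `|nreg w om t - 1| <= 1000^-1 /\ `|nder w om N t| <= 1000^-1.
Proof.
move=> w0 t0 tj; have z j : j != i -> 0 <= 100^-2 * enorm (rel j).
  by move=> ji; rewrite mulr_ge0 ?enorm_ge0 //; lra.
have [] := field_lip w0 (ltW t0) (lexx 0) (ltW t0) tj z tj.
by rewrite nreg0 nder0 !subr0 (gtr0_norm t0) !(mulrC t) !ler_pM2r.
Qed.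

Lemma field_near w t tau : (forall j, 0 <= w j) -> 0 < t -> 0 <= tau ->
  (forall j, j != i -> t <= 100^-2 * enorm (rel j)) ->
  (forall j, j != i -> tau <= 100^-2 * enorm (rel j)) ->
  `|tau * nder w om N t| <= 1000^-1 * t.
Proof.
move=> w0 t0 tau0 tj tauj; have z j : j != i -> 0 <= 100^-2 * enorm (rel j).
  by move=> ji; rewrite mulr_ge0 ?enorm_ge0 //; lra.
have [_] := field_lip w0 (ltW t0) (lexx 0) tau0 tj z tauj.
by rewrite nder0 !subr0 (gtr0_norm t0) normrM (ger0_norm tau0).
Qed.

Definition potential w (y : 'rV[R]_3) := 1 + \sum_j w j / eucl_dist y (pt B j).

Section AtPoint.
Variables (w : 'I_n -> R) (t : R).
Hypotheses (w0 : forall j, 0 <= w j) (t0 : 0 < t).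
Hypothesis tj : forall j, j != i -> t <= 100^-2 * enorm (rel j).

Let y := pt B i + t *: om.

Let yj j : y - pt B j = t *: om - rel j.
Proof. by rewrite /y /rel opprB [RHS]addrA (addrC (t *: om)). Qed.

Let far j : j != i -> 0 < enorm (rel j - t *: om).
Proof.
move=> ji; case: (@gk_spec t j) => //; first exact: ltW.
by apply: le_trans (tj ji) _; rewrite ler_wpM2r ?enorm_ge0 //; lra.
Qed.

Lemma potentialE : potential w y = hatw w * (w i / (hatw w) / t + nreg w om t).
Proof.
have h0 := hatw_gt0 w0.
rewrite /potential (bigD1 i) //= /eucl_dist yj {1}/rel subrr subr0 enormZ om1 mulr1 gtr0_norm //.
have -> : hatw w * (w i / hatw w / t + nreg w om t) = w i / t + hatw w * nreg w om t.
  by move: h0 t0; move: (nreg w om t) (hatw w) => u v *; field; rewrite !gt_eqF.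
rewrite addrCA; congr (_ + _).
rewrite /nreg mulrDr mulr1 mulr_sumr [in RHS](bigD1 i) //= wt0 mul0r mulr0 add0r.
rewrite {1}/hatw -addrA -big_split; congr (1 + _); apply: eq_bigr => j ji /=.
rewrite /eucl_dist yj enorm_subC /wt /gk; have ej := rel_gt0 ji; have fj := far ji.
move: h0 ej fj; move: (enorm _) (enorm _) => u v *; field.
by rewrite !gt_eqF.
Qed.

Lemma potential_flux : exists l, has_grad (potential w) y l /\
  t * lform l N = hatw w * (nder w om N t - w i / hatw w * k / t).
Proof.
have h0 := hatw_gt0 w0.
exists (0 + \sum_j (- (w j / enorm (y - pt B j) ^+ 3) *: (y - pt B j))).
split.
  apply: has_gradD; first exact: has_gradC.
  apply: has_grad_sum => j; apply: has_grad_newton.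
  rewrite -subr_eq0 yj; have [->|ji] := eqVneq j i.
    by rewrite /rel subrr subr0 scaler_eq0 gt_eqF //= -enorm_eq0 om1 oner_eq0.
  by rewrite -enorm_eq0 enorm_subC gt_eqF // far.
have LS (I : Type) (r : seq I) (F : I -> 'rV[R]_3) : lform (\sum_(j <- r) F j) N = \sum_(j <- r) lform (F j) N.
  elim: r => [|j r IH]; first by rewrite !big_nil -(scale0r (0 : 'rV[R]_3)) lformZl mul0r.
  by rewrite !big_cons lformDl IH.
rewrite add0r LS (bigD1 i) //= mulrDr.
rewrite mulrBr addrC /nder [in RHS](bigD1 i) //= wt0 mul0r add0r; congr (_ + _).
  rewrite !mulr_sumr; apply: eq_bigr => j ji; rewrite yj enorm_subC -[t *: om - _]opprB scalerN scaleNr opprK lformZl.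
  have ej := rel_gt0 ji; have fj := far ji.
  rewrite lformDl lformNl lformZl (lformC om) /wt /gker /gk -/k.
  move: h0 ej fj; move: (enorm (rel j - _)) (enorm _) (lform _ _) => u v l *; field.
  by rewrite !gt_eqF.
have ri : rel i = 0 by rewrite /rel subrr.
rewrite yj ri subr0 !lformZl enormZ om1 mulr1 gtr0_norm // (lformC om) -/k.
by field; rewrite !gt_eqF.
Qed.

End AtPoint.

End NearSource.

(** * The curvature of the leaves in terms of the flux *)

Section Barrier.
Context {R : realType}.

Lemma quotient_algebra (al be a b t k chi psi x y LA LB : R) : 0 < a -> 0 < b -> 0 < t ->
  0 < al / t + chi -> 0 < be / t + psi ->
  t * LA = a * (x - al * k / t) -> t * LB = b * (y - be * k / t) ->
  t * (a * (al / t + chi) * LB + b * (be / t + psi) * LA) /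
    (a * (al / t + chi) * (b * (be / t + psi))) + k =
  rflux al be k t chi psi x y / rpot al be t chi psi.
Proof.
move=> a0 b0 t0 A0 B0 LAE LBE.
have -> : t * (a * (al / t + chi) * LB + b * (be / t + psi) * LA) =
  a * b * ((al / t + chi) * (y - be * k / t) + (be / t + psi) * (x - al * k / t)).
  transitivity (a * (al / t + chi) * (t * LB) + b * (be / t + psi) * (t * LA)); first by ring.
  by rewrite LAE LBE; ring.
have E1 : rpot al be t chi psi = t * ((al / t + chi) * (be / t + psi)).
  by rewrite /rpot; field; rewrite gt_eqF.
have E2 : rflux al be k t chi psi x y = t * ((al / t + chi) * (y - be * k / t) +
    (be / t + psi) * (x - al * k / t) + k * ((al / t + chi) * (be / t + psi))).
  by rewrite /rflux; field; rewrite gt_eqF.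
have E3 : rflux al be k t chi psi x y = t * ((al / t + chi) * (y - be * k / t) +
    (be / t + psi) * (x - al * k / t)) + k * (t * ((al / t + chi) * (be / t + psi))).
  by rewrite E2; ring.
rewrite E1 E3; move: A0 B0; move: (al / t + chi) (be / t + psi) => u v u0 v0.
by field; rewrite !gt_eqF.
Qed.

(** The graph equation says that the directional part [D] is balanced by the flux quotient at the
    radius [r1 / k]; [kap1 * kap2 = 1] is the relation [al * be = r1 ^+ 2] in units of [r1]. *)
Lemma graph_eqn_flux (kap1 kap2 r1 k chi psi xa yb Q D : R) : 0 < k -> 0 < r1 -> kap1 * kap2 = 1 ->
  let al := kap1 * r1 in let be := kap2 * r1 in
  0 < rpot al be (r1 / k) chi psi ->
  k * (k ^+ 2 + k * (kap1 * psi + kap2 * chi) + chi * psi) * D +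
  2 * (k ^+ 2 + Q) * (k ^+ 2 * (chi * psi - k ^+ 2) + k * (kap1 * yb + kap2 * xa) +
    psi * xa + chi * yb) = 0 ->
  D = - (2 * (k ^+ 2 + Q) * (rflux al be k (r1 / k) chi psi (xa / k) (yb / k) /
                             rpot al be (r1 / k) chi psi)).
Proof.
move=> k0 r0 kk al be.
have AE : al * be = r1 ^+ 2.
  by rewrite /al /be; transitivity (kap1 * kap2 * r1 ^+ 2); [ring | rewrite kk mul1r].
have E1 : rpot al be (r1 / k) chi psi =
    r1 / k * (k ^+ 2 + k * (kap1 * psi + kap2 * chi) + chi * psi).
  by rewrite /rpot AE /al /be; field; rewrite !gt_eqF.
have E2 : rflux al be k (r1 / k) chi psi (xa / k) (yb / k) = r1 / k ^+ 2 *
    (k ^+ 2 * (chi * psi - k ^+ 2) + k * (kap1 * yb + kap2 * xa) + psi * xa + chi * yb).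
  by rewrite /rflux AE /al /be; field; rewrite !gt_eqF.
rewrite E1 E2 pmulr_rgt0 ?divr_gt0 //.
move: (_ + chi * psi) (_ + chi * yb) => u v u0 H.
have -> : D = - (2 * (k ^+ 2 + Q) * v) / (k * u).
  have {}H : k * u * D = - (2 * (k ^+ 2 + Q) * v) by apply/eqP; rewrite -subr_eq0 opprK H.
  by rewrite -H mulrAC divff ?mul1r // mulf_neq0 // gt_eqF.
by field; rewrite !gt_eqF.
Qed.

Lemma small_sum_sq (e u v w y : R) : e <= 100^-1 -> - e <= u -> u <= e -> - e <= v -> v <= e ->
  - e <= w -> w <= e -> - e <= y -> y <= e ->
  (1 + u) ^+ 2 + (v * v + w * w + y * y) <= 2 ^+ 2.
Proof. by move=> *; nra. Qed.

Section Source.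
Variables (n : nat) (B : brill_lindquist R n) (i : 'I_n).

Definition conf (y : 'rV[R]_3) := chiBL B y * psiBL B y.
Definition near_pt (t : R) := forall j, j != i -> t <= 100^-2 * enorm (rel B i j).

Let a := hatw B i (alpha B).
Let b := hatw B i (beta B).
Let al := alpha B i / a.
Let be := beta B i / b.
Let a0 : 0 < a := hatw_gt0 B i (alpha_ge0 B).
Let b0 : 0 < b := hatw_gt0 B i (beta_ge0 B).
Let al0 : 0 <= al. Proof. by rewrite divr_ge0 ?alpha_ge0 // ltW. Qed.
Let be0 : 0 <= be. Proof. by rewrite divr_ge0 ?beta_ge0 // ltW. Qed.

(** By [conf_flux] this is [t] times the logarithmic derivative of [conf] along [N], plus the radial
    part of [N]: the only part of the scaled [level_curv] that varies along a ray. *)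
Definition srcE (om N : 'rV[R]_3) t :=
  rflux al be (lform N om) t (nreg B i (alpha B) om t) (nreg B i (beta B) om t)
    (nder B i (alpha B) om N t) (nder B i (beta B) om N t) /
  rpot al be t (nreg B i (alpha B) om t) (nreg B i (beta B) om t).

Section Point.
Variables (om N : 'rV[R]_3) (t : R).
Hypotheses (om1 : enorm om = 1) (N2 : enorm N <= 2) (t0 : 0 < t) (tn : near_pt t).

Lemma nreg_gt0 w : (forall j, 0 <= w j) -> 0 < nreg B i w om t.
Proof.
move=> w0; have [H _] := field_small om1 N2 w0 t0 tn.
by have [c _ _] := near1_bounds H; apply: lt_le_trans c; rewrite subr_gt0 invf_lt1 ?ltr1n ?ltr0n.
Qed.

Lemma conf_flux : exists G, [/\ has_grad conf (pt B i + t *: om) G, 0 < conf (pt B i + t *: om) &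
  t * lform G N / conf (pt B i + t *: om) + lform N om = srcE om N t].
Proof.
have [la [Ha La]] := potential_flux N om1 (alpha_ge0 B) t0 tn.
have [lb [Hb Lb]] := potential_flux N om1 (beta_ge0 B) t0 tn.
have Ea := potentialE om1 (alpha_ge0 B) t0 tn.
have Eb := potentialE om1 (beta_ge0 B) t0 tn.
exists (chiBL B (pt B i + t *: om) *: lb + psiBL B (pt B i + t *: om) *: la).
have p1 : 0 < al / t + nreg B i (alpha B) om t.
  by apply: ltr_wpDl (nreg_gt0 (alpha_ge0 B)); rewrite divr_ge0 // ltW.
have p2 : 0 < be / t + nreg B i (beta B) om t.
  by apply: ltr_wpDl (nreg_gt0 (beta_ge0 B)); rewrite divr_ge0 // ltW.
have EA : chiBL B (pt B i + t *: om) = a * (al / t + nreg B i (alpha B) om t) := Ea.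
have EB : psiBL B (pt B i + t *: om) = b * (be / t + nreg B i (beta B) om t) := Eb.
split; first exact: (has_gradM Ha Hb).
  by rewrite /conf EA EB !mulr_gt0.
rewrite lformDl !lformZl /conf EA EB /srcE.
exact: quotient_algebra.
Qed.

End Point.
Lemma srcE_increasing (om N : 'rV[R]_3) r1 t : enorm om = 1 -> enorm N <= 2 ->
  `|lform N om - 1| <= 100^-1 -> 0 < r1 -> al * be = r1 ^+ 2 -> 0 < t ->
  near_pt t -> near_pt (r1 / lform N om) -> near_pt al -> near_pt be ->
  t != r1 / lform N om -> 0 < (t - r1 / lform N om) * (srcE om N t - srcE om N (r1 / lform N om)).
Proof.
move=> om1 N2 k1 r0 AE t0 tn Tn an bn tT.
have k0 : 0 < lform N om.
  have [c _ _] := near1_bounds k1; apply: lt_le_trans c.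
  by rewrite subr_gt0 invf_lt1 ?ltr1n ?ltr0n.
have T0 : 0 < r1 / lform N om by rewrite divr_gt0.
have A0 := alpha_ge0 B; have B0 := beta_ge0 B.
have [a1 a2] := field_small om1 N2 A0 t0 tn; have [a3 a4] := field_small om1 N2 A0 T0 Tn.
have [b1 b2] := field_small om1 N2 B0 t0 tn; have [b3 b4] := field_small om1 N2 B0 T0 Tn.
have FA tau := @field_lip _ _ B i _ _ om1 N2 _ t (r1 / lform N om) tau A0 (ltW t0) (ltW T0).
have FB tau := @field_lip _ _ B i _ _ om1 N2 _ t (r1 / lform N om) tau B0 (ltW t0) (ltW T0).
have [c1 c2] := FA t (ltW t0) tn Tn tn; have [c3 c4] := FB t (ltW t0) tn Tn tn.
have [d1 d2] := FA be be0 tn Tn bn; have [d3 d4] := FB al al0 tn Tn an.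
apply: (flux_quotient_increasing (e := 1000^-1) (D := `|t - r1 / lform N om|)) => //.
exact: (flux_small (e := 1000^-1)).
Qed.

Lemma srcE_gt0 (om : 'rV[R]_3) t : enorm om = 1 -> al * be = 0 -> 0 < t -> near_pt t ->
  near_pt al -> near_pt be -> 0 < srcE om om t.
Proof.
move=> om1 AE t0 tn an bn; have N2 : enorm om <= 2 by rewrite om1 ler1n.
have A0 := alpha_ge0 B; have B0 := beta_ge0 B.
have [a1 a2] := field_small om1 N2 A0 t0 tn; have [b1 b2] := field_small om1 N2 B0 t0 tn.
have fa := field_near om1 N2 A0 t0 be0 tn bn; have fb := field_near om1 N2 B0 t0 al0 tn an.
apply: divr_gt0; last by apply: rpot_gt0 => //; [exact: (nreg_gt0 om1 N2 t0 tn A0) | exact: (nreg_gt0 om1 N2 t0 tn B0)].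
have -> : lform om om = 1 by rewrite -enorm_lform om1 expr1n.
exact: (flux_gt0 (e := 1000^-1)).
Qed.

Section Level.
Variable X : ser R.
Hypotheses (Xan : ser_an 2 X) (Xan1 : forall a, ser_an 2 (rot a X)).

Definition gradsq x := \sum_(c < 3) ev (rot c X) x * ev (rot c X) x.
Definition shape x := (kval X x ^+ 2 + gradsq x) * (\sum_(c < 3) ev (rot c (rot c X)) x) -
  kval X x * gradsq x -
  \sum_(c < 3) \sum_(d < 3) ev (rot c X) x * ev (rot d X) x * ev (rot c (rot d X)) x.

Lemma level_curv_src z : z != 0 -> near_pt (enorm z) -> enorm (Nvec X (unitv z)) <= 2 ->
  exists G, [/\ has_grad conf (pt B i + z) G, 0 < conf (pt B i + z) &
    enorm z * level_curv (conf (pt B i + z)) G (Nvec X (unitv z)) (Hmx X z) =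
    shape (unitv z) + 2 * (kval X (unitv z) ^+ 2 + gradsq (unitv z)) *
      srcE (unitv z) (Nvec X (unitv z)) (enorm z)].
Proof.
move=> z0 zn N2; have om1 := enorm_unitv z0; have t0 := enorm_gt0 z0.
have zE : enorm z *: unitv z = z by rewrite /unitv scalerA divff ?scale1r // gt_eqF.
have [G [HG G0 GE]] := conf_flux om1 N2 t0 zn; exists G; rewrite zE in HG G0 GE.
by split => //; rewrite level_curv_graph // -GE (Nvec_radial _ om1).
Qed.

Lemma Nvec_small x e : enorm x = 1 -> `|ev X x| <= e -> (forall c, `|ev (rot c X) x| <= e) ->
  e <= 100^-1 -> enorm (Nvec X x) <= 2.
Proof.
move=> x1 X1 X2 e1; rewrite -(@ler_pXn2r _ 2) ?nnegrE ?enorm_ge0 // enorm_lform.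
have xx : lform x x = 1 by rewrite -enorm_lform x1 expr1n.
have one2 : 1 < 2 :> R by rewrite ltr1n.
have x2 : enorm x < 2 by rewrite x1.
have rad1 := rgrad_radial (rgrad_ev one2 Xan x2).
rewrite (frame_grad_sq (kval X x) xx rad1) sum3 /kval.
move: (X2 o0) (X2 o1) (X2 o2) X1; rewrite !ler_norml.
move: (ev X x) (ev (rot o0 X) x) (ev (rot o1 X) x) (ev (rot o2 X) x) e1.
move=> u v w y e1 /andP[? ?] /andP[? ?] /andP[? ?] /andP[? ?]; exact: (@small_sum_sq e).
Qed.

End Level.

End Source.
End Barrier.

(** * The foliation near a source *)

Section BarrierExistence.
Context {R : realType}.

Lemma lform_dcr c (d x : 'rV[R]_3) : lform (dcr c d) x = lform d (crossx c x).
Proof.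
rewrite /lform !sum3 !crossxE !mxE !sum3.
by move: c; elim/ord3E; rewrite /lc /=; ring.
Qed.

(** Two positive numbers with the same square agree. Positivity of the [g] produced by the fixed
    point comes from [|g - 1| <= 1/2], so it is the geometric ratio of distances. *)
Lemma kernel_unique (g h k s c e l : R) : 0 < k -> `|g - 1| <= 2^-1 -> 0 < h ->
  s = e / k -> c = l -> g ^+ 2 * (k ^+ 2 - 2 * k * e * l + e ^+ 2) = k ^+ 2 ->
  h ^+ 2 * (1 - 2 * s * c + s ^+ 2) = 1 -> g = h.
Proof.
move=> k0 g1 h0 -> -> gE hE.
have g0 : 0 < g by move: g1; rewrite ler_norml => /andP[? _]; lra.
have E : 1 - 2 * (e / k) * l + (e / k) ^+ 2 = (k ^+ 2 - 2 * k * e * l + e ^+ 2) / k ^+ 2.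
  by field; rewrite gt_eqF.
have k2 : k ^+ 2 != 0 by rewrite expf_neq0 // gt_eqF.
have F : g ^+ 2 * (1 - 2 * (e / k) * l + (e / k) ^+ 2) = 1 by rewrite E mulrA gE divff.
have v0 : 1 - 2 * (e / k) * l + (e / k) ^+ 2 != 0.
  by apply/eqP => v0; move: F; rewrite v0 mulr0 => /esym/eqP; rewrite oner_eq0.
apply/eqP; rewrite -(@eqrXn2 _ 2) ?(ltW g0) ?(ltW h0) //; apply/eqP.
by apply: (mulIf v0); rewrite F hE.
Qed.

Section Source.
Variables (n : nat) (B : brill_lindquist R n) (i : 'I_n) (X : ser R).
Hypothesis Xan : ser_an 2 X.
Variables (om : 'rV[R]_3) (r1 : R) (g : 'I_n -> R).
Let al := alpha B i / hatw B i (alpha B).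
Let be := beta B i / hatw B i (beta B).
Let k := kval X om.
Hypotheses (om1 : enorm om = 1) (N2 : enorm (Nvec X om) <= 2) (k0 : 0 < k) (r0 : 0 < r1).
Hypothesis ab : al * be = r1 ^+ 2.
Hypothesis Tn : near_pt B i (r1 / k).
Let eps j := r1 / enorm (rel B i j).
Let d j := unitv (rel B i j).
Hypothesis gE : forall j, `|g j - 1| <= 2^-1 /\
  g j ^+ 2 * (k ^+ 2 - 2 * k * eps j * lform (d j) om + eps j ^+ 2) = k ^+ 2.

Lemma graph_gk j : j != i -> g j = gk B i om (r1 / k) j.
Proof.
move=> ji; have [g1 g2] := gE j.
have T0 : 0 <= r1 / k by rewrite divr_ge0 // ltW.
have Tj : r1 / k <= 100^-1 * enorm (rel B i j).
  by apply: le_trans (Tn ji) _; rewrite ler_wpM2r ?enorm_ge0 // lef_pV2 ?posrE ?exprn_gt0 ?ler_eXnr ?ler1n.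
have [_ [h0 hE]] := gk_spec om1 ji T0 Tj.
apply: kernel_unique k0 g1 h0 _ _ g2 hE; first by rewrite /eps mulrAC.
by rewrite /d /unitv lformZl mulrC.
Qed.

Lemma graph_eqn_shape :
  graph_eqn (al / r1) (be / r1) eps d (wt B i (alpha B)) (wt B i (beta B)) om k
    (fun c => ev (rot c X) om) (fun c e => ev (rot c (rot e X)) om) g ->
  shape X om = - (2 * (k ^+ 2 + gradsq X om) * srcE B i om (Nvec X om) (r1 / k)).
Proof.
have lN : lform (Nvec X om) om = k := Nvec_radial X om1.
pose r j := g j * (g j * (g j * (k * lform (d j) om +
  \sum_(c < 3) lform (dcr c (d j)) om * ev (rot c X) om - eps j))).
have chiE w : 1 + \sum_j wt B i w j * (g j - 1) = nreg B i w om (r1 / k).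
  rewrite /nreg; congr (1 + _); apply: eq_bigr => j _.
  by have [->|ji] := eqVneq j i; rewrite ?wt0 ?mul0r // graph_gk.
have xE w : (\sum_j wt B i w j * (1 * eps j * r j)) / k = nder B i w om (Nvec X om) (r1 / k).
  rewrite /nder mulr_suml; apply: eq_bigr => j _.
  have [->|ji] := eqVneq j i; first by rewrite wt0 !mul0r.
  rewrite /gker lN -graph_gk // /r; move: (wt B i w j) => W.
  have -> : k * lform (d j) om + \sum_(c < 3) lform (dcr c (d j)) om * ev (rot c X) om =
      lform (rel B i j) (Nvec X om) / enorm (rel B i j).
    rewrite (lformC (rel _ _ _)) /Nvec !sum3 !lformDl !lformZl !lform_dcr /d /unitv !lformZl.
    rewrite !(lformC _ (rel B i j)); move: (enorm _)^-1 => w'; rewrite -/k; ring.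
  rewrite /eps; have := rel_gt0 B ji.
  move: (lform _ _) (enorm _) (g j) k k0 => l e h kk kk0 e0; field.
  by rewrite !gt_eqF.
have YE kap w : \sum_j wt B i w j * (kap * eps j * r j) =
    kap * \sum_j wt B i w j * (1 * eps j * r j).
  by rewrite mulr_sumr; apply: eq_bigr => j _; ring.
have kr : al / r1 * (be / r1) = 1.
  by rewrite mulf_div ab -expr2 divff // expf_neq0 // gt_eqF.
have alE : al / r1 * r1 = al by rewrite divfK // gt_eqF.
have beE : be / r1 * r1 = be by rewrite divfK // gt_eqF.
have T0 : 0 < r1 / k by rewrite divr_gt0.
rewrite /graph_eqn -/r !chiE (YE (al / r1)) (YE (be / r1)) => H.
have := graph_eqn_flux k0 r0 kr _ H.
rewrite !xE !alE !beE /srcE lN; apply; apply: rpot_gt0 => //.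
- by rewrite divr_ge0 ?alpha_ge0 // ltW // hatw_gt0 //; exact: alpha_ge0.
- by rewrite divr_ge0 ?beta_ge0 // ltW // hatw_gt0 //; exact: beta_ge0.
- by apply: (nreg_gt0 om1 N2 T0 Tn) => j; exact: alpha_ge0.
- by apply: (nreg_gt0 om1 N2 T0 Tn) => j; exact: beta_ge0.
Qed.

End Source.


Lemma two_le_add (x y : R) : 0 <= x -> 0 <= y -> x * y = 1 -> 2 <= x + y.
Proof.
move=> x0 y0 xy; rewrite -(@ler_pXn2r _ 2) ?nnegrE ?addr_ge0 //.
have -> : (x + y) ^+ 2 = (x - y) ^+ 2 + 4 * (x * y) by ring.
by rewrite xy -[leLHS]add0r; apply: lerD; [exact: sqr_ge0 | lra].
Qed.

(** Since [h = t k] and [r1 = T k], comparing [h] with [r1] is comparing [t] with [T] on the same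
    ray, where the monotonicity of [E] decides the sign. *)
Lemma level_sign (t L m E E' T h r1 k : R) : 0 < t -> 0 < m -> 0 < k -> T = r1 / k -> h = t * k ->
  t * L = m * (E - E') -> (t = T -> E = E') -> (t != T -> 0 < (t - T) * (E - E')) ->
  [/\ h = r1 -> L = 0, r1 < h -> 0 < L & h < r1 -> L < 0].
Proof.
move=> t0 m0 k0 TE hE LE E0 E1.
split=> H.
- have tT : t = T by rewrite TE -H hE mulfK // gt_eqF.
  by move: LE; rewrite E0 // subrr mulr0 => /eqP; rewrite mulf_eq0 gt_eqF //= => /eqP.
- have tT : T < t by rewrite TE ltr_pdivrMr // -hE.
  have := E1; rewrite gt_eqF // => /(_ isT); rewrite pmulr_rgt0 ?subr_gt0 // => EE.
  by rewrite -(pmulr_rgt0 _ t0) LE mulr_gt0 // subr_gt0.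
- have tT : t < T by rewrite TE ltr_pdivlMr // -hE.
  have := E1; rewrite lt_eqF // => /(_ isT).
  rewrite -mulrNN !opprB pmulr_rgt0 ?subr_gt0 // => EE.
  by rewrite -oppr_gt0 -(pmulr_rgt0 _ t0) mulrN LE -mulrN opprB mulr_gt0 // subr_gt0.
Qed.

Theorem barrier_exists : exists K e0 : R, 0 < K /\ 0 < e0 /\
  forall (n : nat) (B : brill_lindquist R n) (i : 'I_n) (mu : R),
  alpha B i * beta B i != 0 -> 0 <= mu -> mu <= e0 ->
  (forall j, j != i -> alpha B i + beta B i <= mu * enorm (rel B i j)) ->
  let r1 := Num.sqrt (alpha B i * beta B i / (hatw B i (alpha B) * hatw B i (beta B))) in
  exists X : ser R, [/\ nle 2 X (K * mu), (forall c, nle 2 (rot c X) (K * mu)),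
    (forall c d, exists M, nle 2 (rot c (rot d X)) M), K * mu <= 100^-1 &
    forall z, z != 0 -> near_pt B i (enorm z) ->
    exists G, [/\ has_grad (conf B) (pt B i + z) G, 0 < conf B (pt B i + z) &
      let L := level_curv (conf B (pt B i + z)) G (Nvec X (unitv z)) (Hmx X z) in
      [/\ hlev X z = r1 -> L = 0, r1 < hlev X z -> 0 < L & hlev X z < r1 -> L < 0]]].
Proof.
have [K [eps0 [K0 [e00 H]]]] := @graph_eqn_solution R.
(* The second entry makes [K * mu <= 100^-1], so [k] is within 1/100 of 1; the third puts [al], [be]
   and [r1 / k] into the range [near_pt]. *)
exists K, (Num.min eps0 (Num.min (100^-1 / K) (100^-2))); split => //.
split; first by rewrite !lt_min e00 divr_gt0 ?invr_gt0 ?exprn_gt0 ?ltr0n.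
move=> n B i mu AB mu0; rewrite !le_min => /and3P[mu1 mu2 mu3] hyp r1.
have A1 := hatw_ge1 B i (alpha_ge0 B); have B1 := hatw_ge1 B i (beta_ge0 B).
have a0 := hatw_gt0 B i (alpha_ge0 B); have b0 := hatw_gt0 B i (beta_ge0 B).
have aP : 0 < alpha B i.
  by rewrite lt_def alpha_ge0 andbT; apply: contra_neq AB => ->; rewrite mul0r.
have bP : 0 < beta B i.
  by rewrite lt_def beta_ge0 andbT; apply: contra_neq AB => ->; rewrite mulr0.
pose al := alpha B i / hatw B i (alpha B); pose be := beta B i / hatw B i (beta B).
have al0 : 0 < al by rewrite divr_gt0.
have be0 : 0 < be by rewrite divr_gt0.
have ale : al <= alpha B i by rewrite ler_pdivrMr // ler_peMr // ltW.
have bee : be <= beta B i by rewrite ler_pdivrMr // ler_peMr // ltW.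
have rE : alpha B i * beta B i / (hatw B i (alpha B) * hatw B i (beta B)) = al * be.
  by rewrite -mulf_div.
have r2 : al * be = r1 ^+ 2 by rewrite /r1 rE sqr_sqrtr // mulr_ge0 // ltW.
have r0 : 0 < r1 by rewrite /r1 rE sqrtr_gt0 mulr_gt0.
clearbody r1; clear rE.
have kk : al / r1 * (be / r1) = 1.
  by rewrite mulf_div r2 -expr2 divff // expf_neq0 // gt_eqF.
have k1 : 0 <= al / r1 by rewrite divr_ge0 // ltW.
have k2 : 0 <= be / r1 by rewrite divr_ge0 // ltW.
have k12 := two_le_add k1 k2 kk.
(* The arithmetic-geometric mean inequality; the factor 2 leaves room for the later division by
   [k >= 1/2]. *)
have r3 : 2 * r1 <= alpha B i + beta B i.
  apply: le_trans (lerD ale bee).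
  by move: k12; rewrite -mulrDl ler_pdivlMr.
have q j v : v <= alpha B i + beta B i -> v / enorm (rel B i j) <= mu.
  (* The parameters are indexed by all sources, [i] included; at [j = i] the quotient is 0 because
     the inverse of 0 is 0. *)
  move=> vE; have [->|ji] := eqVneq j i; first by rewrite enorm_rel0 invr0 mulr0.
  by rewrite ler_pdivrMr ?rel_gt0 //; apply: le_trans vE (hyp j ji).
have nearq v : v <= alpha B i + beta B i -> near_pt B i v.
  move=> vE j ji; apply: le_trans vE _; apply: le_trans (hyp j ji) _.
  by rewrite ler_wpM2r // enorm_ge0.
have q1 : r1 <= alpha B i + beta B i.
  by apply: le_trans r3; rewrite mulr_natl mulr2n lerDl ltW.
have q2 : al <= alpha B i + beta B i by apply: le_trans ale _; rewrite lerDl ltW.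
have q3 : be <= alpha B i + beta B i by apply: le_trans bee _; rewrite lerDr ltW.
have [||||||||||||||X [X1 X2 X3 X4]] := H 'I_n mu (al / r1) (be / r1) (fun j => r1 / enorm (rel B i j))
   (fun j => unitv (rel B i j)) (wt B i (alpha B)) (wt B i (beta B)) => //.
- by move=> j; rewrite divr_ge0 ?enorm_ge0 // ltW.
- by move=> j; apply: q.
- by move=> j; rewrite mulrA divfK ?gt_eqF //; apply: q.
- by move=> j; rewrite mulrA divfK ?gt_eqF //; apply: q.
- move=> j; have [->|ji] := eqVneq (rel B i j) 0; last by rewrite enorm_unitv.
  by rewrite /unitv scaler0 (eqP (_ : enorm 0 == 0)) ?ler01 // enorm_eq0.
- by move=> j; apply: wt_ge0; exact: alpha_ge0.
- by apply: wt_sum; exact: alpha_ge0.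
- by move=> j; apply: wt_ge0; exact: beta_ge0.
- by apply: wt_sum; exact: beta_ge0.
have Kmu : K * mu <= 100^-1 by rewrite mulrC -ler_pdivlMr.
exists X; split => // z z0 zn.
have Xan := nle_an X1; have Xan1 c := nle_an (X2 c).
have om1 := enorm_unitv z0; have t0 := enorm_gt0 z0.
have x2 : enorm (unitv z) <= 2 by rewrite om1 ler1n.
have two0 : 0 <= 2 :> R by [].
have v1 := ev_le two0 X1 x2; have v2 c := ev_le two0 (X2 c) x2.
have N2 := Nvec_small Xan om1 v1 v2 Kmu.
have lN := Nvec_radial X om1.
have kn : `|kval X (unitv z) - 1| <= 100^-1.
  by rewrite /kval addrC addKr; apply: le_trans v1 Kmu.
have [kl _ _] := near1_bounds kn.
have kh : 2^-1 <= kval X (unitv z) by apply: le_trans kl; lra.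
have kp : 0 < kval X (unitv z) by apply: lt_le_trans kh.
have Tn : near_pt B i (r1 / kval X (unitv z)).
  apply: nearq; apply: le_trans r3; rewrite ler_pdivrMr // mulrC mulrA ler_peMl ?(ltW r0) //.
  by rewrite -ler_pdivrMr // mul1r.
have [g [gE geq]] := X4 _ x2.
have SH := graph_eqn_shape om1 N2 kp r0 r2 Tn gE geq.
have [G [HG G0 GE]] := level_curv_src (B := B) (i := i) Xan Xan1 z0 zn N2.
exists G; split => //.
apply: (level_sign (t := enorm z) (T := r1 / kval X (unitv z))
  (m := 2 * (kval X (unitv z) ^+ 2 + gradsq X (unitv z)))
  (E := srcE B i (unitv z) (Nvec X (unitv z)) (enorm z))
  (E' := srcE B i (unitv z) (Nvec X (unitv z)) (r1 / kval X (unitv z))) t0 _ kp) => //.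
- rewrite mulr_gt0 // ltr_wpDr ?exprn_gt0 //.
  by apply: sumr_ge0 => c _; rewrite -expr2 sqr_ge0.
- by rewrite GE SH; ring.
- by move=> <-.
have := srcE_increasing (B := B) (i := i) (t := enorm z) om1 N2 _ r0 r2 t0 zn.
by rewrite lN; apply => //; exact: nearq.
Qed.

(** For the series [0] the leaves are round spheres and [shape] vanishes, so the sign is that of the
    flux, positive by [srcE_gt0]. *)
Lemma round_barrier (n : nat) (B : brill_lindquist R n) (i : 'I_n) z :
  alpha B i * beta B i = 0 -> z != 0 -> near_pt B i (enorm z) ->
  (forall j, j != i -> alpha B i + beta B i <= 100^-2 * enorm (rel B i j)) ->
  exists G, [/\ has_grad (conf B) (pt B i + z) G, 0 < conf B (pt B i + z) &
    0 < level_curv (conf B (pt B i + z)) G (Nvec 0 (unitv z)) (Hmx 0 z)].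
Proof.
move=> AB z0 zn hyp.
have A1 := hatw_ge1 B i (alpha_ge0 B); have B1 := hatw_ge1 B i (beta_ge0 B).
have a0 := hatw_gt0 B i (alpha_ge0 B); have b0 := hatw_gt0 B i (beta_ge0 B).
have N1 : nle 2 (0 : ser R) 0 := nle0 _.
have r0 c : rot c (0 : ser R) = 0 by rewrite -[in LHS](subrr (0 : ser R)) rotB subrr.
have om1 := enorm_unitv z0; have t0 := enorm_gt0 z0.
have x2 : enorm (unitv z) <= 2 by rewrite om1 ler1n.
have two0 : 0 <= 2 :> R by [].
have ev0 : ev (0 : ser R) (unitv z) = 0.
  by apply/eqP; rewrite -normr_le0; exact: ev_le two0 N1 x2.
have Xan : ser_an 2 (0 : ser R) := nle_an N1.
have Xan1 c : ser_an 2 (rot c (0 : ser R)) by rewrite r0.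
have k1 : kval 0 (unitv z) = 1 by rewrite /kval ev0 addr0.
have NE : Nvec 0 (unitv z) = unitv z.
  rewrite /Nvec k1 scale1r big1 ?addr0 // => c _; by rewrite r0 ev0 scale0r.
have N2 : enorm (Nvec 0 (unitv z)) <= 2 by rewrite NE.
have gz : gradsq 0 (unitv z) = 0.
  by rewrite /gradsq big1 // => c _; rewrite r0 ev0 mul0r.
have sz : shape 0 (unitv z) = 0.
  rewrite /shape gz mulr0 subr0 big1 ?mulr0 ?sub0r => [|c _]; last by rewrite !r0 ev0.
  by rewrite big1 ?oppr0 // => c _; rewrite big1 // => d _; rewrite !r0 ev0 !mulr0.
have [G [HG G0 GE]] := level_curv_src (B := B) (i := i) Xan Xan1 z0 zn N2.
exists G; split => //.
rewrite sz gz k1 addr0 add0r expr1n mulr1 NE in GE.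
rewrite -(pmulr_rgt0 _ t0) NE GE mulr_gt0 //.
have nearq v : v <= alpha B i + beta B i -> near_pt B i v.
  by move=> vE j ji; apply: le_trans vE (hyp j ji).
apply: srcE_gt0 => //.
- by rewrite mulf_div AB mul0r.
- apply: nearq; apply: (@le_trans _ _ (alpha B i)); last by rewrite lerDl beta_ge0.
  by rewrite ler_pdivrMr // ler_peMr // alpha_ge0.
- apply: nearq; apply: (@le_trans _ _ (beta B i)); last by rewrite lerDr alpha_ge0.
  by rewrite ler_pdivrMr // ler_peMr // beta_ge0.
Qed.

End BarrierExistence.

(** * Distances to the other sources and constant polynomials *)

Section Constants.
Context {R : realType} {n : nat}.
Variables (B : brill_lindquist R n) (i : 'I_n).

Lemma eucl_dist_rel j : eucl_dist (pt B i) (pt B j) = enorm (rel B i j).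
Proof. by rewrite /eucl_dist enorm_subC. Qed.

(** Either the minimum is attained at another source, or there is none; in the latter case every
    condition over [j != i] is vacuous. *)
Lemma sigma_cases : (sigmaBL B i = +oo%E /\ forall j, j = i) \/
  exists j, [/\ j != i, sigmaBL B i = (enorm (rel B i j))%:E &
    forall k, k != i -> enorm (rel B i j) <= enorm (rel B i k)].
Proof.
case: (pickP (fun j => j != i)) => [j0 j0i|none].
  right; pose F j : \bar R := (eucl_dist (pt B i) (pt B j))%:E.
  have [j ji E] := @eq_bigmin _ (\bar R) _ +oo%E j0 (fun j => j != i) F j0i (fun k _ => leey _).
  exists j; split => //; first by rewrite /sigmaBL E /F eucl_dist_rel.
  move=> k ki; rewrite -lee_fin -!eucl_dist_rel -[X in (X <= _)%E]E.
  exact: (@bigmin_le_cond _ (\bar R) _ +oo%E k (fun j => j != i) F).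
left; have ni j : j = i by apply/eqP; have := none j; rewrite /= => /negbFE.
by split => //; rewrite /sigmaBL big1_seq // => j /andP[]; rewrite (ni j) eqxx.
Qed.

Lemma chi_hatE : chi_hat B i = hatw B i (alpha B).
Proof. by rewrite /chi_hat /hatw; under eq_bigr do rewrite eucl_dist_rel. Qed.

Lemma psi_hatE : psi_hat B i = hatw B i (beta B).
Proof. by rewrite /psi_hat /hatw; under eq_bigr do rewrite eucl_dist_rel. Qed.

Lemma mass_ratio_spec : 0 <= mass_ratio B i /\
  forall j, j != i -> alpha B i + beta B i <= mass_ratio B i * enorm (rel B i j).
Proof.
have ab : 0 <= alpha B i + beta B i by rewrite addr_ge0 ?alpha_ge0 ?beta_ge0.
rewrite /mass_ratio; have [[-> ni]|[j [ji -> jmin]]] := sigma_cases.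
  by rewrite invey mule0 /=; split => // j; rewrite (ni j) eqxx.
have e0 := rel_gt0 B ji.
rewrite inver gt_eqF //= ; split; first by rewrite divr_ge0 // ltW.
move=> k ki; rewrite mulrAC ler_pdivlMr // ler_wpM2l //; exact: jmin.
Qed.

Lemma near_sourceP C x : 0 < C ->
  near_source B i C x <-> forall j, j != i -> eucl_dist x (pt B i) <= C^-1 * enorm (rel B i j).
Proof.
move=> C0; rewrite /near_source /=; have [[-> ni]|[j [ji -> jmin]]] := sigma_cases.
  rewrite inver gt_eqF // gt0_mulye ?lte_fin ?invr_gt0 // leey.
  by split => // _ j; rewrite (ni j) eqxx.
rewrite inver gt_eqF // -EFinM lee_fin mulrC; split=> [H k ki|]; last exact.
by apply: le_trans H _; rewrite ler_wpM2l ?invr_ge0 ?(ltW C0) // jmin.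
Qed.

Lemma eval3_const (c x y z : R) : eval3 (c%:P%:P%:P) x y z = c.
Proof. by rewrite /eval3 !hornerC. Qed.

Lemma nneg_const (c : R) : 0 <= c -> nneg_coefs (c%:P%:P%:P).
Proof.
move=> c0 p q r; rewrite !coefC; case: (p == 0%N); last by rewrite !coef0.
by rewrite coefC; case: (q == 0%N); rewrite ?coef0 // coefC; case: ifP.
Qed.

End Constants.

(** * Maximum principle *)

Section MinimalSurfaces.
Context {R : realType}.

Lemma immersion_continuous (M : closed_surface R) (F : M -> 'rV[R]_3) :
  smooth_immersion F -> continuous F.
Proof.
move=> iF x; have [cov _] := @atlas_smooth R M; have [c Ac dx] := cov x.
have [sF _] := iF c Ac.
have oD := chart_dom_open c.
have cm : {for x, continuous (chart_map c)}.
  by have := @chart_map_continuous _ _ c; rewrite continuous_open_subspace // => /(_ x); apply; exact/mem_set.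
have cf : {for chart_map c x, continuous (F \o chart_par c)}.
  by apply: (sF 0%N); exact: chart_map_img.
have E : \forall y \near x, ((F \o chart_par c) \o chart_map c) y = F y.
  by near=> y; rewrite /= chart_mapK //; near: y; exact: open_nbhs_nbhs.
have cc : F (chart_par c (chart_map c y)) @[y --> x] --> F (chart_par c (chart_map c x)) :=
  continuous_comp cm cf.
rewrite (chart_mapK dx) in cc.
apply: cvg_trans cc; exact: (near_eq_cvg E).
Unshelve. all: by end_near.
Qed.

(** Both [w] and [N] are multiples of the plane normal [cr]. As [N] has a component along [om], so
    does [cr], and [w] orthogonal to [om] must be the zero multiple. *)
Lemma perp_plane (D s t : R) (cr w N om : 'rV[R]_3) : D != 0 ->
  (forall i, D * w 0 i = s * cr 0 i) -> (forall i, D * N 0 i = t * cr 0 i) ->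
  lform w om = 0 -> lform N om != 0 -> w = 0.
Proof.
move=> D0 wE NE w0 N0.
have E (v : 'rV[R]_3) a : (forall i, D * v 0 i = a * cr 0 i) -> D * lform v om = a * lform cr om.
  move=> H; rewrite -!lformZl; congr lform; apply/rowP => i.
  by rewrite !mxE H.
have c0 : lform cr om != 0.
  apply/eqP => c0; move/eqP: (E _ _ NE); rewrite c0 mulr0 mulf_eq0 (negPf D0) /=.
  by rewrite (negPf N0).
have s0 : s = 0.
  by apply/eqP; move/eqP: (E _ _ wE); rewrite w0 mulr0 eq_sym mulf_eq0 (negPf c0) orbF.
apply/rowP => i; rewrite mxE; apply/eqP; move/eqP: (wE i).
by rewrite s0 mul0r mulf_eq0 (negPf D0).
Qed.

Section Immersed.
Variables (Om : 'rV[R]_3 -> R) (M : closed_surface R) (F : M -> 'rV[R]_3).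
Hypothesis iF : smooth_immersion F.

Lemma surface_argmax (phi : 'rV[R]_3 -> R) (l : 'rV[R]_3 -> 'rV[R]_3) :
  (forall x, has_grad phi (F x) (l (F x))) -> exists x, forall y, phi (F y) <= phi (F x).
Proof.
move=> dphi.
have [|x _ xmax] := @compact_EVT_max M R (phi \o F) setT (@surface_nonempty R M) (@surface_compact R M).
  apply: continuous_subspaceT => x; apply: continuous_comp; first exact: immersion_continuous.
  by case: (dphi x) => /differentiable_continuous.
by exists x => y; apply: xmax; rewrite inE.
Qed.

Lemma surface_crit phi l c u : (forall x, has_grad phi (F x) (l (F x))) -> atlas c -> chart_img c u ->
  (forall y, phi (F y) <= phi (F (chart_par c u))) ->
  forall a, lform (l (F (chart_par c u))) (pderiv a (F \o chart_par c) u) = 0.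
Proof.
move=> dphi Ac iu xmax a; have [sF _] := iF Ac.
exact: (level_crit (@chart_img_open _ _ c) iu sF (fun u _ => dphi _) (fun u _ => xmax _)).
Qed.

Lemma surface_max h N Hm G x :
  zero_mean_curvature (fun y => (Om y ^+ 2)%:M) F ->
  0 < Om (F x) -> has_grad Om (F x) G ->
  (forall x, has_grad h (F x) (N (F x))) -> (forall j, has_grad (fun y => N y 0 j) (F x) (row j Hm)) ->
  N (F x) != 0 -> (forall y, h (F y) <= h (F x)) ->
  level_curv (Om (F x)) G (N (F x)) Hm <= 0.
Proof.
move=> mc; have [cov _] := @atlas_smooth R M; have [c Ac dx] := cov x.
have [sF rk] := iF Ac; have iu := chart_map_img dx; have xE := chart_mapK dx.
rewrite -xE => o0 HG dh dN n0 xmax.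
apply: (level_max (@chart_img_open _ _ c) iu sF (rk _ iu) o0 HG (fun u _ => dh _) dN n0) => [u _|nu un].
  exact: xmax.
exact: (mc c Ac _ iu nu un).
Qed.

End Immersed.

Section Foliation.
Variables (n : nat) (B : brill_lindquist R n) (i : 'I_n) (X : ser R).
Hypotheses (Xan : ser_an 2 X) (Xan1 : forall c, ser_an 2 (rot c X)).
Variables (M : closed_surface R) (F : M -> 'rV[R]_3).
Hypotheses (iF : smooth_immersion F) (mc : zero_mean_curvature (gBL B) F).
Hypothesis Fi : forall x, F x <> pt B i.
Let z x := F x - pt B i.
Let L x G := level_curv (conf B (pt B i + z x)) G (Nvec X (unitv (z x))) (Hmx X (z x)).
Let curv G x := has_grad (conf B) (pt B i + z x) G /\ 0 < conf B (pt B i + z x).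
Hypothesis kpos : forall x, enorm x = 1 -> 0 < kval X x.

Let z0 x : z x != 0.
Proof. by rewrite subr_eq0; apply/eqP; exact: Fi. Qed.

Let zF x : pt B i + z x = F x.
Proof. by rewrite addrC subrK. Qed.

Let N0 x : Nvec X (unitv (z x)) != 0.
Proof.
have x1 := enorm_unitv (z0 x); apply/eqP => N0.
have := Nvec_radial X x1; rewrite N0 -(scale0r (0 : 'rV[R]_3)) lformZl mul0r => k0.
by have := kpos x1; rewrite -k0 ltxx.
Qed.

Let h y := hlev X (y - pt B i).
Let N y := Nvec X (unitv (y - pt B i)).

Let dh x : has_grad h (F x) (N (F x)).
Proof. exact: (has_grad_translate (has_grad_hlev Xan (z0 x))). Qed.

Let dN x j : has_grad (fun y => N y 0 j) (F x) (row j (Hmx X (z x))).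
Proof. exact: (has_grad_translate (has_grad_Nvec Xan Xan1 j (z0 x))). Qed.

Lemma foliation_max : exists x, (forall y, hlev X (z y) <= hlev X (z x)) /\
  forall G, curv G x -> L x G <= 0.
Proof.
have [x xmax] := surface_argmax iF dh; exists x; split => // G; rewrite /curv /L zF => -[HG G0].
exact: (surface_max iF mc G0 HG dh (dN x) (N0 x) xmax).
Qed.

(** The maximum argument applied to [-h]; negating gradient and Hessian reverses [level_curv] by
    [level_curvN]. *)
Lemma foliation_min : exists x, (forall y, hlev X (z x) <= hlev X (z y)) /\
  forall G, curv G x -> 0 <= L x G.
Proof.
have gN (f : 'rV[R]_3 -> R) y l : has_grad f y l -> has_grad (fun y => - f y) y (- l).
  move=> H; have := has_gradM (has_gradC (-1) y) H.
  rewrite scaleN1r scaler0 addr0 (_ : (fun y => -1 * _) = fun y => - f y) //.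
  by apply/funext => w; rewrite mulN1r.
pose N' y := - N y.
have dh' x : has_grad (fun y => - h y) (F x) (N' (F x)) := gN _ _ _ (dh x).
have [x xmax] := surface_argmax iF dh'; exists x; split => [y|G].
  by have := xmax y; rewrite lerN2.
rewrite /curv /L zF => -[HG G0].
rewrite -oppr_le0 -level_curvN.
apply: (surface_max (N := N') iF mc G0 HG dh' _ _ xmax); last by rewrite oppr_eq0; exact: N0.
move=> j; have -> : (fun y => N' y 0 j) = (fun y => - (N y 0 j)).
  by apply/funext => y; rewrite /N' mxE.
apply: has_grad_eq (gN _ _ _ (dN x j)) _.
by apply/rowP => c; rewrite mxE [RHS]mxE [X in - X]mxE [RHS]mxE.
Qed.

Section Leaf.
Variable r1 : R.
Hypothesis leaf : forall x, hlev X (z x) = r1.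

Lemma leafE x : z x = (r1 / kval X (unitv (z x))) *: unitv (z x).
Proof.
have x1 := enorm_unitv (z0 x); have kp := kpos x1.
rewrite -(leaf x) /hlev mulfK ?gt_eqF // /unitv scalerA divff ?scale1r //.
by rewrite gt_eqF // enorm_gt0.
Qed.

Lemma has_grad_lform (q y : 'rV[R]_3) : has_grad (lform q) y q.
Proof.
apply: has_gradP => e e0; exists 1 => // v _.
have -> : lform q (y + v) = lform q y + lform q v by rewrite !(lformC q) lformDl.
by rewrite (addrC (lform q y)) addrK subrr normr0 mulr_ge0 // ltW.
Qed.

Lemma not_constant v : ~ forall x, F x = v.
Proof.
move=> Fv; have [cov _] := @atlas_smooth R M; have [x _] := @surface_nonempty R M.
have [c Ac dx] := cov x; have [_ /(_ _ (chart_map_img dx))] := iF Ac.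
have -> : F \o chart_par c = cst v by apply/funext => u /=.
rewrite (_ : \matrix_(a < 2) _ = 0) ?mxrank0 //.
by apply/row_matrixP => a; rewrite rowK row0 /pderiv derive_cst.
Qed.

(* Where [<q, unitv .>] is maximal, the part of [q] orthogonal to the radius is normal to the
   surface, hence a multiple of [N]; as [N] has a nonzero radial component, that part vanishes. *)
Lemma leaf_covers q : enorm q = 1 -> exists x, unitv (z x) = q.
Proof.
move=> q1; have qq : lform q q = 1 by rewrite -enorm_lform q1 expr1n.
pose phi y := lform q (unitv (y - pt B i)).
pose w om := q - lform q om *: om.
pose l y := (enorm (y - pt B i))^-1 *: w (unitv (y - pt B i)).
have dphi x : has_grad phi (F x) (l (F x)).
  apply: (@has_grad_translate _ _ (lform q \o unitv) (F x) (pt B i)).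
  have D : rgrad (lform q) (unitv (z x)) (fun a => lform q (crossx a (unitv (z x)))).
    by exists q; [exact: has_grad_lform | ].
  apply: has_grad_eq (has_grad_unitv (z0 x) D) _.
  by rewrite cross_frame lform_unitv // scale1r.
have [x xmax] := surface_argmax iF dphi.
have [cov _] := @atlas_smooth R M; have [c Ac dx] := cov x.
have iu := chart_map_img dx; have xE := chart_mapK dx.
have om1 := enorm_unitv (z0 x); have oo := lform_unitv (z0 x).
have tp := enorm_gt0 (z0 x).
have [_ /(_ _ iu) /tangent_rankP g0] := iF Ac.
have P1 a : lform (w (unitv (z x))) (pderiv a (F \o chart_par c) (chart_map c x)) = 0.
  have := surface_crit iF dphi Ac iu; rewrite xE => /(_ xmax a).
  by rewrite lformZl => /eqP; rewrite mulf_eq0 invr_eq0 gt_eqF //= => /eqP.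
have P2 a : lform (N (F x)) (pderiv a (F \o chart_par c) (chart_map c x)) = 0.
  have := surface_crit iF dh Ac iu; rewrite xE => /(_ _ a); apply => y.
  by rewrite /h -!/(z _) !leaf.
set p1 := pderiv e0 _ _ in g0; set p2 := pderiv e1 _ _ in g0.
have C1 := perp_cross (etrans (lformC _ _) (P1 e0)) (etrans (lformC _ _) (P1 e1)).
have C2 := perp_cross (etrans (lformC _ _) (P2 e0)) (etrans (lformC _ _) (P2 e1)).
have wom : lform (w (unitv (z x))) (unitv (z x)) = 0.
  by rewrite /w lformDl lformNl lformZl oo mulr1 subrr.
have Nom : lform (N (F x)) (unitv (z x)) = kval X (unitv (z x)) := Nvec_radial X om1.
have kp := kpos om1.
have qom : q = lform q (unitv (z x)) *: unitv (z x).
  apply/eqP; rewrite -subr_eq0; apply/eqP.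
  by apply: (perp_plane g0 C1 C2 wom); rewrite Nom gt_eqF.
have sq : lform q (unitv (z x)) ^+ 2 = 1.
  have H c' : q = c' *: unitv (z x) -> c' ^+ 2 = 1.
    move: (unitv (z x)) oo => om oo' qc.
    by rewrite -qq qc lformZl lformC lformZl oo' mulr1 expr2.
  exact: H qom.
have [s1|s1] : lform q (unitv (z x)) = 1 \/ lform q (unitv (z x)) = -1.
- by move/eqP: sq; rewrite sqrf_eq1 => /orP[] /eqP; [left | right].
- by exists x; rewrite [in RHS]qom s1 scale1r.
(* If the maximum of [lform q (unitv .)] is -1, every point of the surface lies in the direction
   [- q]; on a single leaf that is one point, which no immersed surface is. *)
exfalso; apply: (@not_constant (pt B i + (r1 / kval X (- q)) *: - q)) => y.
have yq : unitv (z y) = - q.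
  have yy := lform_unitv (z0 y).
  apply/eqP; rewrite -subr_eq0 opprK; apply/eqP/lform_eq0/eqP.
  rewrite eq_le lform_sq andbT lformDl !(lformC _ (_ + _)) !lformDl yy qq (lformC (unitv _)).
  by have := xmax y; rewrite /phi -!/(z _) s1 => H; lra.
by rewrite -[LHS]zF leafE yq.
Qed.

End Leaf.

End Foliation.
End MinimalSurfaces.

(** * The minimal leaf *)

Section LeafSurface.
Context {R : realType}.
Variables (n : nat) (B : brill_lindquist R n) (i : 'I_n) (X : ser R) (r1 : R).
Hypotheses (Xan : ser_an 2 X) (Xan1 : forall c, ser_an 2 (rot c X)).
Hypotheses (r0 : 0 < r1) (kpos : forall x, enorm x = 1 -> 0 < kval X x).
Hypothesis inside : forall x, enorm x = 1 -> forall j, j != i -> r1 / kval X x < enorm (rel B i j).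
Hypothesis flat : forall z, z != 0 -> hlev X z = r1 -> exists G,
  [/\ has_grad (conf B) (pt B i + z) G, 0 < conf B (pt B i + z) &
      level_curv (conf B (pt B i + z)) G (Nvec X (unitv z)) (Hmx X z) = 0].

Definition leaf_map (x : sphere_surface R) : 'rV[R]_3 :=
  pt B i + (r1 / kval X (spt x)) *: spt x.

Let rk x : 0 < r1 / kval X (spt x).
Proof. by rewrite divr_gt0 // kpos //; exact: sphereP. Qed.

Let zE x : leaf_map x - pt B i = (r1 / kval X (spt x)) *: spt x.
Proof. by rewrite /leaf_map addrC addKr. Qed.

Let z_norm x : enorm (leaf_map x - pt B i) = r1 / kval X (spt x).
Proof. by rewrite zE enormZ (gtr0_norm (rk x)) (sphereP x) mulr1. Qed.

Let z0 x : leaf_map x - pt B i != 0.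
Proof. by rewrite -enorm_eq0 z_norm gt_eqF. Qed.

Let z_unit x : unitv (leaf_map x - pt B i) = spt x.
Proof. by rewrite /unitv z_norm zE scalerA mulVf ?scale1r // gt_eqF. Qed.

Let z_lev x : hlev X (leaf_map x - pt B i) = r1.
Proof. by rewrite /hlev z_unit z_norm divfK // gt_eqF // kpos //; exact: sphereP. Qed.

Let leaf_smooth b : smooth_on setT (leaf_map \o spar b).
Proof.
apply: smooth_row; first exact: openT.
move=> a; apply: sm_is_smooth; first exact: openT.
have -> : (fun u => (leaf_map \o spar b) u 0 a) =
    (fun u => pt B i 0 a + r1 * (1 + ev X (istereo b u))^-1 * istereo b u 0 a).
  by apply/funext => u; rewrite /= /leaf_map !mxE.
apply: (sm_add (f := fun=> pt B i 0 a)); first exact: sm_cst.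
apply: sm_mul; last exact: istereo_sm.
apply: sm_mul; first exact: sm_cst.
apply: sm_inv => [|u _]; last by rewrite gt_eqF // kpos // istereo_sphere.
apply: (sm_add (f := fun=> 1)); first exact: sm_cst.
apply: (sm_ev (w := 2)) => //; first by rewrite ltr1n.
  by move=> j; exact: istereo_sm.
by move=> u _; rewrite istereo_sphere ltr1n.
Qed.

Lemma leaf_immersion : smooth_immersion leaf_map.
Proof.
move=> c [b ->]; split => [|u _]; first exact: leaf_smooth.
apply: (@left_inverse_rank _ _ (fun y => stereo b (unitv (y - pt B i)))).
- by move=> a; apply: (leaf_smooth b 1%N a).1.
- move=> a.
  have d : 1 - pole b * unitv (leaf_map (spar b u) - pt B i) 0 o2 != 0.
    by rewrite z_unit; exact: istereo_pole.
  have [l Hl] := stereo_pole_has_grad a d.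
  have D : rgrad (fun y => stereo b y 0 a) (unitv (leaf_map (spar b u) - pt B i))
      (fun e => lform l (crossx e (unitv (leaf_map (spar b u) - pt B i)))) by exists l.
  eexists; apply: (@has_grad_translate _ _ ((fun y => stereo b y 0 a) \o unitv) _ (pt B i)).
  exact: has_grad_unitv (z0 _) D.
- by move=> v; rewrite /= z_unit; exact: istereoK.
Qed.

Lemma leaf_zero_curvature : zero_mean_curvature (gBL B) leaf_map.
Proof.
move=> c Ac u iu nu un; have [sF rkF] := leaf_immersion Ac.
have [G [HG G0 L0]] := flat (z0 (chart_par c u)) (z_lev _).
have zF x : pt B i + (leaf_map x - pt B i) = leaf_map x by rewrite addrC subrK.
rewrite zF in HG G0 L0.
have dh v : chart_img c v -> has_grad (fun y => hlev X (y - pt B i)) ((leaf_map \o chart_par c) v)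
    (Nvec X (unitv ((leaf_map \o chart_par c) v - pt B i))).
  by move=> _; exact: (has_grad_translate (has_grad_hlev Xan (z0 _))).
have dN j := has_grad_translate (has_grad_Nvec Xan Xan1 j (z0 (chart_par c u))).
apply: (level_const (N := fun y => Nvec X (unitv (y - pt B i)))
  (@chart_img_open _ _ c) iu sF (rkF u iu) G0 HG dh dN _ (c := r1)) => //.
- apply/eqP => N0; have x1 := enorm_unitv (z0 (chart_par c u)).
  have := Nvec_radial X x1; rewrite /= in N0; rewrite N0 -(scale0r (0 : 'rV[R]_3)) lformZl mul0r => k0.
  by have := kpos x1; rewrite -k0 ltxx.
- by move=> v _; exact: z_lev.
Qed.

Lemma leaf_minimal :
  minimal_surface B [set pt B i + (r1 / kval X w) *: w | w in @unit_sphere R].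
Proof.
exists (sphere_surface R), leaf_map; split.
- exact: leaf_immersion.
- move=> x j /eqP; have [->|ji] := eqVneq j i.
    by rewrite -subr_eq0 (negPf (z0 x)).
  rewrite -subr_eq0 => /eqP E; have := inside (sphereP x) ji.
  have -> : rel B i j = leaf_map x - pt B i.
    by rewrite /rel; apply/eqP; rewrite -subr_eq0 opprB addrA subrK -opprB E oppr0.
  by rewrite z_norm ltxx.
- exact: leaf_zero_curvature.
- apply/seteqP; split => [_ [w w1 <-]|_ [x _ <-]].
    by exists (to_sphere w1).
  by exists (spt x) => //; exact: (sphereP x).
Qed.

End LeafSurface.

Lemma inv_near1 (R : realType) (v e : R) : `|v| <= e -> e <= 100^-1 -> `|(1 + v)^-1 - 1| <= 2 * e.
Proof.
move=> ve e1; have v1 : 2^-1 <= 1 + v by move: ve; rewrite ler_norml => /andP[? _]; lra.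
have v0 : 0 < 1 + v by apply: lt_le_trans v1.
have -> : (1 + v)^-1 - 1 = - v / (1 + v) by field; rewrite gt_eqF.
rewrite normrM normrN normfV (gtr0_norm v0) ler_pdivrMr //.
have e0 : 0 <= e by apply: le_trans ve.
by apply: le_trans ve _; rewrite -mulrA mulrCA ler_peMr // -ler_pdivrMl // mulr1.
Qed.

(** * Choice of the constants and conclusion *)

Section MainTheorem.
Context {R : realType}.

Lemma nle_zero_an : ser_an 2 (0 : ser R) /\ forall c, ser_an 2 (rot c (0 : ser R)).
Proof.
have r0 c : rot c (0 : ser R) = 0 by rewrite -[in LHS](subrr (0 : ser R)) rotB subrr.
by split => [|c]; rewrite ?r0; exact: nle_an (nle0 _).
Qed.

Lemma near_source_pt (n : nat) (B : brill_lindquist R n) (i : 'I_n) C x :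
  100 ^+ 2 <= C -> near_source B i C x -> near_pt B i (enorm (x - pt B i)).
Proof.
move=> C1; have C0 : 0 < C by apply: lt_le_trans C1; rewrite exprn_gt0.
move/(near_sourceP _ _ _ C0) => H j ji; apply: le_trans (H j ji) _.
by rewrite ler_wpM2r ?enorm_ge0 // lef_pV2 ?posrE // exprn_gt0.
Qed.

(** The arithmetic-geometric mean inequality for [p] and [q]; denominators at least 1 only shrink
    the root. *)
Lemma leaf_radius_le (p q a b : R) : 0 <= p -> 0 <= q -> 1 <= a -> 1 <= b ->
  2 * Num.sqrt (p * q / (a * b)) <= p + q.
Proof.
move=> p0 q0 a1 b1; rewrite -(@ler_pXn2r _ 2) ?nnegrE ?addr_ge0 ?mulr_ge0 ?sqrtr_ge0 //.
have ab : 1 <= a * b by rewrite -[leLHS]mulr1 ler_pM.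
have ab0 : 0 < a * b by apply: lt_le_trans ab.
have pq : 0 <= p * q by rewrite mulr_ge0.
rewrite exprMn sqr_sqrtr; last by rewrite divr_ge0 // ltW.
have H : p * q / (a * b) <= p * q by rewrite ler_pdivrMr // ler_peMr.
have S := sqr_ge0 (p - q).
have -> : (p + q) ^+ 2 = (p - q) ^+ 2 + 4 * (p * q) by ring.
by move: (p * q / (a * b)) H S; rewrite expr2 => u *; lra.
Qed.

End MainTheorem.

Theorem theorem1p11 (R : realType) :
  (exists PC Pe : poly3 R,
     nneg_coefs PC /\ nneg_coefs Pe /\
     forall (n : nat) (B : brill_lindquist R n) (i : 'I_n),
       alpha B i * beta B i != 0 ->
       let C : R := class_value PC B i in
       0 < C /\
       exists eps : R, 0 < eps /\ eps^-1 <= class_value Pe B i /\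
       (mass_ratio B i < eps ->
        exists S : 'rV[R]_3 -> R,
          (forall w, unit_sphere w -> 0 < S w) /\
          let Sigma : set 'rV[R]_3 :=
            [set pt B i + S w *: w | w in @unit_sphere R] in
          let r0 : R := (Num.sqrt (chi_hat B i * psi_hat B i))^-1 in
          let s : R := Num.sqrt (alpha B i * beta B i) in
          minimal_surface B Sigma /\
          (forall x, Sigma x ->
             (r0 - C * mass_ratio B i) * s <= eucl_dist x (pt B i)
               <= (r0 + C * mass_ratio B i) * s) /\
          (Sigma `<=` near_source B i C /\
           forall Sigma' : set 'rV[R]_3,
             minimal_surface B Sigma' -> Sigma' `<=` near_source B i C ->
             Sigma' = Sigma)))
  /\
  (exists PC Pe : poly3 R,
     nneg_coefs PC /\ nneg_coefs Pe /\
     forall (n : nat) (B : brill_lindquist R n) (i : 'I_n),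
       alpha B i * beta B i = 0 ->
       let C : R := class_value PC B i in
       0 < C /\
       exists eps : R, 0 < eps /\ eps^-1 <= class_value Pe B i /\
       (mass_ratio B i < eps ->
        ~ exists Sigma : set 'rV[R]_3,
            minimal_surface B Sigma /\ Sigma `<=` near_source B i C)).
Proof.
split; last first.
  have C0 : 0 < 100 ^+ 2 :> R by rewrite exprn_gt0.
  (* [C = 100 ^+ 2] places the surface in the range [near_pt], and [eps = 100 ^- 2] supplies the
     mass bound of [round_barrier]. *)
  exists (100 ^+ 2)%:P%:P%:P, (100 ^+ 2)%:P%:P%:P.
  split; first by apply: nneg_const; exact: ltW.
  split; first by apply: nneg_const; exact: ltW.
  move=> n B i AB; rewrite /class_value !eval3_const; split => //.
  exists (100 ^- 2); rewrite invr_gt0 invrK; split => //; split => // mu1 [_ [[M [F [iF Fp mc ->]]] near]].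
  have [mu0 hyp] := mass_ratio_spec B i.
  have Fi x : F x <> pt B i by exact: Fp.
  have z0 x : F x - pt B i != 0 by rewrite subr_eq0; apply/eqP.
  have zn x : near_pt B i (enorm (F x - pt B i)) by apply: near_source_pt (lexx _) (near _ _); exists x.
  have [Xan Xan1] := @nle_zero_an R.
  have kpos x : enorm x = 1 -> 0 < kval (0 : ser R) x.
    move=> x1; have : `|ev (0 : ser R) x| <= 0.
      by apply: ev_le (nle0 2) _; rewrite ?x1 ?ler1n.
    by rewrite normr_le0 => /eqP e; rewrite /kval e addr0.
  have [y [_ yL]] := foliation_max Xan Xan1 iF mc Fi kpos.
  have [|G [HG G0 L0]] := round_barrier AB (z0 y) (zn y).
    move=> j ji; apply: le_trans (hyp j ji) _; rewrite ler_wpM2r ?enorm_ge0 //; exact: ltW.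
  by have := yL G (conj HG G0); rewrite leNgt L0.
have [K [e0 [K0 [e00 barrier]]]] := @barrier_exists R.
(* The first summand puts [near_source] inside [near_pt]; the second covers [|1 / k - 1| <= 2 K mu],
   the width of the region in (a). *)
pose C : R := 100 ^+ 2 + 2 * K.
have C1 : 100 ^+ 2 <= C by rewrite lerDl mulr_ge0 // ltW.
have C0 : 0 < C by apply: lt_le_trans C1; rewrite exprn_gt0.
have CK : 2 * K <= C by rewrite lerDr exprn_ge0.
have C2 : 1 < C by apply: lt_le_trans C1; rewrite exprn_egt1 // ltr1n.
clearbody C.
(* [mu <= C^-1] makes the constructed leaf lie in [near_source B i C] itself. *)
pose eps := Num.min e0 C^-1.
have eps0 : 0 < eps by rewrite lt_min e00 invr_gt0.
exists C%:P%:P%:P, (eps^-1)%:P%:P%:P.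
split; first by apply: nneg_const; exact: ltW.
split; first by apply: nneg_const; rewrite invr_ge0 ltW.
move=> n B i AB; rewrite /class_value !eval3_const; split => //.
exists eps; split => //; split => // mu_eps.
have [mu0 hyp] := mass_ratio_spec B i.
set mu := mass_ratio B i in mu_eps mu0 hyp *.
have mu1 : mu <= e0 by apply: le_trans (ltW mu_eps) _; rewrite ge_min lexx.
have mu2 : mu <= C^-1 by apply: le_trans (ltW mu_eps) _; rewrite ge_min lexx orbT.
have mu3 : mu < 1 by apply: le_lt_trans mu2 _; rewrite invf_lt1.
have [X [X1 X2 _ Kmu sgn]] := barrier n B i mu AB mu0 mu1 hyp.
have A1 := hatw_ge1 B i (alpha_ge0 B); have B1 := hatw_ge1 B i (beta_ge0 B).
have ab0 : 0 <= alpha B i * beta B i by rewrite mulr_ge0 ?alpha_ge0 ?beta_ge0.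
have hat1 : 1 <= hatw B i (alpha B) * hatw B i (beta B) by rewrite -[leLHS]mulr1 ler_pM.
have hat0 := lt_le_trans (ltr01 : 0 < 1 :> R) hat1.
have r1le := leaf_radius_le (alpha_ge0 B i) (beta_ge0 B i) A1 B1.
set r1 := Num.sqrt _ in sgn r1le.
have r0 : 0 < r1 by rewrite sqrtr_gt0 divr_gt0 // lt_def AB ab0.
have rE : r1 = (Num.sqrt (hatw B i (alpha B) * hatw B i (beta B)))^-1 * Num.sqrt (alpha B i * beta B i).
  by rewrite /r1 sqrtrM // sqrtrV ?(ltW hat0) // mulrC.
clearbody r1.
have Xan := nle_an X1; have Xan1 c := nle_an (X2 c).
have two0 : 0 <= 2 :> R by [].
have evb w : enorm w = 1 -> `|ev X w| <= K * mu.
  by move=> w1; apply: ev_le two0 X1 _; rewrite w1 ler1n.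
have kinv w : enorm w = 1 -> `|(kval X w)^-1 - 1| <= 2 * (K * mu).
  by move=> w1; apply: inv_near1 (evb w w1) Kmu.
have kh w : enorm w = 1 -> 2^-1 <= kval X w.
  move=> /evb /le_trans /(_ Kmu); rewrite ler_norml => /andP[H _].
  by rewrite /kval; lra.
have kpos w : enorm w = 1 -> 0 < kval X w by move=> /kh; apply: lt_le_trans.
have rk w j : enorm w = 1 -> j != i -> r1 / kval X w <= mu * enorm (rel B i j).
  move=> w1 ji; apply: le_trans (le_trans r1le (hyp j ji)).
  rewrite ler_pdivrMr ?kpos // mulrC mulrA ler_peMl ?(ltW r0) //.
  by rewrite -ler_pdivrMr // mul1r kh.
have dist w : enorm w = 1 -> eucl_dist (pt B i + (r1 / kval X w) *: w) (pt B i) = r1 / kval X w.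
  move=> w1; rewrite /eucl_dist addrC addKr enormZ w1 mulr1 gtr0_norm //.
  by rewrite divr_gt0 ?kpos.
exists (fun w => r1 / kval X w); split; first by move=> w w1; rewrite divr_gt0 ?kpos.
split; [|split; [|split]].
- apply: leaf_minimal => //.
    move=> w w1 j ji; apply: le_lt_trans (rk w j w1 ji) _.
    by rewrite gtr_pMl // rel_gt0.
  move=> z z0 zr; have zn : near_pt B i (enorm z).
    move=> j ji; have u1 := enorm_unitv z0.
    have -> : enorm z = r1 / kval X (unitv z) by rewrite -zr /hlev mulfK // gt_eqF // kpos.
    apply: le_trans (rk _ j u1 ji) _; rewrite ler_wpM2r ?enorm_ge0 //.
    by apply: le_trans mu2 _; rewrite lef_pV2 ?posrE // exprn_gt0.
  by have [G [HG G0 [L0 _ _]]] := sgn z z0 zn; exists G; split => //; exact: L0.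
- move=> _ [w w1 <-]; rewrite dist // rE chi_hatE psi_hatE.
  set t := (Num.sqrt _)^-1; set s := Num.sqrt (alpha B i * beta B i).
  have s0 : 0 <= s by exact: sqrtr_ge0.
  (* The hatted values are at least 1. Hence the deviation of [t * s / k] from [t * s] is at most
     [2 K mu s], within [C mu s]. *)
  have t1 : 0 <= t <= 1.
    rewrite invr_ge0 sqrtr_ge0 /= invf_le1 ?sqrtr_gt0 //.
    by rewrite -[leLHS]sqrtr1 ler_wsqrtr.
  have [t2 t3] := andP t1.
  have := normM_le (_ : `|t * s| <= s) (kinv w w1); rewrite mulrBr mulr1.
  move=> /(_ _) H.
  have {}H : `|t * s / kval X w - t * s| <= s * (2 * (K * mu)).
    by apply: H; rewrite ger0_norm ?mulr_ge0 // ler_piMl.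
  have D : s * (2 * (K * mu)) <= C * mu * s.
    by rewrite mulrC ler_wpM2r // mulrA ler_wpM2r.
  have := le_trans H D; rewrite ler_distl mulrBl mulrDl => /andP[-> ->] //.
- move=> _ [w w1 <-]; apply/near_sourceP => // j ji; rewrite dist //.
  by apply: le_trans (rk w j w1 ji) _; rewrite ler_wpM2r ?enorm_ge0.
move=> _ [M [F [iF Fp mc ->]]] near.
have Fi x : F x <> pt B i by exact: Fp.
have z0 x : F x - pt B i != 0 by rewrite subr_eq0; apply/eqP.
have zn x : near_pt B i (enorm (F x - pt B i)) by apply: near_source_pt C1 (near _ _); exists x.
have leaf x : hlev X (F x - pt B i) = r1.
  apply/eqP; rewrite eq_le; apply/andP; split.
    have [y [ymax yL]] := foliation_max Xan Xan1 iF mc Fi kpos.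
    apply: le_trans (ymax x) _; rewrite leNgt; apply/negP => H.
    have [G [HG G0 [_ Lp _]]] := sgn _ (z0 y) (zn y).
    by have := yL G (conj HG G0); rewrite leNgt Lp.
  have [y [ymin yL]] := foliation_min Xan Xan1 iF mc Fi kpos.
  apply: le_trans (ymin x); rewrite leNgt; apply/negP => H.
  have [G [HG G0 [_ _ Ln]]] := sgn _ (z0 y) (zn y).
  by have := yL G (conj HG G0); rewrite leNgt Ln.
apply/seteqP; split => [_ [x _ <-]|_ [w w1 <-]].
  exists (unitv (F x - pt B i)); first exact: enorm_unitv.
  by rewrite -(leafE Fi kpos leaf) addrC subrK.
have [x xw] := leaf_covers Xan iF Fi kpos leaf w1.
exists x => //; rewrite -xw -(leafE Fi kpos leaf) addrC subrK //.
Qed.
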